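(* There exists a polynomially convex arc $J$ in $\mathbb{C}^3$ that meets the closed unit ball $\overline{\mathbb{B}}$ of $\mathbb{C}^3$ in a single end point (that is, $J\cap\overline{\mathbb{B}}=\{a\}$ where $a$ is an end point of $J$) such that $\overline{\mathbb{B}}\cup J$ is not rationally convex.
   Context: An arc is a space homeomorphic to the closed unit interval. For a compact set $X\subset\mathbb{C}^N$, the polynomial hull is $\widehat X=\{z\in\mathbb{C}^N:|p(z)|\le\max_{x\in X}|p(x)|\text{ for all polynomials }p\}$ and the rational hull is $h_r(X)=\{z\in\mathbb{C}^N:p(z)\in p(X)\text{ for all polynomials }p\}$, where polynomials are in the complex coordinates. $X$ is polynomially convex if $\widehat X=X$ and rationally convex if $h_r(X)=X$. *)

(* Defs.v *)
From mathcomp Require Import all_boot all_order all_algebra.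
From mathcomp Require Import all_classical all_reals all_analysis.
From mathcomp Require Import complex.
(* Not imported: the notations of mpoly clash with those of analysis. *)
From mathcomp Require mpoly.

Set Implicit Arguments.
Unset Strict Implicit.
Unset Printing Implicit Defensive.

Import Order.TTheory GRing.Theory Num.Theory.
Import numFieldNormedType.Exports.

Local Open Scope ring_scope.
Local Open Scope classical_set_scope.

Section homeomorphisms.
Variables T U : topologicalType.

(* [f] restricts to a homeomorphism of the subspace [A] of [T] onto the
   subspace [B] of [U]. *)
Definition homeomorphism_on (A : set T) (B : set U) (f : T -> U) : Prop :=
  [/\ {within A, continuous f}, set_bij A B f &
      exists2 g : U -> T, {within B, continuous g} & {in A, cancel f g}].

End homeomorphisms.

Section arcs.
Variables (R : realType) (U : topologicalType).

Definition is_arc (J : set U) : Prop :=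
  exists f : R -> U, homeomorphism_on (`[0, 1] : set R) J f.

Definition is_arc_end_point (J : set U) (a : U) : Prop :=
  exists2 f : R -> U, homeomorphism_on (`[0, 1] : set R) J f & a = f 0 \/ a = f 1.

End arcs.

(* R[i] has no topology in the library, but the regular module R[i]^o carries
   the metric topology of the modulus, and row vectors over it the product
   topology, i.e. the usual topology of C^n. *)
Definition Cspace (R : realType) (n : nat) : topologicalType :=
  'rV[(R[i])^o]_n.

Section hulls.
Variables (R : realType) (n : nat).
Implicit Types (p : mpoly.mpoly n R[i]) (z : Cspace R n) (X : set (Cspace R n)).

Definition coords z : 'I_n -> R[i] := fun i => (z : 'rV_n) ord0 i.

Definition peval p z : R[i] := mpoly.meval (coords z) p.

(* The modulus as an element of R; the norm of R[i] takes its values in R[i]. *)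
Definition modulus (w : R[i]) : R := ComplexField.Normc.normc w.

(* The Euclidean ball; the library norm of row vectors is the sup norm. *)
Definition closed_unit_ball : set (Cspace R n) :=
  [set z | \sum_(i < n) modulus (coords z i) ^+ 2 <= 1].

(* Meant for compact X, on which the supremum is a maximum when X is nonempty.
   For empty X, sup set0 = 0 and p = 1 shows that the hull is empty. *)
Definition polynomial_hull X : set (Cspace R n) :=
  [set z | forall p,
    modulus (peval p z) <= sup [set modulus (peval p x) | x in X]].

Definition rational_hull X : set (Cspace R n) :=
  [set z | forall p, (peval p @` X) (peval p z)].

Definition polynomially_convex X : Prop := polynomial_hull X = X.

Definition rationally_convex X : Prop := rational_hull X = X.

End hulls.

(* Main.v *)
Require Import Defs.
From mathcomp Require Import all_boot all_order all_algebra.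
From mathcomp Require Import all_classical all_reals all_analysis.
From mathcomp Require Import complex ring lra.
From mathcomp Require Import cyclic separable cyclotomic.
From mathcomp Require Import (canonicals, coercions) mpoly.

(** The example is a Cantor set with a large rational hull, of a kind that goes back to
   Wermer and Rudin, placed so that a ball takes care of the outside.

   Let E be the product of two middle-third Cantor sets in C = R^2, mu the uniform
   probability measure on E, and g the Cauchy transform of mu, that is,
   g(z) = int dmu(a) / (z - a).  As E has dimension greater than 1, g is continuous on the
   whole plane (limit_field_ucont); it is holomorphic off E, and close to 1 / z far away.
   Consider the map F(z) = (z/200, 4 g(z), 8 (1 - z g(z))).  If |z| is about 60 then
   F(z) lies in the unit ball, whereas F(E) is outside the ball, since g(z) and 1 - z g(z)
   cannot be both small for bounded z.

   Let the polynomial p have no zero in the ball and on F(E).  The argument of p(F(z)) does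
   not wind along the circle |z| = 60, because its image can be contracted in the ball, nor
   along small circles around the pieces of the totally disconnected set E, because their
   images are close to single points of F(E).  By the argument principle p(F(z)) has no zero
   in between, in particular p(F(0)) <> 0.  Here F(0) = (0, 0, 8), as g(0) = 0 by symmetry.
   Thus (0, 0, 8) is in the rational hull of the union of the ball and any set containing
   F(E).  In the formal proof g is replaced
   by the fields g_n of 4 ^ n point masses, which makes p(F(z)) a rational function of z.
   Its zeros and poles are counted by Rouche's theorem (count_roots_outer, count_roots_hole,
   no_avoiding_hypersurface), which for polynomials follows from the mean value property.

   It remains to draw a polynomially convex arc J through F(E).  A variant of Lebesgue's
   curve is an injective path z(t) through E, and there is a height h(t) >= 0 that vanishes
   exactly where z(t) is in E and takes each positive value only finitely often.  The arc
   consists of the points F(z(t)) + (0, 0, h(t)).  In suitable polynomial coordinates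
   (z, w, c) of C^3 these are the points (z(t), g(z(t)), h(t)).  As c is real on J, the
   polynomial hull of J can be determined in each fibre of c separately
   (hull_le_near_fibre).  The fibres over c > 0 are finite.  The fibre over 0 is a graph
   over E, and by Runge's theorem the polynomials in z are dense in the continuous functions
   on E; the complement of E is so simple that poles can be pushed to infinity along lines
   (cantor_square_inv_poly, cantor_square_peak).  A segment in front of the path z(t)
   leads to a point with |z| about 61, hence into the ball; J starts where the path leaves
   the ball for the last time (last_exit). *)

Set Implicit Arguments.
Unset Strict Implicit.
Unset Printing Implicit Defensive.

Import Order.TTheory GRing.Theory Num.Theory.
Import numFieldNormedType.Exports.
Import ComplexField.

Local Open Scope classical_set_scope.
Local Open Scope ring_scope.
Local Open Scope complex_scope.

Local Notation Re := complex.Re.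
Local Notation Im := complex.Im.

(** * The modulus of complex numbers *)

Section modulus_theory.
Variable R : realType.
Implicit Types (z w : R[i]) (a b : R).

Lemma modulus_sqr z : modulus z ^+ 2 = Re z ^+ 2 + Im z ^+ 2.
Proof. by case: z => a b; rewrite /modulus /= sqr_sqrtr// addr_ge0 ?sqr_ge0. Qed.

Lemma modulus_ge0 z : 0 <= modulus z.
Proof. by case: z => a b; rewrite /modulus /= sqrtr_ge0. Qed.

Lemma modulus0 : modulus (0 : R[i]) = 0.
Proof. exact: Normc.normc0. Qed.

Lemma modulus1 : modulus (1 : R[i]) = 1.
Proof. exact: Normc.normc1. Qed.

Lemma modulus_eq0 z : (modulus z == 0) = (z == 0).
Proof.
by apply/eqP/eqP => [/(@Normc.eq0_normc R)//|->]; exact: modulus0.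
Qed.

Lemma modulus_gt0 z : (0 < modulus z) = (z != 0).
Proof. by rewrite lt_def modulus_ge0 andbT modulus_eq0. Qed.

Lemma modulusM z w : modulus (z * w) = modulus z * modulus w.
Proof. exact: Normc.normcM. Qed.

Lemma modulusV z : modulus z^-1 = (modulus z)^-1.
Proof. exact: Normc.normcV. Qed.

Lemma modulusN z : modulus (- z) = modulus z.
Proof. exact: normcN. Qed.

Lemma modulusB z w : modulus (z - w) = modulus (w - z).
Proof. by rewrite -modulusN opprB. Qed.

Lemma modulusD z w : modulus (z + w) <= modulus z + modulus w.
Proof. exact: le_normcD. Qed.

Lemma modulus_triangle z w x : modulus (z - x) <= modulus (z - w) + modulus (w - x).
Proof. by rewrite (_ : z - x = (z - w) + (w - x)) ?modulusD//; ring. Qed.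

Lemma modulus_ge z w : modulus z - modulus w <= modulus (z + w).
Proof. by have := modulusD (z + w) (- w); rewrite addrK modulusN; lra. Qed.

Lemma modulusX z n : modulus (z ^+ n) = modulus z ^+ n.
Proof.
by elim: n => [|n IH]; rewrite ?expr0 ?modulus1// !exprS modulusM IH.
Qed.

Lemma modulus_real a : modulus a%:C = `|a|.
Proof. by rewrite /modulus /= expr0n/= addr0 sqrtr_sqr. Qed.

Lemma modulus_realM a z : modulus (a%:C * z) = `|a| * modulus z.
Proof. by rewrite modulusM modulus_real. Qed.

Lemma modulusJ z : modulus (conjc z) = modulus z.
Proof. by case: z => a b; rewrite /modulus /= sqrrN. Qed.

Lemma modulus_sum (I : Type) (r : seq I) (F : I -> R[i]) :
  modulus (\sum_(i <- r) F i) <= \sum_(i <- r) modulus (F i).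
Proof.
elim: r => [|i r IH]; first by rewrite !big_nil modulus0.
by rewrite !big_cons (le_trans (modulusD _ _))// lerD2l.
Qed.

Lemma Re_le_modulus z : `|Re z| <= modulus z.
Proof.
rewrite -(ler_pXn2r (n := 2)) ?nnegrE ?modulus_ge0// modulus_sqr real_normK ?num_real//.
by rewrite lerDl sqr_ge0.
Qed.

Lemma Im_le_modulus z : `|Im z| <= modulus z.
Proof.
rewrite -(ler_pXn2r (n := 2)) ?nnegrE ?modulus_ge0// modulus_sqr real_normK ?num_real//.
by rewrite lerDr sqr_ge0.
Qed.

Lemma modulus_le_ReIm z : modulus z <= `|Re z| + `|Im z|.
Proof.
rewrite -(ler_pXn2r (n := 2)) ?nnegrE ?modulus_ge0 ?addr_ge0// modulus_sqr.
rewrite -[Re z ^+ 2]real_normK ?num_real// -[Im z ^+ 2]real_normK ?num_real//.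
by have := mulr_ge0 (normr_ge0 (Re z)) (normr_ge0 (Im z)); nra.
Qed.

Lemma mulcJ z : z * conjc z = (modulus z ^+ 2)%:C.
Proof.
rewrite modulus_sqr; case: z => a b; apply/eqP; rewrite eq_complex /=.
by apply/andP; split; apply/eqP; ring.
Qed.

Lemma exp_lt_eps (r e : R) : 0 <= r < 1 -> 0 < e -> exists n, r ^+ n < e.
Proof.
move=> /andP[r0 r1] e0.
have := @cvg_expr R r; rewrite ger0_norm// => /(_ r1) /cvgrPdist_lt /(_ e e0) [n _ hn].
exists n; have := hn n (leqnn n); rewrite sub0r normrN ger0_norm// exprn_ge0//.
Qed.

End modulus_theory.

(** * Uniform limits of polynomials on a plane set *)

Section uniform_limits_of_polynomials.
Variables (R : realType) (X : set R[i]).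

Definition unif_poly_limit (f : R[i] -> R[i]) := forall e : R, 0 < e ->
  exists p : {poly R[i]}, forall z, X z -> modulus (p.[z] - f z) <= e.

Lemma upl_poly (p : {poly R[i]}) : unif_poly_limit (horner p).
Proof. by move=> e e0; exists p => z _; rewrite subrr modulus0 ltW. Qed.

Lemma upl_ext f h : (forall z, X z -> f z = h z) ->
  unif_poly_limit f -> unif_poly_limit h.
Proof. by move=> fh Hf e /Hf[p Hp]; exists p => z Xz; rewrite -fh// Hp. Qed.

Lemma upl_const c : unif_poly_limit (fun=> c).
Proof. by apply: (upl_ext _ (upl_poly c%:P)) => z _; rewrite hornerC. Qed.

Lemma uplD f h : unif_poly_limit f -> unif_poly_limit h ->
  unif_poly_limit (fun z => f z + h z).
Proof.
move=> Hf Hh e e0; have e2 : 0 < e / 2 by lra.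
have [p Hp] := Hf _ e2; have [q Hq] := Hh _ e2.
exists (p + q) => z Xz; rewrite hornerD.
rewrite (_ : _ - _ = (p.[z] - f z) + (q.[z] - h z)); last by ring.
by have := modulusD (p.[z] - f z) (q.[z] - h z); have := Hp z Xz; have := Hq z Xz; lra.
Qed.

Lemma upl_closed f : (forall e : R, 0 < e -> exists2 h, unif_poly_limit h &
  forall z, X z -> modulus (h z - f z) <= e) -> unif_poly_limit f.
Proof.
move=> H e e0; have e2 : 0 < e / 2 by lra.
have [h Hh hf] := H _ e2; have [p Hp] := Hh _ e2; exists p => z Xz.
by have := modulus_triangle p.[z] (h z) (f z); have := Hp z Xz; have := hf z Xz; lra.
Qed.

Hypothesis Xbounded : exists B : R, forall z, X z -> modulus z <= B.

Lemma poly_bounded (p : {poly R[i]}) :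
  exists2 M : R, 0 < M & forall z, X z -> modulus p.[z] <= M.
Proof.
have [B HB] := Xbounded; elim/poly_ind: p => [|p c [M M0 HM]].
  by exists 1 => // z _; rewrite horner0 modulus0.
exists (M * `|B| + modulus c + 1).
  by have := mulr_ge0 (ltW M0) (normr_ge0 B); have := modulus_ge0 c; lra.
move=> z Xz; rewrite hornerMXaddC (le_trans (modulusD _ _))// modulusM.
have zB : modulus z <= `|B| by rewrite (le_trans (HB z Xz))// ler_norm.
by have := ler_pM (modulus_ge0 p.[z]) (modulus_ge0 z) (HM z Xz) zB; lra.
Qed.

Lemma upl_bounded f : unif_poly_limit f ->
  exists2 M : R, 0 < M & forall z, X z -> modulus (f z) <= M.
Proof.
move=> /(_ 1 ltr01)[p Hp]; have [M M0 HM] := poly_bounded p.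
exists (M + 1) => [|z Xz]; first by lra.
have := modulusD p.[z] (f z - p.[z]); rewrite [_ + (_ - _)]addrC subrK.
by have := Hp z Xz; rewrite modulusB; have := HM z Xz; lra.
Qed.

Lemma uplM f h : unif_poly_limit f -> unif_poly_limit h ->
  unif_poly_limit (fun z => f z * h z).
Proof.
move=> Hf Hh e e0; have [M M0 HM] := upl_bounded Hf.
have e1 : 0 < e / 2 / M by rewrite !divr_gt0.
have [q Hq] := Hh _ e1; have [K K0 HK] := poly_bounded q.
have e2 : 0 < e / 2 / K by rewrite !divr_gt0.
have [p Hp] := Hf _ e2.
exists (p * q) => z Xz; rewrite hornerM.
rewrite (_ : _ - _ = (p.[z] - f z) * q.[z] + f z * (q.[z] - h z)); last by ring.
rewrite (le_trans (modulusD _ _))// !modulusM.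
have := ler_pM (modulus_ge0 _) (modulus_ge0 _) (Hp z Xz) (HK z Xz).
have := ler_pM (modulus_ge0 _) (modulus_ge0 _) (HM z Xz) (Hq z Xz).
rewrite divfK ?gt_eqF// (mulrC M) divfK ?gt_eqF//; lra.
Qed.

Lemma upl_exp f n : unif_poly_limit f -> unif_poly_limit (fun z => f z ^+ n).
Proof.
move=> Hf; elim: n => [|n IH]; first exact: upl_const.
by apply: (upl_ext _ (uplM Hf IH)) => z _; rewrite exprS.
Qed.

(** The partial sums of the geometric series converge uniformly.  The functions 1 / (z - b)
   are reduced to this case. *)
Lemma upl_geometric h (r : R) : 0 <= r < 1 -> (forall z, X z -> modulus (h z) <= r) ->
  unif_poly_limit h -> unif_poly_limit (fun z => (1 - h z)^-1).
Proof.
move=> /andP[r0 r1] hr Hh; apply: upl_closed => e e0.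
have [n Hn] : exists n, r ^+ n < e * (1 - r).
  by apply: exp_lt_eps; rewrite ?r0//; nra.
exists (fun z => \sum_(i < n) h z ^+ i).
  elim: n {Hn} => [|n IH].
    by apply: (upl_ext _ (upl_const 0)) => z _; rewrite big_ord0.
  by apply: (upl_ext _ (uplD IH (upl_exp n Hh))) => z _; rewrite big_ord_recr.
move=> z Xz; have hz := hr z Xz.
have h1 : 1 - r <= modulus (1 - h z).
  by have := modulus_ge 1 (- h z); rewrite modulus1 modulusN; lra.
have h10 : 1 - h z != 0 by rewrite -modulus_gt0; lra.
have -> : \sum_(i < n) h z ^+ i - (1 - h z)^-1 = - (h z ^+ n / (1 - h z)).
  have := subrX1 (h z) n; set S := \sum_(_ < _) _ => hS.
  have -> : h z ^+ n = (h z - 1) * S + 1 by rewrite -hS subrK.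
  by field.
rewrite modulusN modulusM modulusV modulusX.
rewrite ler_pdivrMr; last by lra.
have : modulus (h z) ^+ n <= r ^+ n by rewrite lerXn2r ?nnegrE ?modulus_ge0.
by nra.
Qed.

Lemma upl_inv_far b (r : R) : 0 <= r < 1 -> b != 0 ->
  (forall z, X z -> modulus z <= r * modulus b) -> unif_poly_limit (fun z => (z - b)^-1).
Proof.
move=> r01 b0 H; have mb : 0 < modulus b by rewrite modulus_gt0.
apply: (@upl_ext (fun z => (- b)^-1 * (1 - b^-1 * z)^-1)) => [z Xz|].
  have zb : z - b != 0.
    by rewrite subr_eq0; apply: contraTneq (H z Xz) => ->; rewrite -ltNge; nra.
  have -> : 1 - b^-1 * z = - b^-1 * (z - b) by field.
  by field; rewrite zb b0.
apply: uplM (upl_const _) (upl_geometric r01 _ _) => [z Xz|].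
  by rewrite modulusM modulusV mulrC ler_pdivrMr// H.
by apply: (@upl_ext (horner (b^-1 *: 'X))) (upl_poly _) => z _; rewrite hornerZ hornerX.
Qed.

(** Pole pushing: since 1 / (z - b') = u / (1 - (b' - b) u) with u = 1 / (z - b), a pole
   can be moved by half its distance to X. *)
Lemma upl_inv_push b b' (d : R) : 0 < d -> (forall z, X z -> d <= modulus (z - b)) ->
  modulus (b' - b) <= d / 2 -> unif_poly_limit (fun z => (z - b)^-1) ->
  unif_poly_limit (fun z => (z - b')^-1).
Proof.
move=> d0 H bb Hb; pose h z := (b' - b) * (z - b)^-1.
have Hh : unif_poly_limit h by apply: uplM Hb; exact: upl_const.
have hX z : X z -> modulus (h z) <= 1 / 2.
  move=> Xz; have := H z Xz => dz.
  by rewrite modulusM modulusV ler_pdivrMr; lra.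
have r01 : 0 <= (1 / 2 : R) < 1 by lra.
apply: upl_ext (uplM Hb (upl_geometric r01 hX Hh)) => z Xz.
have zb : z - b != 0 by rewrite -modulus_gt0; have := H z Xz; lra.
have h1 : 1 - h z != 0.
  rewrite -modulus_gt0; have := modulus_ge 1 (- h z); rewrite modulus1 modulusN.
  by have := hX z Xz; lra.
have -> : z - b' = (z - b) * (1 - h z) by rewrite /h; field.
by rewrite invfM.
Qed.

(** A ray that keeps away from X lets the pole be pushed so far that the inverse becomes
   a power series converging uniformly on X. *)
Lemma upl_inv_ray b e (d : R) : modulus e = 1 -> 0 < d ->
  (forall (t : R) z, 0 <= t -> X z -> d <= modulus (z - (b + t%:C * e))) ->
  unif_poly_limit (fun z => (z - b)^-1).
Proof.
move=> e1 d0; have [B HB] := Xbounded.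
have far n : forall b, 2 * `|B| + 1 <= modulus (b + (n%:R * (d / 2))%:C * e) ->
    (forall (t : R) z, 0 <= t -> X z -> d <= modulus (z - (b + t%:C * e))) ->
    unif_poly_limit (fun z => (z - b)^-1).
  elim: n => [|n IH] {}b hb H.
    rewrite mul0r rmorph0 mul0r addr0 in hb.
    have b0 : b != 0 by rewrite -modulus_gt0; have := normr_ge0 B; lra.
    apply: (@upl_inv_far b (1 / 2)) => // [|z Xz]; first by lra.
    by have := HB z Xz; have := ler_norm B; lra.
  have bE t : b + (d / 2)%:C * e + t%:C * e = b + (d / 2 + t)%:C * e.
    by rewrite rmorphD; ring.
  apply: (@upl_inv_push (b + (d / 2)%:C * e) b d) => //.
  - move=> z Xz; have d2 : 0 <= d / 2 by lra.
    exact: H.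
  - by rewrite modulusB addrC addKr modulusM modulus_real e1 gtr0_norm; lra.
  - apply: IH => [|t z t0 Xz]; last by rewrite bE; apply: H => //; lra.
    rewrite bE; have -> // : d / 2 + n%:R * (d / 2) = n.+1%:R * (d / 2).
    by rewrite -natr1; ring.
pose n := Num.bound ((2 * `|B| + 1 + modulus b) / (d / 2)).
apply: (far n); have : (2 * `|B| + 1 + modulus b) / (d / 2) < n%:R.
  apply: archi_boundP; rewrite divr_ge0//; last by lra.
  by have := normr_ge0 B; have := modulus_ge0 b; lra.
rewrite ltr_pdivrMr; last by lra.
have := modulus_ge ((n%:R * (d / 2))%:C * e) b.
rewrite [_ + b]addrC modulusM modulus_real e1 mulr1 ger0_norm; first by lra.
by rewrite mulr_ge0//; lra.
Qed.

Lemma upl_inv_poly (D : {poly R[i]}) :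
  (forall b, ~ X b -> unif_poly_limit (fun z => (z - b)^-1)) ->
  (forall z, X z -> D.[z] != 0) -> unif_poly_limit (fun z => D.[z]^-1).
Proof.
move=> Hb; have [s ->] := closed_field_poly_normal D.
elim: s (lead_coef D) => [|b s IH] c D0.
  apply: (upl_ext _ (upl_const c^-1)) => z _.
  by rewrite big_nil alg_polyC hornerC.
have Xb : ~ X b.
  move=> /D0; rewrite big_cons hornerZ hornerM hornerXsubC subrr mul0r mulr0.
  by rewrite eqxx.
have D1 z : X z -> (c *: \prod_(z <- s) ('X - z%:P)).[z] != 0.
  move=> /D0; apply: contraNN => /eqP.
  rewrite !hornerZ big_cons hornerM => E.
  by rewrite mulrCA E mulr0.
apply: (upl_ext _ (uplM (Hb b Xb) (IH c D1))) => z Xz.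
by rewrite big_cons !hornerZ hornerM hornerXsubC -invfM; congr (_^-1); ring.
Qed.

End uniform_limits_of_polynomials.

(** * Rouche's theorem for polynomials *)

Section rouche.
Variable R : realType.
Implicit Types (z w x : R[i]) (s : seq R[i]).

Lemma prim_root_exists n : (0 < n)%N -> exists z : R[i], n.-primitive_root z.
Proof.
pose p : {poly R[i]} := 'X^n - 1; have [r Dp] := closed_field_poly_normal p.
move=> n_gt0; rewrite (monicP _) ?monicXnsubC // scale1r in Dp.
have rn1 : all n.-unity_root r by apply/allP=> z; rewrite -root_prod_XsubC -Dp.
have sz_r : (n < (size r).+1)%N.
  by rewrite -(size_prod_XsubC r id) -Dp size_XnsubC.
have [|z] := hasP (has_prim_root n_gt0 rn1 _ sz_r); last by exists z.
by rewrite -separable_prod_XsubC -Dp separable_Xn_sub_1 // pnatr_eq0 -lt0n.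
Qed.

Lemma mean_value_prim_root (p : {poly R[i]}) n z : (size p <= n)%N ->
  n.-primitive_root z -> \sum_(k < n) p.[z ^+ k] = p.[0] *+ n.
Proof.
move=> pn zP.
under eq_bigr do rewrite (horner_coef_wide _ pn).
rewrite exchange_big /=; under eq_bigr do rewrite -mulr_sumr.
have n0 := prim_order_gt0 zP.
rewrite (bigD1 (Ordinal n0)) //= [X in _ + X]big1 => [|[i ni] /=].
  under eq_bigr do rewrite expr0.
  by rewrite sumr_const card_ord addr0 horner_coef0 mulr_natr.
rewrite -val_eqE /= => i0.
have zi : z ^+ i != 1.
  by rewrite -(prim_order_dvd zP) gtnNdvd// lt0n.
have : (z ^+ i - 1) * \sum_(k < n) (z ^+ i) ^+ k = 0.
  by rewrite -subrX1 exprAC (prim_expr_order zP) expr1n subrr.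
move=> /eqP; rewrite mulf_eq0 subr_eq0 (negbTE zi) /= => /eqP E.
rewrite [X in _ * X](_ : _ = 0) ?mulr0// -[RHS]E.
by apply: eq_bigr => k _; rewrite exprAC.
Qed.

Definition unit_disc : set R[i] := [set z | modulus z <= 1].

Lemma unit_disc_bounded : exists B : R, forall z, unit_disc z -> modulus z <= B.
Proof. by exists 1. Qed.

(** Mean value property: the average over the n-th roots of unity of a polynomial of degree
   less than n is its value at 0, so the real part of f has average 0 on the circle. *)
Lemma re_not_pos_on_circle (f : R[i] -> R[i]) (t : R) :
  unif_poly_limit unit_disc f -> f 0 = 0 -> 0 < t ->
  ~ forall z, modulus z = 1 -> t <= Re (f z).
Proof.
move=> Hf f0 t0 H; have t4 : 0 < t / 4 by lra.
have [p Hp] := Hf _ t4.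
have [z zP] := @prim_root_exists (size p).+1 isT.
have M1 k : modulus (z ^+ k) = 1.
  rewrite modulusX (_ : modulus z = 1) ?expr1n//.
  apply/eqP; rewrite -(@eqrXn2 _ (size p).+1) ?modulus_ge0//.
  by rewrite -modulusX (prim_expr_order zP) modulus1 expr1n.
have := mean_value_prim_root (leqnSn _) zP => /(congr1 (@complex.Re R)).
have p0 : Re p.[0] <= t / 4.
  have d0 : unit_disc 0 by rewrite /unit_disc /mkset modulus0 ler01.
  have := Hp 0 d0; rewrite f0 subr0.
  by have := Re_le_modulus p.[0]; have := ler_norm (Re p.[0]); lra.
have pk k : t / 2 <= Re p.[z ^+ k].
  have dk : unit_disc (z ^+ k) by rewrite /unit_disc /mkset M1.
  have := Hp _ dk.
  have := Re_le_modulus (p.[z ^+ k] - f (z ^+ k)).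
  have := H _ (M1 k); rewrite raddfB /=.
  have := ler_norm (- (Re p.[z ^+ k] - Re (f (z ^+ k)))); rewrite normrN; lra.
rewrite raddf_sum raddfMn /= => E.
have : \sum_(k < (size p).+1) (t / 2) <= \sum_(k < (size p).+1) Re p.[z ^+ k].
  by apply: ler_sum.
rewrite E sumr_const card_ord lerMn2r /=; lra.
Qed.

Definition prod_diff s z := \prod_(x <- s) (z - x).

Lemma prod_diffE s z : prod_diff s z = (\prod_(x <- s) ('X - x%:P)).[z].
Proof. by rewrite horner_prod; apply: eq_bigr => x _; rewrite hornerXsubC. Qed.

(** On the unit circle z - x = z * conj (1 - conj x * z).  This moves the zeros of
   prod_diff s inside the disc to the outside, at the price of powers of z and of a
   conjugation; conjugates do not matter up to positive factors. *)
Definition inner_part s z := \prod_(x <- s | modulus x < 1) (1 - conjc x * z).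
Definition outer_part s z := \prod_(x <- s | ~~ (modulus x < 1)) (z - x).

Lemma prod_diff_circle s z : modulus z = 1 ->
  prod_diff s z =
  z ^+ count (fun x => modulus x < 1) s * conjc (inner_part s z) * outer_part s z.
Proof.
move=> z1; rewrite /prod_diff /inner_part /outer_part.
have zz : z * conjc z = 1 by rewrite mulcJ z1 expr1n.
elim: s => [|x s IH]; first by rewrite !big_nil conjc1 expr0 !mul1r.
rewrite !big_cons /=; case: ifP => /= _; rewrite IH ?add0n; last by ring.
rewrite exprS rmorphM rmorphB rmorph1 rmorphM /= conjcK.
have -> : z - x = z * (1 - x * conjc z); last by ring.
by rewrite mulrBr mulr1 mulrCA zz mulr1.
Qed.

Lemma inner_part_poly s : exists p : {poly R[i]}, forall z, inner_part s z = p.[z].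
Proof.
exists (\prod_(x <- s | modulus x < 1) (1 - conjc x *: 'X)) => z.
by rewrite horner_prod; apply: eq_bigr => x _; rewrite !hornerE.
Qed.

Lemma outer_part_poly s : exists p : {poly R[i]}, forall z, outer_part s z = p.[z].
Proof.
exists (\prod_(x <- s | ~~ (modulus x < 1)) ('X - x%:P)) => z.
by rewrite horner_prod; apply: eq_bigr => x _; rewrite !hornerE.
Qed.

Lemma inner_part_neq0 s z : modulus z <= 1 -> inner_part s z != 0.
Proof.
move=> z1; rewrite prodf_seq_neq0; apply/allP => x _; apply/implyP => x1.
apply/eqP => /eqP; rewrite subr_eq0 => /eqP /(congr1 (@modulus R)).
rewrite modulus1 modulusM modulusJ => E.
by have := modulus_ge0 x; have := modulus_ge0 z; nra.
Qed.

Lemma outer_part_neq0 s z : (forall x, x \in s -> modulus x != 1) ->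
  modulus z <= 1 -> outer_part s z != 0.
Proof.
move=> s1 z1; rewrite /outer_part big_seq_cond prodf_seq_neq0.
apply/allP => x _; apply/implyP => /andP[/s1 x1 x2].
rewrite subr_eq0; apply: contraNneq x2 => zx; rewrite -zx in x1 *.
by rewrite lt_neqAle x1.
Qed.

(** If s1 had more zeros in the disc than s2, then up to a positive factor the product of
   the hypothesis would be on the circle a function holomorphic in the disc that vanishes
   at 0, and its real part could not be positive on the circle. *)
Lemma count_le_of_re_pos c1 s1 c2 s2 (t : R) : 0 < t ->
  (forall x, x \in s2 -> modulus x != 1) ->
  (forall z, modulus z = 1 ->
    t <= Re ((c1 * prod_diff s1 z) * conjc (c2 * prod_diff s2 z))) ->
  (count (fun x => modulus x < 1)%R s1 <= count (fun x => modulus x < 1)%R s2)%N.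
Proof.
move=> t0 h2 H; rewrite leqNgt; apply/negP.
set k1 := count _ s1; set k2 := count _ s2 => k21.
have [I1 I1E] := inner_part_poly s1; have [U1 U1E] := outer_part_poly s1.
have [I2 I2E] := inner_part_poly s2; have [U2 U2E] := outer_part_poly s2.
pose D := I1 * U2.
have D0 z : unit_disc z -> D.[z] != 0.
  by move=> z1; rewrite hornerM mulf_neq0// -?I1E -?U2E ?inner_part_neq0 ?outer_part_neq0.
pose N := (c1 * conjc c2) *: ('X^(k1 - k2) * U1 * I2).
pose f z := N.[z] * D.[z]^-1.
have Hf : unif_poly_limit unit_disc f.
  apply: (uplM unit_disc_bounded (upl_poly _ _)).
  apply: (upl_inv_poly unit_disc_bounded _ D0) => b /negP.
  rewrite /unit_disc /mkset -ltNge => b1.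
  have b0 : b != 0 by rewrite -modulus_gt0; lra.
  apply: (@upl_inv_far _ _ unit_disc_bounded b (modulus b)^-1) => //.
    by rewrite invr_ge0 modulus_ge0 invf_lt1 //; lra.
  by move=> z z1; rewrite mulVf// gt_eqF//; lra.
have f0 : f 0 = 0.
  rewrite /f /N hornerZ !hornerM hornerXn expr0n subn_eq0 leqNgt k21 /=.
  by rewrite !(mul0r, mulr0).
have [M M0 HM] := poly_bounded unit_disc_bounded D.
have tM : 0 < t / M ^+ 2 by rewrite divr_gt0// exprn_gt0.
apply: (re_not_pos_on_circle Hf f0 tM) => z z1.
have zd : unit_disc z by rewrite /unit_disc /mkset z1.
have zz : z * conjc z = 1 by rewrite mulcJ z1 expr1n.
have := H z z1; rewrite !prod_diff_circle// -/k1 -/k2 I1E I2E U1E U2E.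
have -> : c1 * (z ^+ k1 * conjc I1.[z] * U1.[z]) *
    conjc (c2 * (z ^+ k2 * conjc I2.[z] * U2.[z])) =
    (modulus D.[z] ^+ 2)%:C * f z.
  rewrite -mulcJ /f.
  have -> : D.[z] * conjc D.[z] * (N.[z] * D.[z]^-1) = N.[z] * conjc D.[z].
    by field; exact: D0.
  rewrite /N /D hornerZ !hornerM hornerXn !rmorphM /= conjcK rmorphXn /=.
  rewrite -{1}(subnK (ltnW k21)) exprD.
  have -> : z ^+ k2 = (conjc z ^+ k2)^-1.
    apply: (mulIf (x := conjc z ^+ k2)).
      by rewrite expf_neq0// conjc_eq0 -modulus_gt0 z1.
    rewrite -exprMn zz expr1n mulVf// expf_neq0// conjc_eq0 -modulus_gt0 z1//.
  field.
  by rewrite expf_neq0// conjc_eq0 -modulus_gt0 z1.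
have ReZ (a : R) (w : R[i]) : Re (a%:C * w) = a * Re w.
  by case: w => u v /=; rewrite mul0r subr0.
rewrite ReZ.
have m0 : 0 < modulus D.[z] ^+ 2 by rewrite exprn_gt0// modulus_gt0 D0.
have mM : modulus D.[z] ^+ 2 <= M ^+ 2.
  by rewrite lerXn2r ?nnegrE ?modulus_ge0 ?(ltW M0) ?HM.
move=> E; rewrite ler_pdivrMr ?exprn_gt0//.
have : 0 <= Re (f z) by have := m0; nra.
nra.
Qed.

(** Two functions A and B as in Rouche's theorem satisfy Re (A * conj B) > 0, a condition
   that is symmetric in A and B. *)
Lemma rouche_unit c1 s1 c2 s2 (b : R) : 0 < b ->
  (forall z, modulus z = 1 -> b <= modulus (c2 * prod_diff s2 z)) ->
  (forall z, modulus z = 1 ->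
    modulus (c1 * prod_diff s1 z - c2 * prod_diff s2 z) <=
    modulus (c2 * prod_diff s2 z) / 2) ->
  count (fun x => modulus x < 1) s1 = count (fun x => modulus x < 1) s2.
Proof.
move=> b0 Hb H; pose A z := c1 * prod_diff s1 z; pose B z := c2 * prod_diff s2 z.
have noroot c s : (forall z, modulus z = 1 -> c * prod_diff s z != 0) ->
    forall x, x \in s -> modulus x != 1.
  move=> Hs x xs; apply/eqP => /Hs; rewrite mulf_eq0 negb_or => /andP[_].
  by move: xs; rewrite -root_prod_XsubC prod_diffE => /rootP ->; rewrite eqxx.
have pos z : modulus z = 1 -> b ^+ 2 / 2 <= Re (A z * conjc (B z)).
  move=> z1; have := H z z1; have := Hb z z1; rewrite -/(A z) -/(B z) => h1 h2.
  have -> : A z * conjc (B z) = (modulus (B z) ^+ 2)%:C + (A z - B z) * conjc (B z).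
    by rewrite -mulcJ; ring.
  rewrite raddfD /=; have := Re_le_modulus ((A z - B z) * conjc (B z)).
  rewrite modulusM modulusJ; have := ler_norm (- Re ((A z - B z) * conjc (B z))).
  rewrite normrN => h3 h4.
  have : modulus (A z - B z) * modulus (B z) <= modulus (B z) / 2 * modulus (B z).
    by rewrite ler_wpM2r ?modulus_ge0.
  by nra.
have t0 : 0 < b ^+ 2 / 2 by rewrite divr_gt0// exprn_gt0.
have nB : forall x, x \in s2 -> modulus x != 1.
  by apply: (noroot c2) => z z1; rewrite -modulus_gt0; have := Hb z z1; lra.
have nA : forall x, x \in s1 -> modulus x != 1.
  apply: (noroot c1) => z z1; apply/eqP => E; have := pos z z1.
  by rewrite /A E mul0r /=; lra.
apply/eqP; rewrite eqn_leq; apply/andP; split.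
  exact: (@count_le_of_re_pos c1 _ c2 _ _ t0 nB pos).
apply: (@count_le_of_re_pos c2 _ c1 _ _ t0 nA) => z z1.
have -> : c2 * prod_diff s2 z * conjc (c1 * prod_diff s1 z) = conjc (A z * conjc (B z)).
  by rewrite [RHS]rmorphM /= conjcK mulrC.
have ReJ (w : R[i]) : Re (conjc w) = Re w by case: w.
by rewrite ReJ pos.
Qed.

Lemma rouche (a : R[i]) (r : R) c1 s1 c2 s2 (b : R) : 0 < r -> 0 < b ->
  (forall z, modulus (z - a) = r -> b <= modulus (c2 * prod_diff s2 z)) ->
  (forall z, modulus (z - a) = r ->
    modulus (c1 * prod_diff s1 z - c2 * prod_diff s2 z) <=
    modulus (c2 * prod_diff s2 z) / 2) ->
  count (fun x => modulus (x - a) < r) s1 = count (fun x => modulus (x - a) < r) s2.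
Proof.
move=> r0 b0 Hb H.
have rC : r%:C != 0 :> R[i] by rewrite -modulus_gt0 modulus_real normr_gt0 gt_eqF.
pose h x := (x - a) / r%:C.
have E s : count (fun x => modulus (x - a) < r) s =
           count (fun x => modulus x < 1) (map h s).
  rewrite count_map; apply: eq_count => x /=.
  by rewrite /h modulusM modulusV modulus_real gtr0_norm// ltr_pdivrMr// mul1r.
have P s z : prod_diff s (a + r%:C * z) = (r%:C) ^+ size s * prod_diff (map h s) z.
  rewrite /prod_diff big_map; elim: s => [|x s IH].
    by rewrite !big_nil expr0 mul1r.
  rewrite !big_cons /= exprS IH /h.
  have -> : a + r%:C * z - x = r%:C * (z - (x - a) / r%:C) by field.
  by ring.
have C z : modulus z = 1 -> modulus (a + r%:C * z - a) = r.
  by move=> z1; rewrite addrC addKr modulusM modulus_real z1 gtr0_norm// mulr1.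
rewrite !E; apply: (@rouche_unit (c1 * r%:C ^+ size s1) _ (c2 * r%:C ^+ size s2) _ b b0).
  by move=> z z1; rewrite -mulrA -P Hb// C.
by move=> z z1; rewrite -!mulrA -!P H// C.
Qed.

End rouche.

(** * Uniform continuity and uniform limits *)

Section uniform_continuity.
Variable R : realType.

(** Distances with values in R on both R and R[i], so that uniform continuity of functions
   between them can be treated at once; the norm of R[i] has its values in R[i]. *)
Definition distR (a b : R) : R := `|a - b|.
Definition distC (z w : R[i]) : R := modulus (z - w).

Definition ucont (T U : Type) (dT : T -> T -> R) (dU : U -> U -> R) (f : T -> U) :=
  forall e, 0 < e -> exists2 d, 0 < d & forall x y, dT x y < d -> dU (f x) (f y) < e.

Lemma ucont_comp T U V (dT : T -> T -> R) (dU : U -> U -> R) (dV : V -> V -> R)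
    (f : T -> U) (h : U -> V) :
  ucont dT dU f -> ucont dU dV h -> ucont dT dV (h \o f).
Proof.
by move=> Hf Hh e /Hh[d d0 hd]; have [c c0 hc] := Hf d d0; exists c => // x y /hc/hd.
Qed.

Lemma lipschitz_ucont T U (dT : T -> T -> R) (dU : U -> U -> R) (f : T -> U) (K : R) :
  0 < K -> (forall x y, dU (f x) (f y) <= K * dT x y) -> ucont dT dU f.
Proof.
move=> K0 H e e0; exists (e / K) => [|x y xy]; first by rewrite divr_gt0.
by rewrite (le_lt_trans (H x y))// mulrC -ltr_pdivlMr.
Qed.

Lemma ucont_limit T U (dT : T -> T -> R) (dU : U -> U -> R) (f : T -> U) :
  (forall u v, dU u v = dU v u) ->
  (forall u v w, dU u w <= dU u v + dU v w) ->
  (forall e, 0 < e -> exists2 h, ucont dT dU h & forall x, dU (h x) (f x) <= e) ->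
  ucont dT dU f.
Proof.
move=> sU tU H e e0; have e4 : 0 < e / 4 by lra.
have [h Hh hf] := H _ e4; have [d d0 hd] := Hh _ e4; exists d => // x y /hd hxy.
have := tU (f x) (h x) (f y); have := tU (h x) (h y) (f y).
by have := hf x; have := hf y; rewrite (sU (h x) (f x)); lra.
Qed.

Lemma distR_sym (u v : R) : distR u v = distR v u.
Proof. exact: distrC. Qed.

Lemma distR_triangle (u v w : R) : distR u w <= distR u v + distR v w.
Proof. exact: ler_distD. Qed.

Lemma distC_sym z w : distC z w = distC w z.
Proof. exact: modulusB. Qed.

Lemma distC_triangle z w x : distC z x <= distC z w + distC w x.
Proof. exact: modulus_triangle. Qed.

(** Corrected by K * r ^+ n, the sequence becomes monotone. *)
Lemma geometric_real_limit (u : nat -> R) (K r : R) : 0 <= K -> 0 <= r ->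
  (forall n, `|u n.+1 - u n| <= K * (1 - r) * r ^+ n) ->
  exists l, forall n, `|u n - l| <= K * r ^+ n.
Proof.
move=> K0 r0 H.
have up n m : u n - K * r ^+ n <= u (n + m)%N - K * r ^+ (n + m).
  elim: m => [|m IH]; first by rewrite addn0.
  apply: (le_trans IH); rewrite addnS; move: (H (n + m)%N); rewrite exprS.
  by rewrite ler_norml => /andP[h1 h2]; lra.
have down n m : u (n + m)%N + K * r ^+ (n + m) <= u n + K * r ^+ n.
  elim: m => [|m IH]; first by rewrite addn0.
  apply: le_trans IH; rewrite addnS; move: (H (n + m)%N); rewrite exprS.
  by rewrite ler_norml => /andP[h1 h2]; lra.
have cross n m : u n - K * r ^+ n <= u m + K * r ^+ m.
  have Kr : 0 <= K * r ^+ (n + m) by rewrite mulr_ge0// exprn_ge0.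
  by have := up n m; have := down m n; rewrite [(m + n)%N]addnC; lra.
pose S := range (fun n => u n - K * r ^+ n).
have S0 : S !=set0 by exists (u 0%N - K * r ^+ 0); exists 0%N.
have SU m : ubound S (u m + K * r ^+ m) by move=> _ [n _ <-].
exists (sup S) => n; rewrite ler_norml; apply/andP; split.
  by have := ge_sup S0 (SU n); lra.
have h : S (u n - K * r ^+ n) by exists n.
have HS : has_ubound S by exists (u 0%N + K * r ^+ 0).
by have := ub_le_sup HS h; lra.
Qed.

Lemma geometric_complex_limit (u : nat -> R[i]) (K r : R) : 0 <= K -> 0 <= r ->
  (forall n, modulus (u n.+1 - u n) <= K * (1 - r) * r ^+ n) ->
  exists l, forall n, modulus (u n - l) <= K * 2 * r ^+ n.
Proof.
move=> K0 r0 H.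
have [|a Ha] := @geometric_real_limit (fun n => Re (u n)) K r K0 r0.
  by move=> n; rewrite -raddfB (le_trans (Re_le_modulus _)).
have [|b Hb] := @geometric_real_limit (fun n => Im (u n)) K r K0 r0.
  by move=> n; rewrite -raddfB (le_trans (Im_le_modulus _)).
exists (a +i* b) => n; rewrite (le_trans (modulus_le_ReIm _))// !raddfB /=.
by have := Ha n; have := Hb n; lra.
Qed.

Lemma ucont_continuous (f : R -> R) : ucont distR distR f -> continuous f.
Proof.
move=> Hf x; apply/cvgrPdist_lt => e /Hf[d d0 hd].
by apply/nbhs_ballP; exists d => //= t; exact: hd.
Qed.

Lemma ucont_maxr (T : Type) (dT : T -> T -> R) (f h : T -> R) :
  ucont dT distR f -> ucont dT distR h -> ucont dT distR (fun x => Num.max (f x) (h x)).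
Proof.
move=> Hf Hh e e0; have [c c0 hc] := Hf e e0; have [d d0 hd] := Hh e e0.
exists (Num.min c d) => [|x y]; first by rewrite lt_min c0.
rewrite lt_min => /andP[/hc + /hd]; rewrite /distR !ltr_norml !maxEle.
by do 2 case: ifP; lra.
Qed.

Lemma ucontD (T : Type) (dT : T -> T -> R) (f h : T -> R) :
  ucont dT distR f -> ucont dT distR h -> ucont dT distR (fun x => f x + h x).
Proof.
move=> Hf Hh e e0; have e2 : 0 < e / 2 by lra.
have [c c0 hc] := Hf _ e2; have [d d0 hd] := Hh _ e2.
exists (Num.min c d) => [|x y]; first by rewrite lt_min c0.
rewrite lt_min => /andP[/hc + /hd]; rewrite /distR !ltr_norml.
by lra.
Qed.

Lemma ucontN (T : Type) (dT : T -> T -> R) (f : T -> R) :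
  ucont dT distR f -> ucont dT distR (fun x => - f x).
Proof.
move=> Hf e /Hf[d d0 hd]; exists d => // x y /hd.
by rewrite /distR -opprD normrN.
Qed.

Lemma ucont_cst T U (dT : T -> T -> R) (dU : U -> U -> R) c :
  (forall u, dU u u = 0) -> ucont dT dU (fun=> c).
Proof. by move=> U0 e e0; exists 1 => // x y _; rewrite U0. Qed.

Lemma distRR (a : R) : distR a a = 0.
Proof. by rewrite /distR subrr normr0. Qed.

(** By compactness: the continuous function max u (e - v) has a positive minimum on the
   interval. *)
Lemma small_near_zeros (u v : R -> R) (a b e : R) : a <= b ->
  ucont distR distR u -> ucont distR distR v ->
  (forall t, a <= t <= b -> u t <= 0 -> v t < e) ->
  exists2 d, 0 < d & forall t, a <= t <= b -> u t < d -> v t < e.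
Proof.
move=> ab Hu Hv H; pose h t := Num.max (u t) (e - v t).
have Hh : ucont distR distR h.
  apply: ucont_maxr => //; apply: ucontD; last exact: ucontN.
  by apply: ucont_cst; exact: distRR.
have [|c cab Hc] := @EVT_min R h a b ab.
  by apply: continuous_subspaceT; exact: ucont_continuous.
have h0 : 0 < h c.
  rewrite /h lt_max; case: (lerP (u c) 0) => [uc|//] /=; by rewrite subr_gt0 H.
exists (h c) => // t tab ut.
have := Hc t; rewrite in_itv /= tab => /(_ isT).
by rewrite {2}/h le_max => /orP[|]; lra.
Qed.

End uniform_continuity.

Section real_scaling.
Variable R : realType.

Lemma ReZ (a : R) (w : R[i]) : Re (a%:C * w) = a * Re w.
Proof. by case: w => u v /=; rewrite mul0r subr0. Qed.

Lemma ImZ (a : R) (w : R[i]) : Im (a%:C * w) = a * Im w.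
Proof. by case: w => u v /=; rewrite mul0r addr0. Qed.

End real_scaling.

(** * The Cauchy transforms of the approximating measures *)

Section cauchy_field.
Variable R : realType.
Implicit Types z w a b : R[i].

Definition cmk (a b : R) : R[i] := a +i* b.

Definition corners : seq R[i] :=
  [:: cmk (- (2 / 3)) (- (2 / 3)); cmk (2 / 3) (- (2 / 3));
      cmk (- (2 / 3)) (2 / 3); cmk (2 / 3) (2 / 3)].

Definition supnorm z : R := Num.max `|Re z| `|Im z|.

Lemma supnorm_le_modulus z : supnorm z <= modulus z.
Proof. by rewrite ge_max Re_le_modulus Im_le_modulus. Qed.

Lemma modulus_le_supnorm z : modulus z <= 2 * supnorm z.
Proof.
have h1 : `|Re z| <= supnorm z by rewrite le_max lexx.
have h2 : `|Im z| <= supnorm z by rewrite le_max lexx orbT.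
by have := modulus_le_ReIm z; lra.
Qed.

Lemma supnormZ (r : R) z : 0 <= r -> supnorm (r%:C * z) = r * supnorm z.
Proof. by move=> r0; rewrite /supnorm ReZ ImZ !normrM ger0_norm// maxr_pMr. Qed.

Lemma supnormD z w : supnorm (z + w) <= supnorm z + supnorm w.
Proof.
rewrite /supnorm ge_max !raddfD /=; apply/andP; split.
  by rewrite (le_trans (ler_normD _ _))// lerD// le_max lexx.
by rewrite (le_trans (ler_normD _ _))// lerD// le_max lexx orbT.
Qed.

Lemma supnormN z : supnorm (- z) = supnorm z.
Proof. by rewrite /supnorm !raddfN /= !normrN. Qed.

Lemma supnorm_triangle z w x : supnorm (z - x) <= supnorm (z - w) + supnorm (w - x).
Proof. by rewrite (_ : z - x = (z - w) + (w - x)) ?supnormD//; ring. Qed.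

Lemma supnorm_corner b : b \in corners -> supnorm b = 2 / 3.
Proof.
rewrite !inE /supnorm => /or4P[] /eqP -> /=; rewrite ?normrN !ger0_norm ?maxxx//;
  by lra.
Qed.

Lemma modulus_corner b : b \in corners -> modulus b <= 1.
Proof.
move=> hb; rewrite -(ler_pXn2r (n := 2)) ?nnegrE ?modulus_ge0// modulus_sqr.
by move: hb; rewrite !inE => /or4P[] /eqP -> /=; lra.
Qed.

Lemma corners_sep b b' : b \in corners -> b' \in corners -> b != b' ->
  4 / 3 <= supnorm (b - b').
Proof.
rewrite !inE => /or4P[] /eqP -> /or4P[] /eqP ->; rewrite ?eqxx// => _;
  rewrite /supnorm /= le_max; apply/orP;
  solve [left; rewrite ler_normr; lra | right; rewrite ler_normr; lra].
Qed.

(** The Cauchy kernel 1 / u, replaced inside the unit disc by conj u, which makes it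
   Lipschitz. *)
Definition kernel u : R[i] := conjc u * ((Num.max 1 (modulus u ^+ 2))^-1)%:C.

Lemma kernel_in u : modulus u <= 1 -> kernel u = conjc u.
Proof.
move=> u1; rewrite /kernel max_l ?invr1 ?mulr1//.
by have := modulus_ge0 u; nra.
Qed.

Lemma kernel_out u : 1 <= modulus u -> kernel u = u^-1.
Proof.
move=> u1; rewrite /kernel max_r; last by nra.
have u0 : u != 0 by rewrite -modulus_gt0; lra.
apply: (mulfI u0); rewrite divff// mulrA mulcJ -rmorphM /= divff ?rmorph1//.
by rewrite expf_neq0// modulus_eq0.
Qed.

Lemma kernel_le1 u : modulus (kernel u) <= 1.
Proof.
case: (lerP (modulus u) 1) => u1; first by rewrite kernel_in// modulusJ.
by rewrite (kernel_out (ltW u1)) modulusV invf_le1 ?ltW//; lra.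
Qed.

Lemma kernel_opp u : kernel (- u) = - kernel u.
Proof. by rewrite /kernel rmorphN mulNr modulusN. Qed.

Lemma kernel_lipschitz_mixed u v : modulus u <= 1 -> 1 <= modulus v ->
  modulus (kernel u - kernel v) <= 3 * modulus (u - v).
Proof.
move=> u1 v1; rewrite kernel_in// kernel_out//.
have v0 : v != 0 by rewrite -modulus_gt0; lra.
have h1 := modulus_triangle (conjc u) (conjc v) (v^-1).
have h2 : modulus (conjc v - v^-1) = (modulus v ^+ 2 - 1) / modulus v.
  have -> : conjc v - v^-1 = (v * conjc v - 1) / v by field.
  rewrite mulcJ modulusM modulusV -(rmorph1 (real_complex R)) -rmorphB modulus_real.
  by rewrite ger0_norm//; nra.
have h3 : (modulus v ^+ 2 - 1) / modulus v <= 2 * (modulus v - 1).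
  by rewrite ler_pdivrMr; nra.
have h4 : modulus v - modulus u <= modulus (u - v).
  by rewrite modulusB; have := modulus_ge v (- u); rewrite modulusN.
have h5 : modulus (conjc u - conjc v) = modulus (u - v).
  by rewrite -rmorphB modulusJ.
by move: h1; rewrite h2 h5; lra.
Qed.

Lemma kernel_lipschitz u v : modulus (kernel u - kernel v) <= 3 * modulus (u - v).
Proof.
have m0 := modulus_ge0 (u - v).
case: (lerP (modulus u) 1) => u1; case: (lerP (modulus v) 1) => v1.
- by rewrite !kernel_in// -rmorphB modulusJ; lra.
- exact: kernel_lipschitz_mixed u1 (ltW v1).
- by rewrite modulusB (modulusB u); exact: kernel_lipschitz_mixed v1 (ltW u1).
- rewrite (kernel_out (ltW u1)) (kernel_out (ltW v1)).
  have u0 : u != 0 by rewrite -modulus_gt0; lra.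
  have v0 : v != 0 by rewrite -modulus_gt0; lra.
  have -> : u^-1 - v^-1 = (v - u) / (u * v) by field; rewrite u0 v0.
  rewrite modulusM modulusV modulusM ler_pdivrMr ?mulr_gt0//; try lra.
  rewrite modulusB; have h : 1 <= modulus u * modulus v by nra.
  by have := ler_wpM2l m0 h; lra.
Qed.

(** The Cauchy transform of the unit mass spread evenly over the centres of the 4 ^ n
   squares of level n, with the kernel truncated at distance 3 ^- n.  The square is made of
   four copies of itself scaled by 1/3; hence the recursion, where the factor 3/4 is the
   mass 1/4 of a copy times the factor 3 by which the kernel grows. *)
Fixpoint field n z : R[i] :=
  if n is m.+1 then (3 / 4)%:C * \sum_(b <- corners) field m (3%:C * (z - b))
  else kernel z.

Lemma fieldS n z :
  field n.+1 z = (3 / 4)%:C * \sum_(b <- corners) field n (3%:C * (z - b)).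
Proof. by []. Qed.

Lemma sum_corners_le (F : R[i] -> R[i]) (M : R) :
  (forall b, b \in corners -> modulus (F b) <= M) ->
  modulus (\sum_(b <- corners) F b) <= 4 * M.
Proof.
move=> H; apply: (le_trans (modulus_sum _ _)).
rewrite big_seq; apply: (le_trans (ler_sum _ (fun b hb => H b hb))).
by rewrite -big_seq big_const_seq /=; lra.
Qed.

Lemma field_bounded n : exists M, forall z, modulus (field n z) <= M.
Proof.
elim: n => [|n [M HM]]; first by exists 1; exact: kernel_le1.
exists (3 * M) => z /=; rewrite modulus_realM ger0_norm; last by lra.
have := @sum_corners_le (fun b => field n (3%:C * (z - b))) M.
by move=> /(_ (fun b _ => HM _)); lra.
Qed.

Lemma field_lipschitz n : exists2 K, 0 < K &
  forall z w, modulus (field n z - field n w) <= K * modulus (z - w).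
Proof.
elim: n => [|n [K K0 HK]]; first by exists 3 => //; exact: kernel_lipschitz.
exists (9 * K) => [|z w /=]; first by lra.
rewrite -mulrBr -sumrB modulus_realM ger0_norm; last by lra.
have H b : b \in corners ->
    modulus (field n (3%:C * (z - b)) - field n (3%:C * (w - b))) <=
    K * (3 * modulus (z - w)).
  move=> _; apply: (le_trans (HK _ _)).
  rewrite (_ : _ - _ = 3%:C * (z - w)); last by ring.
  by rewrite modulus_realM ger0_norm.
by have := sum_corners_le H; lra.
Qed.

(** The set of corners is symmetric about 0. *)
Lemma field_opp n z : field n (- z) = - field n z.
Proof.
elim: n z => [|n IH] z /=; first exact: kernel_opp.
rewrite -mulrN; congr (_ * _); rewrite !big_cons !big_nil /= !addr0 !opprD.
rewrite -!IH.
have E b : - (3%:C * (z - b)) = 3%:C * (- z - (- b)) by ring.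
rewrite !E.
have C (x y : R) : - cmk x y = cmk (- x) (- y) by [].
rewrite !C !opprK; ring.
Qed.

Lemma field0 n : field n 0 = 0.
Proof.
have := field_opp n 0; rewrite oppr0 => /eqP; rewrite -subr_eq0 opprK -mulr2n.
by rewrite mulrn_eq0 => /eqP.
Qed.

End cauchy_field.

(** * Convergence of the Cauchy transforms *)

Section limit_field.
Variable R : realType.
Implicit Types z w a b : R[i].

Definition box_dist z : R := Num.max 0 (supnorm z - 1).

Lemma box_dist_ge0 z : 0 <= box_dist z.
Proof. by rewrite le_max lexx. Qed.

Lemma corners_uniq : uniq (corners R).
Proof.
rewrite /= !inE !eq_complex /= !negb_or !negb_and -!andbA.
have h : - (2 / 3) != 2 / 3 :> R by apply/eqP; lra.
by rewrite h (eq_sym (2 / 3)) h ?orbT.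
Qed.

Lemma supnorm_sub_corner z b : b \in corners R -> supnorm z - 2 / 3 <= supnorm (z - b).
Proof.
by move=> /supnorm_corner hb; have := supnormD (z - b) b; rewrite subrK hb; lra.
Qed.

Lemma box_dist_zoom z b : b \in corners R -> 3 * box_dist z <= box_dist (3%:C * (z - b)).
Proof.
move=> hb; rewrite /box_dist supnormZ; last by lra.
by have := supnorm_sub_corner z hb; rewrite !maxEle; do 2 case: ifP; lra.
Qed.

(** Outside the square the kernel is holomorphic, and 1 / (z - b) - 1 / z = b / (z (z - b))
   is of the second order. *)
Lemma field_step_small z : modulus (field 1 z - field 0 z) * box_dist z ^+ 2 <= 1.
Proof.
case: (lerP (supnorm z) 1) => z1.
  by rewrite /box_dist max_l ?expr0n ?mulr0//; lra.
rewrite /box_dist max_r; last by lra.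
set d := supnorm z - 1; have d0 : 0 < d by rewrite /d; lra.
have mz := supnorm_le_modulus z.
have zd : d <= modulus z by rewrite /d; lra.
have z0 : z != 0 by rewrite -modulus_gt0; lra.
rewrite /= (kernel_out (ltW (lt_le_trans z1 mz))).
have E : (3 / 4)%:C * (\sum_(b <- corners R) kernel (3%:C * (z - b))) - z^-1 =
    (1 / 4)%:C * \sum_(b <- corners R) (b / (z * (z - b))).
  have -> : z^-1 = (1 / 4)%:C * \sum_(b <- corners R) z^-1.
    by rewrite !big_cons big_nil /=; field.
  have -> : (3 / 4)%:C * (\sum_(b <- corners R) kernel (3%:C * (z - b))) =
     (1 / 4)%:C * \sum_(b <- corners R) (3%:C * kernel (3%:C * (z - b))).
    by rewrite -mulr_sumr mulrA -rmorphM /=; congr (_%:C * _); lra.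
  rewrite -mulrBr -sumrB; congr (_ * _); rewrite big_seq [RHS]big_seq.
  apply: eq_bigr => b hb; have h := supnorm_sub_corner z hb.
  have h' := supnorm_le_modulus (z - b).
  rewrite kernel_out; last by rewrite modulus_realM ger0_norm; lra.
  have zb0 : z - b != 0 by rewrite -modulus_gt0; lra.
  by field; rewrite zb0 z0.
rewrite E modulus_realM ger0_norm; last by lra.
have H b : b \in corners R -> modulus (b / (z * (z - b))) <= (d ^+ 2)^-1.
  move=> hb; have h := supnorm_sub_corner z hb.
  have h' := supnorm_le_modulus (z - b); have h1 := modulus_corner hb.
  have zb : d <= modulus (z - b) by rewrite /d; lra.
  rewrite modulusM modulusV modulusM -[leRHS]mul1r ler_pM ?modulus_ge0//.
    by rewrite invr_ge0 mulr_ge0 ?modulus_ge0.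
  rewrite lef_pV2 ?posrE ?exprn_gt0 ?mulr_gt0 ?expr2 ?ler_pM//; lra.
have := sum_corners_le H; rewrite -ler_pdivlMr ?exprn_gt0//; lra.
Qed.

(** A zoom by 3 multiplies the distance to the square by at least 3, so the square of the
   distance gains 9 where the recursion loses 3. *)
Lemma field_step_far n z :
  modulus (field n.+1 z - field n z) * box_dist z ^+ 2 <= (1 / 3) ^+ n.
Proof.
elim: n z => [|n IH] z; first by rewrite expr0; exact: field_step_small.
have -> : field n.+2 z - field n.+1 z = (3 / 4)%:C *
    \sum_(b <- corners R) (field n.+1 (3%:C * (z - b)) - field n (3%:C * (z - b))).
  by rewrite sumrB mulrBr.
have d0 := box_dist_ge0 z.
have e0 : 0 <= (1 / 3 : R) ^+ n by rewrite exprn_ge0//; lra.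
case: (lerP (box_dist z) 0) => dz.
  have -> : box_dist z = 0 by lra.
  by rewrite expr0n mulr0 exprS; lra.
have H b : b \in corners R ->
    modulus (field n.+1 (3%:C * (z - b)) - field n (3%:C * (z - b))) <=
    (1 / 3) ^+ n / box_dist z ^+ 2 / 9.
  move=> hb; have h := box_dist_zoom z hb; have IHb := IH (3%:C * (z - b)).
  rewrite ler_pdivlMr// ler_pdivlMr ?exprn_gt0// -mulrA.
  apply: le_trans IHb; rewrite ler_wpM2l ?modulus_ge0//.
  have : (3 * box_dist z) ^+ 2 <= box_dist (3%:C * (z - b)) ^+ 2.
    by rewrite lerXn2r ?nnegrE ?box_dist_ge0//; lra.
  by rewrite exprMn; lra.
have := sum_corners_le H; rewrite modulus_realM ger0_norm; last by lra.
by rewrite -ler_pdivlMr ?exprn_gt0// [_ ^+ n.+1]exprS; lra.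
Qed.

Lemma sum_corners_le1 (F : R[i] -> R[i]) (A B : R) b0 : b0 \in corners R ->
  modulus (F b0) <= A ->
  (forall b, b \in corners R -> b != b0 -> modulus (F b) <= B) ->
  modulus (\sum_(b <- corners R) F b) <= A + 3 * B.
Proof.
move=> hb0 hA hB; rewrite (big_rem b0 hb0) /=.
apply: (le_trans (modulusD _ _)); apply: lerD => //.
apply: (le_trans (modulus_sum _ _)); rewrite big_seq.
have hr b : b \in rem b0 (corners R) -> modulus (F b) <= B.
  by rewrite mem_rem_uniq ?corners_uniq// inE => /andP[b1 b2]; apply: hB.
apply: (le_trans (ler_sum _ hr)).
have c3 : count xpredT (rem b0 (corners R)) = 3%N by rewrite count_predT size_rem.
by rewrite -big_seq big_const_seq c3 /=; lra.
Qed.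

Lemma one_near_corner z : exists2 b0, b0 \in corners R &
  forall b, b \in corners R -> b != b0 -> 2 / 3 <= supnorm (z - b).
Proof.
case: (pselect (exists2 b0, b0 \in corners R & supnorm (z - b0) < 2 / 3)).
  move=> [b0 h0 hz]; exists b0 => // b hb bb0.
  have := corners_sep hb h0 bb0; have := supnorm_triangle b z b0.
  by rewrite -(supnormN (b - z)) opprB; lra.
move=> H; exists (cmk (- (2 / 3)) (- (2 / 3))); first by rewrite !inE eqxx.
by move=> b hb _; rewrite leNgt; apply/negP => hz; apply: H; exists b.
Qed.

(** At most one of the four terms of the recursion is evaluated near the square.  That
   term is multiplied by 3/4 < 1 and the other three are at most 3 ^- n, so the steps
   decay geometrically.  That 3/4 < 1 expresses that the Cantor square has dimension
   log 4 / log 3 > 1; this is what makes the limit continuous. *)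
Lemma field_step n z : modulus (field n.+1 z - field n z) <= 45 * (4 / 5) ^+ n.
Proof.
elim: n z => [|n IH] z.
  have := modulusD (field 1 z) (- field 0 z); rewrite modulusN expr0.
  have := @sum_corners_le R (fun b => field 0 (3%:C * (z - b))) 1.
  move=> /(_ (fun b _ => kernel_le1 _)); have := kernel_le1 z.
  by rewrite /= modulus_realM ger0_norm; lra.
have -> : field n.+2 z - field n.+1 z = (3 / 4)%:C *
    \sum_(b <- corners R) (field n.+1 (3%:C * (z - b)) - field n (3%:C * (z - b))).
  by rewrite sumrB mulrBr.
have [b0 hb0 hb] := one_near_corner z.
have H b : b \in corners R -> b != b0 ->
    modulus (field n.+1 (3%:C * (z - b)) - field n (3%:C * (z - b))) <= (1 / 3) ^+ n.
  move=> bc /(hb b bc) h; have := field_step_far n (3%:C * (z - b)).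
  apply: le_trans; rewrite ler_peMr ?modulus_ge0//.
  have : 1 <= box_dist (3%:C * (z - b)).
    by rewrite le_max supnormZ ?ler0n//; apply/orP; right; lra.
  by nra.
have := sum_corners_le1 hb0 (IH _) H; rewrite modulus_realM ger0_norm; last by lra.
have : (1 / 3 : R) ^+ n <= (4 / 5) ^+ n by rewrite lerXn2r ?nnegrE//; lra.
(* 3/4 * 45 + 9/4 = 4/5 * 45 *)
by rewrite exprS; lra.
Qed.

Lemma limit_field_exists :
  exists g : R[i] -> R[i], forall z n, modulus (field n z - g z) <= 450 * (4 / 5) ^+ n.
Proof.
have H z : exists w, forall n, modulus (field n z - w) <= 450 * (4 / 5) ^+ n.
  have [|||l Hl] := @geometric_complex_limit R (fun n => field n z) 225 (4 / 5).
  - lra.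
  - lra.
  - by move=> n; have := field_step n z; lra.
  - by exists l => n; have := Hl n; lra.
by exists (fun z => projT1 (cid (H z))) => z; case: (cid _).
Qed.

Definition limit_field : R[i] -> R[i] := projT1 (cid limit_field_exists).

Lemma field_limit_dist n z : modulus (field n z - limit_field z) <= 450 * (4 / 5) ^+ n.
Proof. by rewrite /limit_field; case: (cid _). Qed.

Lemma field_limit_unif (e : R) : 0 < e ->
  exists N, forall n, (N <= n)%N -> forall z, modulus (field n z - limit_field z) <= e.
Proof.
move=> e0; have [N HN] : exists N, (4 / 5 : R) ^+ N < e / 450.
  by apply: exp_lt_eps; lra.
exists N => n /subnKC <- z; apply: (le_trans (field_limit_dist _ z)).
have : (4 / 5 : R) ^+ (n - N) <= 1 by rewrite exprn_ile1//; lra.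
have : 0 <= (4 / 5 : R) ^+ (n - N) by rewrite exprn_ge0//; lra.
have : 0 <= (4 / 5 : R) ^+ N by rewrite exprn_ge0//; lra.
rewrite exprD; nra.
Qed.

Lemma limit_field_ucont : ucont (@distC R) (@distC R) limit_field.
Proof.
apply: ucont_limit; [exact: distC_sym|exact: distC_triangle|move=> e e0].
have [N HN] := field_limit_unif e0; exists (field N); last exact: HN.
by have [K K0 HK] := @field_lipschitz R N; exact: lipschitz_ucont HK.
Qed.

Lemma limit_field_bounded : exists M, forall z, modulus (limit_field z) <= M.
Proof.
have [M HM] := field_bounded R 0; exists (M + 450) => z.
have := field_limit_dist 0 z; have := modulus_ge (limit_field z) (- field 0 z).
by rewrite modulusN (modulusB (field 0 z)) expr0; have := HM z; lra.
Qed.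

End limit_field.

(** * The field as a rational function *)

Section centres.
Variable R : realType.
Implicit Types z w a b : R[i].

Fixpoint centres n : seq R[i] :=
  if n is m.+1 then [seq b + (1 / 3)%:C * a | b <- corners R, a <- centres m]
  else [:: 0].

Lemma centresS n :
  centres n.+1 = [seq b + (1 / 3)%:C * a | b <- corners R, a <- centres n].
Proof. by []. Qed.

Lemma size_centres n : size (centres n) = (4 ^ n)%N.
Proof. by elim: n => // n IH; rewrite centresS size_allpairs IH expnS. Qed.

Lemma centresSP n a : reflect
  (exists b a', [/\ b \in corners R, a' \in centres n & a = b + (1 / 3)%:C * a'])
  (a \in centres n.+1).
Proof.
apply: (iffP allpairsP) => [[[b a'] [h1 h2 h3]]|[b [a' [h1 h2 h3]]]].
  by exists b, a'.
by exists (b, a').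
Qed.

Lemma centres_in_box n a : a \in centres n -> supnorm a <= 1 - (1 / 3) ^+ n.
Proof.
elim: n a => [|n IH] a.
  by rewrite inE => /eqP ->; rewrite /supnorm /= normr0 maxxx expr0; lra.
move=> /centresSP[b [a' [hb /IH ha' ->]]]; have := supnormD b ((1 / 3)%:C * a').
rewrite (supnorm_corner hb) supnormZ; last by lra.
by rewrite exprS; lra.
Qed.

(** The squares of level n have half side 3 ^- n, hence this distance leaves a gap between
   any two of them. *)
Lemma centres_sep n a a' : a \in centres n -> a' \in centres n -> a != a' ->
  4 * (1 / 3) ^+ n <= supnorm (a - a').
Proof.
elim: n a a' => [|n IH] a a'; first by rewrite !inE => /eqP -> /eqP ->; rewrite eqxx.
move=> /centresSP[b [c [hb hc ->]]] /centresSP[b' [c' [hb' hc' ->]]] ne.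
have [bb|bb] := eqVneq b b'.
  have cc : c != c' by apply: contraNneq ne => ->; rewrite bb.
  have := IH _ _ hc hc' cc; rewrite bb.
  rewrite (_ : b' + (1 / 3)%:C * c - (b' + (1 / 3)%:C * c') =
    (1 / 3)%:C * (c - c')); last by ring.
  by rewrite supnormZ ?exprS; lra.
have := corners_sep hb hb' bb.
have := supnorm_triangle b (b + (1 / 3)%:C * c) b'.
have := supnorm_triangle (b + (1 / 3)%:C * c) (b' + (1 / 3)%:C * c') b'.
have := centres_in_box hc; have := centres_in_box hc'.
rewrite (_ : b - (b + _) = - ((1 / 3)%:C * c)); last by ring.
rewrite (_ : b' + (1 / 3)%:C * c' - b' = (1 / 3)%:C * c'); last by ring.
rewrite supnormN !supnormZ; try lra.
have : (1 / 3 : R) ^+ n <= 1 by rewrite exprn_ile1//; lra.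
by rewrite exprS; lra.
Qed.

Lemma centres_uniq n : uniq (centres n).
Proof.
elim: n => // n IH; rewrite centresS; apply: allpairs_uniq => //; first exact: corners_uniq.
move=> [b c] [b' c'] /allpairsPdep[x [y [hb hc [-> ->]]]].
move=> /allpairsPdep[x' [y' [hb' hc' [-> ->]]]] /= E.
have [bb|bb] := eqVneq x x'.
  have t0 : (1 / 3 : R)%:C != 0.
    by rewrite -modulus_gt0 modulus_real gtr0_norm; lra.
  by move: E; rewrite bb => /addrI /(mulfI t0) ->.
have := corners_sep hb hb' bb.
rewrite (_ : x - x' = (1 / 3)%:C * (y' - y)); last first.
  by rewrite mulrBr -{1}[x](addrK ((1 / 3)%:C * y)) E; ring.
rewrite supnormZ; last by lra.
have := supnormD y' (- y); rewrite supnormN.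
have := centres_in_box hc; have := centres_in_box hc'.
have : 0 <= (1 / 3 : R) ^+ n by rewrite exprn_ge0//; lra.
by clear E => *; exfalso; lra.
Qed.

(** Off the discs of radius 3 ^- n around the centres the truncation has no effect. *)
Lemma field_sum n z : (forall a, a \in centres n -> (1 / 3) ^+ n <= modulus (z - a)) ->
  field n z = ((1 / 4) ^+ n)%:C * \sum_(a <- centres n) (z - a)^-1.
Proof.
elim: n z => [|n IH] z H.
  rewrite big_cons big_nil addr0 expr0 mul1r subr0 /= kernel_out//.
  by have := H 0; rewrite inE eqxx subr0 expr0 => /(_ isT).
have zoom b a : 3%:C * (z - b) - a = 3%:C * (z - (b + (1 / 3)%:C * a)).
  have -> : (1 / 3 : R)%:C = 3%:C^-1 by rewrite -fmorphV div1r.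
  by field.
rewrite fieldS centresS big_allpairs_dep exprS.
have -> : (3 / 4 : R)%:C = (1 / 4)%:C * 3%:C.
  by rewrite -rmorphM; congr (_%:C); lra.
rewrite [X in _ = X * _]rmorphM -!mulrA; congr (_ * _).
rewrite !mulr_sumr big_seq [RHS]big_seq.
apply: eq_bigr => b hb; rewrite IH => [|a ha].
  rewrite !mulr_sumr; apply: eq_bigr => a _; rewrite zoom.
  rewrite invfM mulrCA [X in _ * X]mulrA divff ?mul1r//.
  by rewrite -modulus_gt0 modulus_real normr_gt0.
rewrite zoom modulus_realM ger0_norm//.
have /H : b + (1 / 3)%:C * a \in centres n.+1 by apply/centresSP; exists b, a.
by rewrite exprS; lra.
Qed.

End centres.

(** * Self-similar functions on an interval *)

Section self_similar_function.
Variable R : realType.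
Implicit Types s t : R.

Definition clamp s : R := Num.max 0 (Num.min 1 s).

Lemma clamp0 s : s <= 0 -> clamp s = 0.
Proof. by move=> s0; rewrite /clamp !maxEle !minEle; do 2 case: ifP; lra. Qed.

Lemma clamp1 s : 1 <= s -> clamp s = 1.
Proof. by move=> s0; rewrite /clamp !maxEle !minEle; do 2 case: ifP; lra. Qed.

Lemma clampE s : 0 <= s <= 1 -> clamp s = s.
Proof. by move=> s0; rewrite /clamp !maxEle !minEle; do 2 case: ifP; lra. Qed.

Lemma clamp_itv s : 0 <= clamp s <= 1.
Proof. by rewrite /clamp !maxEle !minEle; do 2 case: ifP; lra. Qed.

Lemma clamp_lipschitz s t : `|clamp s - clamp t| <= `|s - t|.
Proof.
have h1 := ler_norm (s - t); have h2 := ler_norm (t - s).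
rewrite (distrC t) in h2; have h3 := normr_ge0 (s - t).
by rewrite ler_norml /clamp !maxEle !minEle; do 4 case: ifP; lra.
Qed.

Variables (e : R) (g0 g1 g2 : R -> R) (K : R).
Hypothesis K_gt0 : 0 < K.
Hypothesis g0K : forall s t, `|g0 s - g0 t| <= K * `|s - t|.
Hypothesis g1K : forall s t, `|g1 s - g1 t| <= K * `|s - t|.
Hypothesis g2K : forall s t, `|g2 s - g2 t| <= K * `|s - t|.
Hypotheses (g00 : g0 0 = 0) (g10 : g1 0 = 0) (g20 : g2 0 = 0).

(** [0, 1] is cut in seven parts.  On the parts of even index a copy of u scaled by
   1/3 is inserted, on the others the prescribed functions g0, g1, g2.  Thanks to
   the clamps the increments along all parts can be added up. *)
Definition insert_copies (u : R -> R) t : R :=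
  e + (u (clamp (7 * t)) - e) / 3 + g0 (clamp (7 * t - 1))
    + (u (clamp (7 * t - 2)) - e) / 3 + g1 (clamp (7 * t - 3))
    + (u (clamp (7 * t - 4)) - e) / 3 + g2 (clamp (7 * t - 5))
    + (u (clamp (7 * t - 6)) - e) / 3.

(* The value at 1 that insert_copies preserves. *)
Let e' : R := e - 3 * (g0 1 + g1 1 + g2 1).

Lemma insert_copies0 u : u 0 = e -> insert_copies u 0 = e.
Proof.
by move=> ue; rewrite /insert_copies !clamp0 ?g00 ?g10 ?g20 ?ue; lra.
Qed.

Lemma insert_copies1 u : u 1 = e' -> insert_copies u 1 = e'.
Proof.
by move=> ue; rewrite /insert_copies !clamp1 ?ue ?/e'; lra.
Qed.

(** Among the clamps of the four copies at most one lies strictly between 0 and 1, and at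
   0 and 1 the functions agree. *)
Lemma insert_copies_contract u v (D : R) : u 0 = v 0 -> u 1 = v 1 ->
  (forall t, `|u t - v t| <= D) ->
  forall t, `|insert_copies u t - insert_copies v t| <= D / 3.
Proof.
move=> uv0 uv1 H t; have D0 : 0 <= D by rewrite (le_trans _ (H 0)).
pose w s := u s - v s.
have w0 : w 0 = 0 by rewrite /w uv0 subrr.
have w1 : w 1 = 0 by rewrite /w uv1 subrr.
have -> : insert_copies u t - insert_copies v t =
    (w (clamp (7 * t)) + w (clamp (7 * t - 2)) + w (clamp (7 * t - 4)) +
     w (clamp (7 * t - 6))) / 3.
  by rewrite /insert_copies /w; lra.
rewrite normrM [X in _ * X]ger0_norm; last by lra.
rewrite ler_wpM2r//.
have [t2|t2] := lerP (7 * t) 2.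
  by rewrite (@clamp0 (7 * t - 2)) ?(@clamp0 (7 * t - 4)) ?(@clamp0 (7 * t - 6));
    rewrite ?w0 ?addr0 ?H//; lra.
have [t4|t4] := lerP (7 * t) 4.
  by rewrite (@clamp1 (7 * t)) ?(@clamp0 (7 * t - 4)) ?(@clamp0 (7 * t - 6));
    rewrite ?w0 ?w1 ?addr0 ?add0r ?H//; lra.
have [t6|t6] := lerP (7 * t) 6.
  by rewrite (@clamp1 (7 * t)) ?(@clamp1 (7 * t - 2)) ?(@clamp0 (7 * t - 6));
    rewrite ?w0 ?w1 ?addr0 ?add0r ?H//; lra.
by rewrite (@clamp1 (7 * t)) ?(@clamp1 (7 * t - 2)) ?(@clamp1 (7 * t - 4));
    rewrite ?w0 ?w1 ?addr0 ?add0r ?H//; lra.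
Qed.

Lemma insert_copies_near u v (D : R) : (forall t, `|u t - v t| <= D) ->
  forall t, `|insert_copies u t - insert_copies v t| <= 2 * D.
Proof.
move=> H t; have := H (clamp (7 * t)); have := H (clamp (7 * t - 2)).
have := H (clamp (7 * t - 4)); have := H (clamp (7 * t - 6)).
rewrite /insert_copies !ler_norml; lra.
Qed.

Lemma insert_copies_lipschitz u (L : R) : 0 < L ->
  (forall s t, `|u s - u t| <= L * `|s - t|) ->
  forall s t, `|insert_copies u s - insert_copies u t| <= (28 * L + 21 * K) * `|s - t|.
Proof.
move=> L0 HL s t; set d := `|s - t|.
have cl (k : R) : `|clamp (7 * s - k) - clamp (7 * t - k)| <= 7 * d.
  apply: (le_trans (clamp_lipschitz _ _)).
  have -> : 7 * s - k - (7 * t - k) = 7 * (s - t) by lra.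
  by rewrite normrM (@ger0_norm _ 7).
have cl0 : `|clamp (7 * s) - clamp (7 * t)| <= 7 * d.
  by have := cl 0; rewrite !subr0.
have d0 : 0 <= d by rewrite normr_ge0.
have U k : `|u (clamp (7 * s - k)) - u (clamp (7 * t - k))| <= L * (7 * d).
  by rewrite (le_trans (HL _ _))// ler_wpM2l// ltW.
have U0 : `|u (clamp (7 * s)) - u (clamp (7 * t))| <= L * (7 * d).
  by rewrite (le_trans (HL _ _))// ler_wpM2l// ltW.
have G (h : R -> R) k : (forall s t, `|h s - h t| <= K * `|s - t|) ->
    `|h (clamp (7 * s - k)) - h (clamp (7 * t - k))| <= K * (7 * d).
  by move=> hK; rewrite (le_trans (hK _ _))// ler_wpM2l// ltW.
have := U0; have := U 2; have := U 4; have := U 6.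
have := G _ 1 g0K; have := G _ 3 g1K; have := G _ 5 g2K.
have Ld : 0 <= L * d by rewrite mulr_ge0// ltW.
have Kd : 0 <= K * d by rewrite mulr_ge0// ltW.
rewrite /insert_copies !ler_norml; lra.
Qed.

Fixpoint copies_iter n t : R :=
  if n is m.+1 then insert_copies (copies_iter m) t else e + (e' - e) * clamp t.

Lemma copies_iter0 n : copies_iter n 0 = e.
Proof.
elim: n => [|n IH]; last exact: insert_copies0.
by rewrite /= clamp0//; lra.
Qed.

Lemma copies_iter1 n : copies_iter n 1 = e'.
Proof.
elim: n => [|n IH]; last exact: insert_copies1.
by rewrite /= clamp1//; lra.
Qed.

Lemma copies_iter_lipschitz n : exists2 L, 0 < L &
  forall s t, `|copies_iter n s - copies_iter n t| <= L * `|s - t|.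
Proof.
elim: n => [|n [L L0 HL]].
  exists (`|e' - e| + 1) => [|s t /=]; first by have := normr_ge0 (e' - e); lra.
  rewrite (_ : _ - _ = (e' - e) * (clamp s - clamp t)); last by lra.
  rewrite normrM; have := clamp_lipschitz s t; have := normr_ge0 (e' - e).
  by have := normr_ge0 (s - t); nra.
exists (28 * L + 21 * K); last exact: insert_copies_lipschitz.
by have := K_gt0; lra.
Qed.

Lemma copies_iter_step : exists2 D, 0 <= D &
  forall n t, `|copies_iter n.+1 t - copies_iter n t| <= D * (1 / 3) ^+ n.
Proof.
have [L L0 HL] := copies_iter_lipschitz 0; have [M M0 HM] := copies_iter_lipschitz 1.
pose f t := copies_iter 1 (clamp t) - copies_iter 0 (clamp t).
have E t : copies_iter 1 t - copies_iter 0 t = f t.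
  rewrite /f; case: (lerP t 0) => t0.
    by rewrite (clamp0 t0) /= /insert_copies !clamp0; lra.
  case: (lerP t 1) => t1; first by rewrite clampE; lra.
  by rewrite (clamp1 (ltW t1)) /= /insert_copies !clamp1; lra.
exists (M + L); first by lra.
elim=> [|n IH] t.
  rewrite E expr0 /f; have /andP[c0 c1] := clamp_itv t.
  have := HM (clamp t) 0; have := HL (clamp t) 0.
  rewrite !copies_iter0 !subr0 (ger0_norm c0) !ler_norml; nra.
have h0 : copies_iter n.+1 0 = copies_iter n 0 by rewrite !copies_iter0.
have h1 : copies_iter n.+1 1 = copies_iter n 1 by rewrite !copies_iter1.
by have := insert_copies_contract h0 h1 IH t; rewrite exprS /=; lra.
Qed.

Lemma self_similar_exists : exists u : R -> R, ucont (@distR R) (@distR R) u /\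
  forall t, u t = insert_copies u t.
Proof.
have [D D0 HD] := copies_iter_step.
have H t : exists l, forall n, `|copies_iter n t - l| <= D * 2 * (1 / 3) ^+ n.
  apply: geometric_real_limit; [lra|lra|move=> n].
  by have := HD n t; have : 0 <= D * (1 / 3) ^+ n; [rewrite mulr_ge0// exprn_ge0//; lra|lra].
pose u t := projT1 (cid (H t)).
have Hu n t : `|copies_iter n t - u t| <= D * 2 * (1 / 3) ^+ n.
  by rewrite /u; case: (cid _).
have small (d : R) : 0 < d -> exists n, D * 2 * (1 / 3) ^+ n <= d.
  move=> d0; have [n Hn] : exists n, (1 / 3 : R) ^+ n < d / (D * 2 + 1).
    by apply: exp_lt_eps; [lra|rewrite divr_gt0//; lra].
  exists n; move: Hn; rewrite ltr_pdivlMr; last by lra.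
  have : 0 <= (1 / 3 : R) ^+ n by rewrite exprn_ge0//; lra.
  by nra.
exists u; split.
  apply: ucont_limit; [exact: distR_sym|exact: distR_triangle|move=> d /small[n Hn]].
  exists (copies_iter n); last by move=> t; exact: le_trans (Hu n t) Hn.
  by have [L L0 HL] := copies_iter_lipschitz n; exact: lipschitz_ucont L0 HL.
move=> t; apply/eqP; rewrite -subr_eq0 -normr_le0; apply/ler_addgt0Pl => d d0.
have d3 : 0 < d / 3 by lra.
have [n Hn] := small _ d3.
have h1 := Hu n.+1 t.
have h2 := insert_copies_near (Hu n) t.
have : D * 2 * (1 / 3) ^+ n.+1 <= D * 2 * (1 / 3) ^+ n.
  by rewrite exprS; have : 0 <= D * 2 * (1 / 3) ^+ n;
    [rewrite mulr_ge0 ?exprn_ge0//; lra|lra].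
by move: h1 h2; rewrite addr0 !ler_norml; move: Hn => /=; lra.
Qed.

Section fixed_function.
Variable u : R -> R.
Hypothesis uE : forall t, u t = insert_copies u t.

Lemma fixed0 : u 0 = e.
Proof.
have := uE 0; rewrite /insert_copies !clamp0 ?g00 ?g10 ?g20; lra.
Qed.

Lemma fixed1 : u 1 = e'.
Proof.
have := uE 1; rewrite /insert_copies !clamp1; rewrite /e'; lra.
Qed.

Lemma fixed_piece0 s : 0 <= s <= 1 -> u (s / 7) = e + (u s - e) / 3.
Proof.
move=> s01; rewrite {1}uE /insert_copies (_ : 7 * (s / 7) = s); last by lra.
rewrite (clampE s01) !clamp0 ?fixed0 ?g00 ?g10 ?g20; lra.
Qed.

Lemma fixed_gap0 s : 0 <= s <= 1 -> u ((s + 1) / 7) = e + (e' - e) / 3 + g0 s.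
Proof.
move=> s01; rewrite {1}uE /insert_copies (_ : 7 * ((s + 1) / 7) = s + 1); last by lra.
rewrite (@clamp1 (s + 1)) ?addrK ?(clampE s01); try lra.
rewrite !clamp0 ?fixed0 ?fixed1 ?g00 ?g10 ?g20; lra.
Qed.

Lemma fixed_piece1 s : 0 <= s <= 1 ->
  u ((s + 2) / 7) = e + (e' - e) / 3 + g0 1 + (u s - e) / 3.
Proof.
move=> s01; rewrite {1}uE /insert_copies (_ : 7 * ((s + 2) / 7) = s + 2); last by lra.
rewrite (@clamp1 (s + 2)) ?(@clamp1 (s + 2 - 1)) ?addrK ?(clampE s01); try lra.
rewrite !clamp0 ?fixed0 ?fixed1 ?g00 ?g10 ?g20; lra.
Qed.

Lemma fixed_gap1 s : 0 <= s <= 1 ->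
  u ((s + 3) / 7) = e + (e' - e) / 3 * 2 + g0 1 + g1 s.
Proof.
move=> s01; rewrite {1}uE /insert_copies (_ : 7 * ((s + 3) / 7) = s + 3); last by lra.
rewrite (@clamp1 (s + 3)) ?(@clamp1 (s + 3 - 1)) ?(@clamp1 (s + 3 - 2)) ?addrK
  ?(clampE s01); try lra.
rewrite !clamp0 ?fixed0 ?fixed1 ?g00 ?g10 ?g20; lra.
Qed.

Lemma fixed_piece2 s : 0 <= s <= 1 ->
  u ((s + 4) / 7) = e + (e' - e) / 3 * 2 + g0 1 + g1 1 + (u s - e) / 3.
Proof.
move=> s01; rewrite {1}uE /insert_copies (_ : 7 * ((s + 4) / 7) = s + 4); last by lra.
rewrite (@clamp1 (s + 4)) ?(@clamp1 (s + 4 - 1)) ?(@clamp1 (s + 4 - 2))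
  ?(@clamp1 (s + 4 - 3)) ?addrK ?(clampE s01); try lra.
rewrite !clamp0 ?fixed0 ?fixed1 ?g00 ?g10 ?g20; lra.
Qed.

Lemma fixed_gap2 s : 0 <= s <= 1 ->
  u ((s + 5) / 7) = e + (e' - e) + g0 1 + g1 1 + g2 s.
Proof.
move=> s01; rewrite {1}uE /insert_copies (_ : 7 * ((s + 5) / 7) = s + 5); last by lra.
rewrite (@clamp1 (s + 5)) ?(@clamp1 (s + 5 - 1)) ?(@clamp1 (s + 5 - 2))
  ?(@clamp1 (s + 5 - 3)) ?(@clamp1 (s + 5 - 4)) ?addrK ?(clampE s01); try lra.
rewrite !clamp0 ?fixed0 ?fixed1 ?g00 ?g10 ?g20; lra.
Qed.

Lemma fixed_piece3 s : 0 <= s <= 1 ->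
  u ((s + 6) / 7) = e + (e' - e) + g0 1 + g1 1 + g2 1 + (u s - e) / 3.
Proof.
move=> s01; rewrite {1}uE /insert_copies (_ : 7 * ((s + 6) / 7) = s + 6); last by lra.
rewrite (@clamp1 (s + 6)) ?(@clamp1 (s + 6 - 1)) ?(@clamp1 (s + 6 - 2))
  ?(@clamp1 (s + 6 - 3)) ?(@clamp1 (s + 6 - 4)) ?(@clamp1 (s + 6 - 5))
  ?addrK ?(clampE s01); try lra.
rewrite ?fixed0 ?fixed1 ?g00 ?g10 ?g20; lra.
Qed.

End fixed_function.

End self_similar_function.

(** * A Lebesgue curve through the Cantor square and its height function *)

Section curve.
Variable R : realType.
Implicit Types s t : R.

Definition tent s : R := 1 - `|2 * s - 1|.

Lemma tent_lipschitz s t : `|tent s - tent t| <= 2 * `|s - t|.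
Proof.
rewrite /tent (_ : _ - _ = `|2 * t - 1| - `|2 * s - 1|); last by lra.
apply: (le_trans (ler_dist_dist _ _)).
rewrite (_ : 2 * t - 1 - (2 * s - 1) = 2 * (t - s)); last by lra.
by rewrite normrM ger0_norm// distrC.
Qed.

Lemma linear_lipschitz (a : R) s t : `|a| <= 2 -> `|a * s - a * t| <= 2 * `|s - t|.
Proof. by move=> a2; rewrite -mulrBr normrM ler_wpM2r. Qed.

Lemma curve_x_exists : exists u : R -> R, ucont (@distR R) (@distR R) u /\
  forall t, u t = insert_copies (-1) (fun s => 2 / 3 * s) (fun s => - 2 * s)
                    (fun s => 2 / 3 * s) u t.
Proof.
apply: (@self_similar_exists R _ _ _ _ 2) => //; rewrite ?mulr0// => s t;
  by apply: linear_lipschitz; rewrite ler_norml; lra.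
Qed.

Lemma curve_y_exists : exists u : R -> R, ucont (@distR R) (@distR R) u /\
  forall t, u t = insert_copies (-1) (fun s => - (2 / 3) * s) (fun s => 2 / 3 * s)
                    (fun s => - (2 / 3) * s) u t.
Proof.
apply: (@self_similar_exists R _ _ _ _ 2) => //; rewrite ?mulr0// => s t;
  by apply: linear_lipschitz; rewrite ler_norml; lra.
Qed.

Lemma tent0 : tent 0 = 0.
Proof. by rewrite /tent mulr0 sub0r normrN normr1 subrr. Qed.

Lemma tent1 : tent 1 = 0.
Proof. by rewrite /tent mulr1 (_ : 2 - 1 = 1) ?normr1 ?subrr//; lra. Qed.

Lemma curve_h_exists : exists u : R -> R, ucont (@distR R) (@distR R) u /\
  forall t, u t = insert_copies 0 tent tent tent u t.
Proof.
by apply: (@self_similar_exists R _ _ _ _ 2) => //; rewrite ?tent0//;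
  exact: tent_lipschitz.
Qed.

(** The point (curve_x, curve_y) runs through four copies of the whole curve in the
   subsquares, joined by three segments.  The height curve_h is 0 over the Cantor square
   and a tent over each segment, scaled by 3 ^- n at level n. *)
Definition curve_x : R -> R := projT1 (cid curve_x_exists).
Definition curve_y : R -> R := projT1 (cid curve_y_exists).
Definition curve_h : R -> R := projT1 (cid curve_h_exists).

Lemma curve_x_ucont : ucont (@distR R) (@distR R) curve_x.
Proof. by rewrite /curve_x; case: cid => u []. Qed.
Lemma curve_y_ucont : ucont (@distR R) (@distR R) curve_y.
Proof. by rewrite /curve_y; case: cid => u []. Qed.
Lemma curve_h_ucont : ucont (@distR R) (@distR R) curve_h.
Proof. by rewrite /curve_h; case: cid => u []. Qed.

Lemma curve_xE t : curve_x t = insert_copies (-1) (fun s => 2 / 3 * s)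
  (fun s => - 2 * s) (fun s => 2 / 3 * s) curve_x t.
Proof. by rewrite /curve_x; case: cid => u []. Qed.
Lemma curve_yE t : curve_y t = insert_copies (-1) (fun s => - (2 / 3) * s)
  (fun s => 2 / 3 * s) (fun s => - (2 / 3) * s) curve_y t.
Proof. by rewrite /curve_y; case: cid => u []. Qed.
Lemma curve_hE t : curve_h t = insert_copies 0 tent tent tent curve_h t.
Proof. by rewrite /curve_h; case: cid => u []. Qed.


Lemma curve_piece0 s : 0 <= s <= 1 ->
  [/\ curve_x (s / 7) = curve_x s / 3 - 2 / 3,
      curve_y (s / 7) = curve_y s / 3 - 2 / 3 &
      curve_h (s / 7) = curve_h s / 3].
Proof.
move=> s01; split.
- by rewrite (fixed_piece0 _ _ _ curve_xE s01) ?mulr0//; lra.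
- by rewrite (fixed_piece0 _ _ _ curve_yE s01) ?mulr0//; lra.
- by rewrite (fixed_piece0 _ _ _ curve_hE s01) ?tent0 ?tent1//; lra.
Qed.

Lemma curve_piece1 s : 0 <= s <= 1 ->
  [/\ curve_x ((s + 2) / 7) = curve_x s / 3 + 2 / 3,
      curve_y ((s + 2) / 7) = curve_y s / 3 - 2 / 3 &
      curve_h ((s + 2) / 7) = curve_h s / 3].
Proof.
move=> s01; split.
- by rewrite (fixed_piece1 _ _ _ curve_xE s01) ?mulr0//; lra.
- by rewrite (fixed_piece1 _ _ _ curve_yE s01) ?mulr0//; lra.
- by rewrite (fixed_piece1 _ _ _ curve_hE s01) ?tent0 ?tent1//; lra.
Qed.

Lemma curve_piece2 s : 0 <= s <= 1 ->
  [/\ curve_x ((s + 4) / 7) = curve_x s / 3 - 2 / 3,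
      curve_y ((s + 4) / 7) = curve_y s / 3 + 2 / 3 &
      curve_h ((s + 4) / 7) = curve_h s / 3].
Proof.
move=> s01; split.
- by rewrite (fixed_piece2 _ _ _ curve_xE s01) ?mulr0//; lra.
- by rewrite (fixed_piece2 _ _ _ curve_yE s01) ?mulr0//; lra.
- by rewrite (fixed_piece2 _ _ _ curve_hE s01) ?tent0 ?tent1//; lra.
Qed.

Lemma curve_piece3 s : 0 <= s <= 1 ->
  [/\ curve_x ((s + 6) / 7) = curve_x s / 3 + 2 / 3,
      curve_y ((s + 6) / 7) = curve_y s / 3 + 2 / 3 &
      curve_h ((s + 6) / 7) = curve_h s / 3].
Proof.
move=> s01; split.
- by rewrite (fixed_piece3 curve_xE s01) ?mulr0//; lra.
- by rewrite (fixed_piece3 curve_yE s01) ?mulr0//; lra.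
- by rewrite (fixed_piece3 curve_hE s01) ?tent0 ?tent1//; lra.
Qed.

Lemma curve_gap0 s : 0 <= s <= 1 ->
  [/\ curve_x ((s + 1) / 7) = - (1 / 3) + 2 / 3 * s, curve_y ((s + 1) / 7) = - (1 / 3) - 2 / 3 * s &
      curve_h ((s + 1) / 7) = tent s].
Proof.
move=> s01; split.
- by rewrite (fixed_gap0 _ _ _ curve_xE s01) ?mulr0//; lra.
- by rewrite (fixed_gap0 _ _ _ curve_yE s01) ?mulr0//; lra.
- by rewrite (fixed_gap0 _ _ _ curve_hE s01) ?tent0 ?tent1//; lra.
Qed.

Lemma curve_gap1 s : 0 <= s <= 1 ->
  [/\ curve_x ((s + 3) / 7) = 1 - 2 * s, curve_y ((s + 3) / 7) = - (1 / 3) + 2 / 3 * s &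
      curve_h ((s + 3) / 7) = tent s].
Proof.
move=> s01; split.
- by rewrite (fixed_gap1 _ _ _ curve_xE s01) ?mulr0//; lra.
- by rewrite (fixed_gap1 _ _ _ curve_yE s01) ?mulr0//; lra.
- by rewrite (fixed_gap1 _ _ _ curve_hE s01) ?tent0 ?tent1//; lra.
Qed.

Lemma curve_gap2 s : 0 <= s <= 1 ->
  [/\ curve_x ((s + 5) / 7) = - (1 / 3) + 2 / 3 * s, curve_y ((s + 5) / 7) = 1 - 2 / 3 * s &
      curve_h ((s + 5) / 7) = tent s].
Proof.
move=> s01; split.
- by rewrite (fixed_gap2 _ _ _ curve_xE s01) ?mulr0//; lra.
- by rewrite (fixed_gap2 _ _ _ curve_yE s01) ?mulr0//; lra.
- by rewrite (fixed_gap2 _ _ _ curve_hE s01) ?tent0 ?tent1//; lra.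
Qed.

(** The subsquares are visited in the order of a Z, as by Lebesgue's curve, each one being
   entered at its lower left and left at its upper right corner.  With this choice the
   joining segments run in the gaps between the subsquares and do not meet. *)
Variant curve_part t : Prop :=
| Piece0 s of 0 <= s <= 1 & t = s / 7 & curve_x t = curve_x s / 3 - 2 / 3
    & curve_y t = curve_y s / 3 - 2 / 3 & curve_h t = curve_h s / 3
| Gap0 s of 0 < s < 1 & t = (s + 1) / 7 & curve_x t = - (1 / 3) + 2 / 3 * s
    & curve_y t = - (1 / 3) - 2 / 3 * s & curve_h t = tent s
| Piece1 s of 0 <= s <= 1 & t = (s + 2) / 7 & curve_x t = curve_x s / 3 + 2 / 3
    & curve_y t = curve_y s / 3 - 2 / 3 & curve_h t = curve_h s / 3
| Gap1 s of 0 < s < 1 & t = (s + 3) / 7 & curve_x t = 1 - 2 * s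
    & curve_y t = - (1 / 3) + 2 / 3 * s & curve_h t = tent s
| Piece2 s of 0 <= s <= 1 & t = (s + 4) / 7 & curve_x t = curve_x s / 3 - 2 / 3
    & curve_y t = curve_y s / 3 + 2 / 3 & curve_h t = curve_h s / 3
| Gap2 s of 0 < s < 1 & t = (s + 5) / 7 & curve_x t = - (1 / 3) + 2 / 3 * s
    & curve_y t = 1 - 2 / 3 * s & curve_h t = tent s
| Piece3 s of 0 <= s <= 1 & t = (s + 6) / 7 & curve_x t = curve_x s / 3 + 2 / 3
    & curve_y t = curve_y s / 3 + 2 / 3 & curve_h t = curve_h s / 3.

Lemma curve_partP t : 0 <= t <= 1 -> curve_part t.
Proof.
move=> t01.
have [h|h1] := lerP (7 * t) 1.
  have s01 : 0 <= 7 * t <= 1 by lra.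
  have tE : t = (7 * t) / 7 by lra.
  by have := curve_piece0 s01; rewrite -tE => -[]; exact: Piece0 s01 tE.
have [h|h2] := ltrP (7 * t) 2.
  have s01 : 0 < 7 * t - 1 < 1 by lra.
  have s01' : 0 <= 7 * t - 1 <= 1 by lra.
  have tE : t = (7 * t - 1 + 1) / 7 by lra.
  by have := curve_gap0 s01'; rewrite -tE => -[]; exact: Gap0 s01 tE.
have [h|h3] := lerP (7 * t) 3.
  have s01 : 0 <= 7 * t - 2 <= 1 by lra.
  have tE : t = (7 * t - 2 + 2) / 7 by lra.
  by have := curve_piece1 s01; rewrite -tE => -[]; exact: Piece1 s01 tE.
have [h|h4] := ltrP (7 * t) 4.
  have s01 : 0 < 7 * t - 3 < 1 by lra.
  have s01' : 0 <= 7 * t - 3 <= 1 by lra.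
  have tE : t = (7 * t - 3 + 3) / 7 by lra.
  by have := curve_gap1 s01'; rewrite -tE => -[]; exact: Gap1 s01 tE.
have [h|h5] := lerP (7 * t) 5.
  have s01 : 0 <= 7 * t - 4 <= 1 by lra.
  have tE : t = (7 * t - 4 + 4) / 7 by lra.
  by have := curve_piece2 s01; rewrite -tE => -[]; exact: Piece2 s01 tE.
have [h|h6] := ltrP (7 * t) 6.
  have s01 : 0 < 7 * t - 5 < 1 by lra.
  have s01' : 0 <= 7 * t - 5 <= 1 by lra.
  have tE : t = (7 * t - 5 + 5) / 7 by lra.
  by have := curve_gap2 s01'; rewrite -tE => -[]; exact: Gap2 s01 tE.
have s01 : 0 <= 7 * t - 6 <= 1 by lra.
have tE : t = (7 * t - 6 + 6) / 7 by lra.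
by have := curve_piece3 s01; rewrite -tE => -[]; exact: Piece3 s01 tE.
Qed.

Lemma tent_gt0 s : 0 < s < 1 -> 0 < tent s.
Proof. by move=> s01; rewrite /tent subr_gt0 ltr_norml; lra. Qed.

Lemma tent_le1 s : tent s <= 1.
Proof. by rewrite /tent; have := normr_ge0 (2 * s - 1); lra. Qed.

Lemma ucont_extrema (f : R -> R) : ucont (@distR R) (@distR R) f ->
  (exists2 c, 0 <= c <= 1 & forall t, 0 <= t <= 1 -> f c <= f t) /\
  (exists2 c, 0 <= c <= 1 & forall t, 0 <= t <= 1 -> f t <= f c).
Proof.
move=> /ucont_continuous Hf.
have Hf' : {within `[0, 1], continuous f} by exact: continuous_subspaceT.
split.
  have [c c01 Hc] := EVT_min ler01 Hf'; exists c; first by rewrite in_itv in c01.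
  by move=> t t01; apply: Hc; rewrite in_itv.
have [c c01 Hc] := EVT_max ler01 Hf'; exists c; first by rewrite in_itv in c01.
by move=> t t01; apply: Hc; rewrite in_itv.
Qed.

(** At a point where an extremum is attained, the value is either explicit or expressed by
   another value divided by 3. *)
Lemma curve_x_bound t : 0 <= t <= 1 -> -1 <= curve_x t <= 1.
Proof.
move=> t01; have [[a a01 Ha] [b b01 Hb]] := ucont_extrema curve_x_ucont.
have := Ha t t01; have := Hb t t01.
have : -1 <= curve_x a.
  case: (curve_partP a01) => s s01 _ E _ _; rewrite E; try (by lra);
  by have := Ha s s01; rewrite E; lra.
have : curve_x b <= 1.
  case: (curve_partP b01) => s s01 _ E _ _; rewrite E; try (by lra);
  by have := Hb s s01; rewrite E; lra.
lra.
Qed.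

Lemma curve_y_bound t : 0 <= t <= 1 -> -1 <= curve_y t <= 1.
Proof.
move=> t01; have [[a a01 Ha] [b b01 Hb]] := ucont_extrema curve_y_ucont.
have := Ha t t01; have := Hb t t01.
have : -1 <= curve_y a.
  case: (curve_partP a01) => s s01 _ _ E _; rewrite E; try (by lra);
  by have := Ha s s01; rewrite E; lra.
have : curve_y b <= 1.
  case: (curve_partP b01) => s s01 _ _ E _; rewrite E; try (by lra);
  by have := Hb s s01; rewrite E; lra.
lra.
Qed.

Lemma curve_h_bound t : 0 <= t <= 1 -> 0 <= curve_h t <= 1.
Proof.
move=> t01; have [[a a01 Ha] [b b01 Hb]] := ucont_extrema curve_h_ucont.
have := Ha t t01; have := Hb t t01.
have : 0 <= curve_h a.
  case: (curve_partP a01) => s s01 _ _ _ E; rewrite E;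
    try (by have := Ha s s01; rewrite E; lra); exact: ltW (tent_gt0 s01).
have : curve_h b <= 1.
  case: (curve_partP b01) => s s01 _ _ _ E; rewrite E;
    try (by have := Hb s s01; rewrite E; lra); exact: tent_le1.
lra.
Qed.

(** The thresholds are the lines bounding the gaps between the subsquares. *)
Definition part_index (x y : R) : nat :=
  if y <= - (1 / 3) then (if x <= - (1 / 3) then 0 else if x < 1 / 3 then 1 else 2)
  else if y < 1 / 3 then 3
  else (if x <= - (1 / 3) then 4 else if x < 1 / 3 then 5 else 6).

Definition part_data (k : nat) t : Prop :=
  match k with
  | 0 => exists s, [/\ 0 <= s <= 1, t = s / 7,
           curve_x t = curve_x s / 3 - 2 / 3 & curve_y t = curve_y s / 3 - 2 / 3]
  | 1 => t = (3 / 2 * curve_x t + 3 / 2) / 7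
  | 2 => exists s, [/\ 0 <= s <= 1, t = (s + 2) / 7,
           curve_x t = curve_x s / 3 + 2 / 3 & curve_y t = curve_y s / 3 - 2 / 3]
  | 3 => t = (7 / 2 - curve_x t / 2) / 7
  | 4 => exists s, [/\ 0 <= s <= 1, t = (s + 4) / 7,
           curve_x t = curve_x s / 3 - 2 / 3 & curve_y t = curve_y s / 3 + 2 / 3]
  | 5 => t = (3 / 2 * curve_x t + 11 / 2) / 7
  | _ => exists s, [/\ 0 <= s <= 1, t = (s + 6) / 7,
           curve_x t = curve_x s / 3 + 2 / 3 & curve_y t = curve_y s / 3 + 2 / 3]
  end.

Lemma part_indexP t : 0 <= t <= 1 -> part_data (part_index (curve_x t) (curve_y t)) t.
Proof.
have idx (k : nat) x y : part_index x y = k -> part_data k t ->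
  part_data (part_index x y) t by move=> ->.
move=> /curve_partP[] s s01 tE xE yE _.
1,3,5,7: have := curve_x_bound s01; have := curve_y_bound s01 => hy hx.
- apply: (idx 0%N); last by exists s.
  rewrite xE yE /part_index.
  rewrite ifT; last by lra.
  rewrite ifT; last by lra.
  by [].
- apply: (idx 2%N); last by exists s.
  rewrite xE yE /part_index.
  rewrite ifT; last by lra.
  rewrite ifF; last by apply/negbTE; rewrite -ltNge; lra.
  rewrite ifF; last by apply/negbTE; rewrite -leNgt; lra.
  by [].
- apply: (idx 4%N); last by exists s.
  rewrite xE yE /part_index.
  rewrite ifF; last by apply/negbTE; rewrite -ltNge; lra.
  rewrite ifF; last by apply/negbTE; rewrite -leNgt; lra.
  rewrite ifT; last by lra.
  by [].
- apply: (idx 6%N); last by exists s.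
  rewrite xE yE /part_index.
  rewrite ifF; last by apply/negbTE; rewrite -ltNge; lra.
  rewrite ifF; last by apply/negbTE; rewrite -leNgt; lra.
  rewrite ifF; last by apply/negbTE; rewrite -ltNge; lra.
  rewrite ifF; last by apply/negbTE; rewrite -leNgt; lra.
  by [].
- apply: (idx 1%N); last by rewrite /=; lra.
  rewrite xE yE /part_index.
  rewrite ifT; last by lra.
  rewrite ifF; last by apply/negbTE; rewrite -ltNge; lra.
  rewrite ifT; last by lra.
  by [].
- apply: (idx 3%N); last by rewrite /=; lra.
  rewrite xE yE /part_index.
  rewrite ifF; last by apply/negbTE; rewrite -ltNge; lra.
  rewrite ifT; last by lra.
  by [].
- apply: (idx 5%N); last by rewrite /=; lra.
  rewrite xE yE /part_index.
  rewrite ifF; last by apply/negbTE; rewrite -ltNge; lra.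
  rewrite ifF; last by apply/negbTE; rewrite -leNgt; lra.
  rewrite ifF; last by apply/negbTE; rewrite -ltNge; lra.
  rewrite ifT; last by lra.
  by [].
Qed.

(** Parts of different index have disjoint images.  Zooming into a common piece
   multiplies |t - t'| by 7, which can be repeated only finitely often if t and t'
   are different. *)
Lemma curve_inj t t' : 0 <= t <= 1 -> 0 <= t' <= 1 ->
  curve_x t = curve_x t' -> curve_y t = curve_y t' -> t = t'.
Proof.
move=> t01 t'01 ex ey.
have H n : forall t t', 0 <= t <= 1 -> 0 <= t' <= 1 ->
    curve_x t = curve_x t' -> curve_y t = curve_y t' -> `|t - t'| <= (1 / 7) ^+ n.
  elim: n => [|n IH] {t01 t'01 ex ey} {}t {}t' t01 t'01 ex ey.
    by rewrite expr0 ler_norml; lra.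
  have e7 : 0 <= (1 / 7 : R) ^+ n.+1 by rewrite exprn_ge0//; lra.
  have zoom s s' k : 0 <= s <= 1 -> 0 <= s' <= 1 -> t = (s + k) / 7 ->
      t' = (s' + k) / 7 -> curve_x s = curve_x s' -> curve_y s = curve_y s' ->
      `|t - t'| <= (1 / 7) ^+ n.+1.
    move=> s01 s'01 -> -> xs ys; have := IH s s' s01 s'01 xs ys.
    by rewrite exprS !ler_norml; lra.
  have same : t = t' -> `|t - t'| <= (1 / 7) ^+ n.+1.
    by move=> ->; rewrite subrr normr0.
  have := part_indexP t01; have := part_indexP t'01; rewrite -ex -ey.
  case: (part_index _ _) => [|[|[|[|[|[|k]]]]]] /=.
  - move=> [s' [s'01 tE' xE' yE']] [s [s01 tE xE yE]].
    by apply: (zoom s s' 0); rewrite ?addr0//; lra.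
  - by rewrite -ex => E1 E2; apply: same; lra.
  - move=> [s' [s'01 tE' xE' yE']] [s [s01 tE xE yE]].
    by apply: (zoom s s' 2) => //; lra.
  - by rewrite -ex => E1 E2; apply: same; lra.
  - move=> [s' [s'01 tE' xE' yE']] [s [s01 tE xE yE]].
    by apply: (zoom s s' 4) => //; lra.
  - by rewrite -ex => E1 E2; apply: same; lra.
  - move=> [s' [s'01 tE' xE' yE']] [s [s01 tE xE yE]].
    by apply: (zoom s s' 6) => //; lra.
apply/eqP; rewrite -subr_eq0 -normr_le0; apply/ler_addgt0Pl => d d0.
have [n Hn] : exists n, (1 / 7 : R) ^+ n < d by apply: exp_lt_eps; lra.
by rewrite addr0; have := H n t t' t01 t'01 ex ey; lra.
Qed.

Definition curve_z t : R[i] := curve_x t +i* curve_y t.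

Lemma curve_near_centre n a : a \in centres R n -> exists t, [/\ 0 <= t <= 1,
  supnorm (curve_z t - a) <= (1 / 3) ^+ n & curve_h t <= (1 / 3) ^+ n].
Proof.
elim: n a => [|n IH] a.
  rewrite inE => /eqP ->; exists 0; have h01 : 0 <= (0 : R) <= 1 by lra.
  rewrite expr0 subr0 /supnorm /= ge_max !ler_norml.
  have := curve_x_bound h01; have := curve_y_bound h01; have := curve_h_bound h01.
  by move=> *; split; [lra|apply/andP; split; lra|lra].
move=> /centresSP[b [c [hb /IH[s [s01 hs ch]] ->]]].
have E t : curve_x t = curve_x s / 3 + Re b -> curve_y t = curve_y s / 3 + Im b ->
    supnorm (curve_z t - (b + (1 / 3)%:C * c)) <= (1 / 3) ^+ n.+1.
  move=> xE yE; have -> : curve_z t - (b + (1 / 3)%:C * c) =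
      (1 / 3)%:C * (curve_z s - c).
    rewrite /curve_z xE yE; case: (b) (c) => [b1 b2] [c1 c2]; apply/eqP.
    by rewrite eq_complex /=; apply/andP; split; apply/eqP; lra.
  by rewrite supnormZ ?exprS; lra.
have H t : curve_h t = curve_h s / 3 -> curve_h t <= (1 / 3) ^+ n.+1.
  by rewrite exprS; lra.
move: hb; rewrite !inE => /or4P[] /eqP bE; rewrite bE in E *.
- have [x0 y0 h0] := curve_piece0 s01; exists (s / 7).
  by split; [lra|apply: E => /=; lra|apply: H].
- have [x0 y0 h0] := curve_piece1 s01; exists ((s + 2) / 7).
  by split; [lra|apply: E => /=; lra|apply: H].
- have [x0 y0 h0] := curve_piece2 s01; exists ((s + 4) / 7).
  by split; [lra|apply: E => /=; lra|apply: H].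
- have [x0 y0 h0] := curve_piece3 s01; exists ((s + 6) / 7).
  by split; [lra|apply: E => /=; lra|apply: H].
Qed.

End curve.

(** * The Cantor square *)

Section cantor_square.
Variable R : realType.
Implicit Types (s t x y v : R) (z a b : R[i]).

Fixpoint cantor n x : Prop :=
  if n is m.+1 then cantor m (3 * x - 2) \/ cantor m (3 * x + 2) else -1 <= x <= 1.

Definition cantor_square : set R[i] :=
  [set z | forall n, cantor n (Re z) /\ cantor n (Im z)].

Lemma cantor_bound n x : cantor n x -> -1 <= x <= 1.
Proof. by elim: n x => [|n IH] x //= [] /IH; lra. Qed.

Lemma cantor_square_bounded : exists B : R, forall z, cantor_square z -> modulus z <= B.
Proof.
exists 2 => z /(_ 0%N)[] /= h1 h2; apply: (le_trans (modulus_le_ReIm z)).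
have : `|Re z| <= 1 by rewrite ler_norml.
have : `|Im z| <= 1 by rewrite ler_norml.
lra.
Qed.

Lemma cantor_gap n x : ~ cantor n x ->
  exists2 d, 0 < d & forall x', cantor n x' -> d <= `|x - x'|.
Proof.
elim: n x => [|n IH] x /=.
  have [x1 _|x1] := ltrP x (-1).
    by exists (-1 - x) => [|x' x'1]; [lra|rewrite distrC ger0_norm; lra].
  have [x2 _|x2] := ltrP 1 x.
    by exists (x - 1) => [|x' x'1]; [lra|rewrite ger0_norm; lra].
  by move=> [].
move=> /not_orP[/IH[d1 d10 h1] /IH[d2 d20 h2]].
exists (Num.min d1 d2 / 3) => [|x' [/h1|/h2]].
- by rewrite divr_gt0// lt_min d10.
- rewrite (_ : 3 * x - 2 - (3 * x' - 2) = 3 * (x - x')); last by lra.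
  rewrite normrM ger0_norm// => h; rewrite ler_pdivrMr// mulrC.
  by apply: le_trans h; rewrite ge_min lexx.
- rewrite (_ : 3 * x + 2 - (3 * x' + 2) = 3 * (x - x')); last by lra.
  rewrite normrM ger0_norm// => h; rewrite ler_pdivrMr// mulrC.
  by apply: le_trans h; rewrite ge_min lexx orbT.
Qed.

(** The intervals of level n have length 2 * 3 ^- n and so have, at least, the gaps between
   them.  The bound on c keeps the induction going. *)
Lemma cantor_isolated n x : cantor n x -> exists c,
  [/\ `|c| <= 1 - (1 / 3) ^+ n, `|x - c| <= (1 / 3) ^+ n &
      forall x', cantor n x' ->
        `|x' - c| <= (1 / 3) ^+ n \/ 3 * (1 / 3) ^+ n <= `|x' - c|].
Proof.
elim: n x => [|n IH] x /=.
  move=> x1; exists 0; rewrite expr0 normr0 subr0 subrr; split=> //.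
    by rewrite ler_norml.
  by move=> x' x'1; left; rewrite subr0 ler_norml.
have e0 : 0 <= (1 / 3 : R) ^+ n by rewrite exprn_ge0//; lra.
have e1 : (1 / 3 : R) ^+ n <= 1 by rewrite exprn_ile1//; lra.
have scale (k : R) x' c : `|3 * x' + k - c| = 3 * `|x' - (c - k) / 3|.
  have -> : 3 * x' + k - c = 3 * (x' - (c - k) / 3) by lra.
  by rewrite normrM (@ger0_norm _ 3).
have scale' (k : R) x' c : `|3 * x' - k - c| = 3 * `|x' - (c + k) / 3|.
  have -> : 3 * x' - k - c = 3 * (x' - (c + k) / 3) by lra.
  by rewrite normrM (@ger0_norm _ 3).
move=> [/IH|/IH] [c [c1 xc H]]; rewrite ler_norml in c1.
- exists ((c + 2) / 3); rewrite exprS; rewrite scale' in xc; split.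
  + by rewrite ler_norml; lra.
  + lra.
  + move=> x' [/H|/cantor_bound x'1]; first by rewrite scale' => -[]; [left|right]; lra.
    by right; rewrite distrC ger0_norm; lra.
- exists ((c - 2) / 3); rewrite exprS; rewrite scale in xc; split.
  + by rewrite ler_norml; lra.
  + lra.
  + move=> x' [/cantor_bound x'1|/H]; last by rewrite scale => -[]; [left|right]; lra.
    by right; rewrite ger0_norm; lra.
Qed.

Lemma cantor_near_centre n z : cantor n (Re z) -> cantor n (Im z) ->
  exists2 a, a \in centres R n & supnorm (z - a) <= (1 / 3) ^+ n.
Proof.
elim: n z => [|n IH] z /=.
  move=> x1 y1; exists 0; first by rewrite inE.
  by rewrite subr0 expr0 /supnorm ge_max !ler_norml x1 y1.
have zoom b : b \in corners R -> cantor n (Re (3%:C * (z - b))) ->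
    cantor n (Im (3%:C * (z - b))) ->
    exists2 a, a \in centres R n.+1 & supnorm (z - a) <= (1 / 3) ^+ n.+1.
  move=> hb h1 h2; have [a ha az] := IH _ h1 h2.
  exists (b + (1 / 3)%:C * a); first by apply/centresSP; exists b, a.
  have -> : z - (b + (1 / 3)%:C * a) = (1 / 3)%:C * (3%:C * (z - b) - a).
    have t3 : (1 / 3 : R)%:C * 3%:C = 1.
      by rewrite -rmorphM (_ : 1 / 3 * 3 = 1) ?rmorph1//; lra.
    by rewrite mulrBr mulrA t3 mul1r; ring.
  by rewrite supnormZ ?exprS; lra.
have Re3 b : Re (3%:C * (z - b)) = 3 * Re z - 3 * Re b by rewrite ReZ raddfB /=; lra.
have Im3 b : Im (3%:C * (z - b)) = 3 * Im z - 3 * Im b by rewrite ImZ raddfB /=; lra.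
have e1 (w : R) : 3 * w - 2 = 3 * w - 3 * (2 / 3) by lra.
have e2 (w : R) : 3 * w + 2 = 3 * w - 3 * - (2 / 3) by lra.
move=> [] hx [] hy; [apply: (zoom (cmk (2 / 3) (2 / 3)))
  |apply: (zoom (cmk (2 / 3) (- (2 / 3))))|apply: (zoom (cmk (- (2 / 3)) (2 / 3)))
  |apply: (zoom (cmk (- (2 / 3)) (- (2 / 3))))];
  by rewrite ?inE ?eqxx ?orbT// ?Re3 ?Im3 /= -?e1 -?e2.
Qed.

Lemma curve_cantor t n : 0 <= t <= 1 -> curve_h t = 0 ->
  cantor n (curve_x t) /\ cantor n (curve_y t).
Proof.
elim: n t => [|n IH] t t01 h0; first by split; [exact: curve_x_bound|exact: curve_y_bound].
have e1 x : 3 * (x / 3 - 2 / 3) + 2 = x by lra.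
have e2 x : 3 * (x / 3 + 2 / 3) - 2 = x by lra.
case: (curve_partP t01) => s s01 _ -> -> hs /=; rewrite ?e1 ?e2.
1,3,5,7: have [] : cantor n (curve_x s) /\ cantor n (curve_y s) by apply: IH => //; lra.
1,2,3,4: by auto.
all: by have := tent_gt0 s01; lra.
Qed.

(** The curve passes arbitrarily close to z at arbitrarily small heights, so the sum of the
   distance to z and the height has minimum 0. *)
Lemma curve_onto_cantor z : cantor_square z ->
  exists t, [/\ 0 <= t <= 1, curve_z t = z & curve_h t = 0].
Proof.
move=> zE; pose f t := `|curve_x t - Re z| + `|curve_y t - Im z| + curve_h t.
have cst (c : R) : ucont (@distR R) (@distR R) (fun=> c).
  by apply: ucont_cst; exact: distRR.
have abs (u : R -> R) : ucont (@distR R) (@distR R) u ->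
    ucont (@distR R) (@distR R) (fun t => `|u t|).
  move=> Hu e /Hu[d d0 hd]; exists d => // s t /hd.
  by apply: le_lt_trans; exact: ler_dist_dist.
have [[t t01 Ht] _] : (exists2 c, 0 <= c <= 1 & forall t, 0 <= t <= 1 -> f c <= f t) /\
  (exists2 c, 0 <= c <= 1 & forall t, 0 <= t <= 1 -> f t <= f c).
  apply: ucont_extrema; apply: ucontD; last exact: curve_h_ucont.
  apply: ucontD; apply: abs; apply: ucontD => //.
  - exact: curve_x_ucont.
  - exact: curve_y_ucont.
have h0 : 0 <= curve_h t by have := curve_h_bound t01; lra.
have f0 : f t <= 0.
  apply/ler_addgt0Pl => e e0; rewrite addr0.
  have [n Hn] : exists n, (1 / 3 : R) ^+ n < e / 5 by apply: exp_lt_eps; lra.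
  have [zx zy] := zE n; have [a ha az] := cantor_near_centre zx zy.
  have [s [s01 sa sh]] := curve_near_centre ha.
  have := supnorm_triangle (curve_z s) a z; rewrite -(supnormN (a - z)) opprB => h.
  have : `|curve_x s - Re z| <= supnorm (curve_z s - z).
    by rewrite /supnorm raddfB le_max lexx.
  have : `|curve_y s - Im z| <= supnorm (curve_z s - z).
    by rewrite /supnorm !raddfB le_max lexx orbT.
  by have := Ht s s01; rewrite /f; lra.
have hx := normr_ge0 (curve_x t - Re z); have hy := normr_ge0 (curve_y t - Im z).
rewrite /f in f0; exists t; split=> //; last by lra.
have hx0 : curve_x t - Re z = 0 by apply/eqP; rewrite -normr_le0; lra.
have hy0 : curve_y t - Im z = 0 by apply/eqP; rewrite -normr_le0; lra.
by apply/eqP; rewrite eq_complex /=; apply/andP; split; apply/eqP; lra.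
Qed.

Lemma tent_eq s v : tent s = v -> s = v / 2 \/ s = 1 - v / 2.
Proof.
rewrite /tent; have [h|h] := lerP (2 * s - 1) 0.
  by rewrite ler0_norm//; left; lra.
by rewrite gtr0_norm//; right; lra.
Qed.

(** Above height 3 ^- n there are only the tents over the segments of the first n levels,
   each of which takes a given value at most twice. *)
Lemma curve_h_fibre v : 0 < v ->
  exists s : seq R, forall t, 0 <= t <= 1 -> curve_h t = v -> t \in s.
Proof.
have H n : forall v, (1 / 3) ^+ n < v ->
    exists s : seq R, forall t, 0 <= t <= 1 -> curve_h t = v -> t \in s.
  elim: n => [|n IH] {}v.
    by rewrite expr0 => v1; exists [::] => t /curve_h_bound; lra.
  rewrite exprS => v1; have [s Hs] : exists s : seq R, forall t, 0 <= t <= 1 ->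
      curve_h t = 3 * v -> t \in s by apply: IH; lra.
  pose s1 := [seq (x + k) / 7 | x <- s, k <- [:: 0; 2; 4; 6]].
  pose s2 := [seq (x + k) / 7 | x <- [:: v / 2; 1 - v / 2], k <- [:: 1; 3; 5]].
  exists (s1 ++ s2) => t t01 tv; rewrite mem_cat; apply/orP.
  have piece x k : 0 <= x <= 1 -> k \in [:: 0; 2; 4; 6] -> t = (x + k) / 7 ->
      curve_h t = curve_h x / 3 -> t \in s1.
    move=> x01 hk tE hE; apply/allpairsP; exists (x, k); split=> //.
    by apply: Hs => //; lra.
  have gap x k : 0 < x < 1 -> k \in [:: 1; 3; 5] -> t = (x + k) / 7 ->
      curve_h t = tent x -> t \in s2.
    move=> x01 hk tE hE; apply/allpairsP; exists (x, k); split=> //=.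
    by rewrite !inE; apply/orP; case: (@tent_eq x v) => [|->|->]; [lra|left|right].
  case: (curve_partP t01) => x x01 tE _ _ hE.
  - by left; apply: (piece x 0) => //; rewrite ?inE ?eqxx// addr0.
  - by right; apply: (gap x 1) => //; rewrite ?inE ?eqxx.
  - by left; apply: (piece x 2) => //; rewrite ?inE ?eqxx ?orbT.
  - by right; apply: (gap x 3) => //; rewrite ?inE ?eqxx ?orbT.
  - by left; apply: (piece x 4) => //; rewrite ?inE ?eqxx ?orbT.
  - by right; apply: (gap x 5) => //; rewrite ?inE ?eqxx ?orbT.
  - by left; apply: (piece x 6) => //; rewrite ?inE ?eqxx ?orbT.
move=> v0; have [n Hn] : exists n, (1 / 3 : R) ^+ n < v by apply: exp_lt_eps; lra.
exact: H Hn.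
Qed.

End cantor_square.

(** * The curve with a segment put in front *)

Section extended_curve.
Variable R : realType.
Implicit Types (s t v : R).

(** On [-1, 0] the segment comes in from the left, to the corner where the curve starts.
   The height is positive on it, so that only the Cantor square has height 0. *)
Definition ext_z t : R[i] :=
  (curve_x (clamp t) - 60 * clamp (- t)) +i* curve_y (clamp t).
Definition ext_h t : R := curve_h (clamp t) + clamp (- t) / 10.

Lemma curve_start : [/\ curve_x (0 : R) = -1, curve_y (0 : R) = -1 & curve_h (0 : R) = 0].
Proof.
split.
- exact: (fixed0 (mulr0 _) (mulr0 _) (mulr0 _) (@curve_xE R)).
- exact: (fixed0 (mulr0 _) (mulr0 _) (mulr0 _) (@curve_yE R)).
- exact: (fixed0 (tent0 R) (tent0 R) (tent0 R) (@curve_hE R)).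
Qed.

Lemma ext_pos t : 0 <= t <= 1 -> ext_z t = curve_z t /\ ext_h t = curve_h t.
Proof.
move=> t01; rewrite /ext_z /ext_h (clampE t01) (@clamp0 _ (- t)); last by lra.
by rewrite mulr0 subr0 mul0r addr0.
Qed.

Lemma ext_neg t : -1 <= t <= 0 -> ext_z t = (-1 + 60 * t) +i* -1 /\ ext_h t = - t / 10.
Proof.
move=> t01; rewrite /ext_z /ext_h clamp0; last by lra.
have [-> -> ->] := curve_start; rewrite clampE; last by lra.
by rewrite add0r mulrN opprK.
Qed.

Lemma ext_inj t t' : -1 <= t <= 1 -> -1 <= t' <= 1 -> ext_z t = ext_z t' -> t = t'.
Proof.
wlog tt' : t t' / t <= t' => [W|] t1 t'1 E.
  by case: (lerP t t') => h; [exact: W|symmetry; exact: W (ltW h) _ _ (esym E)].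
case: (lerP 0 t) => t0.
  have h : 0 <= t <= 1 by lra. have h' : 0 <= t' <= 1 by lra.
  by move: E; rewrite (ext_pos h).1 (ext_pos h').1 => -[]; exact: curve_inj.
have h : -1 <= t <= 0 by lra.
move: E; rewrite (ext_neg h).1; case: (lerP t' 0) => t'0.
  have h' : -1 <= t' <= 0 by lra.
  by rewrite (ext_neg h').1 => -[]; lra.
have h' : 0 <= t' <= 1 by lra.
by rewrite (ext_pos h').1 => -[]; have := curve_x_bound h'; lra.
Qed.

Lemma ext_h_bound t : -1 <= t <= 1 -> 0 <= ext_h t <= 1.
Proof.
move=> t1; case: (lerP 0 t) => t0.
  by have h : 0 <= t <= 1; [lra|rewrite (ext_pos h).2; exact: curve_h_bound].
by have h : -1 <= t <= 0; [lra|rewrite (ext_neg h).2; lra].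
Qed.

Lemma ext_h_zero t : -1 <= t <= 1 -> ext_h t = 0 -> cantor_square (ext_z t).
Proof.
move=> t1; case: (lerP 0 t) => t0.
  have h : 0 <= t <= 1 by lra.
  by rewrite (ext_pos h).2 (ext_pos h).1 => h0 n; exact: curve_cantor.
by have h : -1 <= t <= 0; [lra|rewrite (ext_neg h).2; lra].
Qed.

Lemma ext_onto_cantor z : cantor_square z ->
  exists t, [/\ 0 <= t <= 1, ext_z t = z & ext_h t = 0].
Proof.
move=> /curve_onto_cantor[t [t01 tz th]]; exists t.
by rewrite (ext_pos t01).1 (ext_pos t01).2.
Qed.

Lemma ext_h_fibre v : 0 < v ->
  exists s : seq R, forall t, -1 <= t <= 1 -> ext_h t = v -> t \in s.
Proof.
move=> /curve_h_fibre[s Hs]; exists (- (10 * v) :: s) => t t1.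
rewrite inE; case: (lerP 0 t) => t0.
  by have h : 0 <= t <= 1; [lra|rewrite (ext_pos h).2 => /(Hs t h) ->; rewrite orbT].
have h : -1 <= t <= 0 by lra.
by rewrite (ext_neg h).2 => hv; apply/orP; left; apply/eqP; lra.
Qed.

Lemma ext_ucont : ucont (@distR R) (@distC R) ext_z /\ ucont (@distR R) (@distR R) ext_h.
Proof.
have cl : ucont (@distR R) (@distR R) (@clamp R).
  apply: (@lipschitz_ucont _ _ _ _ _ _ 1) => // s t; rewrite mul1r.
  exact: clamp_lipschitz.
have cl' (k : R) : 0 < k -> ucont (@distR R) (@distR R) (fun t => k * clamp (- t)).
  move=> k0; apply: (@lipschitz_ucont _ _ _ _ _ _ k) => // s t.
  rewrite /distR -mulrBr normrM (gtr0_norm k0) ler_wpM2l ?(ltW k0)//.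
  apply: (le_trans (clamp_lipschitz _ _)).
  by rewrite -opprD normrN.
split.
  have cx : ucont (@distR R) (@distR R) (fun t => curve_x (clamp t) - 60 * clamp (- t)).
    apply: ucontD; first exact: ucont_comp cl (@curve_x_ucont R).
    by apply: ucontN; exact: cl'.
  have cy : ucont (@distR R) (@distR R) (fun t => curve_y (clamp t)).
    exact: ucont_comp cl (@curve_y_ucont R).
  move=> e e0; have e2 : 0 < e / 2 by lra.
  have [c c0 hc] := cx _ e2; have [d d0 hd] := cy _ e2.
  exists (Num.min c d) => [|s t]; first by rewrite lt_min c0.
  rewrite lt_min => /andP[/hc h1 /hd h2]; apply: (le_lt_trans (modulus_le_ReIm _)).
  by rewrite /ext_z /=; rewrite /distR in h1 h2; lra.
apply: ucontD; first exact: ucont_comp cl (@curve_h_ucont R).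
rewrite (_ : (fun t => _) = (fun t => 10^-1 * clamp (- t))); last first.
  by apply/funext => t; rewrite mulrC.
by apply: cl'.
Qed.

Lemma ext_z_bound t : modulus (ext_z t) <= 64.
Proof.
apply: (le_trans (modulus_le_ReIm _)) => /=.
have /andP[h1 h2] := clamp_itv (- t).
have := curve_x_bound (clamp_itv t); have := curve_y_bound (clamp_itv t) => hy hx.
have : `|curve_y (clamp t)| <= 1 by rewrite ler_norml.
have : `|curve_x (clamp t) - 60 * clamp (- t)| <= 61 by rewrite ler_norml; lra.
by lra.
Qed.

End extended_curve.

(** * Polynomial approximation on the Cantor square *)

Section runge_cantor_square.
Variable R : realType.
Implicit Types (z a b : R[i]).

(** A point off the Cantor square has a coordinate off the Cantor set, at positive distance
   from it; along the vertical or horizontal line the pole is pushed to infinity. *)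
Lemma cantor_square_inv_poly (D : {poly R[i]}) :
  (forall z, cantor_square z -> D.[z] != 0) ->
  unif_poly_limit (@cantor_square R) (fun z => D.[z]^-1).
Proof.
apply: (upl_inv_poly (@cantor_square_bounded R)) => b /existsNP[n].
have ray := @upl_inv_ray _ _ (@cantor_square_bounded R) b.
move=> /not_andP[/cantor_gap[d d0 H]|/cantor_gap[d d0 H]].
- apply: (ray (cmk 0 1) d) => // [|t z t0 zE].
    by rewrite /modulus /= expr0n /= add0r expr1n sqrtr1.
  have := Re_le_modulus (z - (b + t%:C * cmk 0 1)).
  apply: le_trans; have := H _ (zE n).1; rewrite distrC.
  by have -> : Re (z - (b + t%:C * cmk 0 1)) = Re z - Re b by
    case: (z) (b) => [x y] [x' y'] /=; ring.
- apply: (ray 1 d) => // [|t z t0 zE]; first exact: modulus1.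
  have := Im_le_modulus (z - (b + t%:C * 1)).
  apply: le_trans; have := H _ (zE n).2; rewrite distrC.
  by have -> : Im (z - (b + t%:C * 1)) = Im z - Im b by
    case: (z) (b) => [x y] [x' y'] /=; ring.
Qed.

(** Take p = 1 - (z - z0) q, where q approximates 1 / (z - z0). *)
Lemma separate_from_cantor_square z0 : ~ cantor_square z0 ->
  exists2 p : {poly R[i]}, p.[z0] = 1 &
    forall z, cantor_square z -> modulus p.[z] <= 1 / 2.
Proof.
move=> z0E; have [B HB] := @cantor_square_bounded R.
have D0 z : cantor_square z -> ('X - z0%:P).[z] != 0.
  by move=> zE; rewrite hornerXsubC subr_eq0; apply/eqP => zz0; apply: z0E; rewrite -zz0.
have B0 : 0 < `|B| + modulus z0 + 1.
  by have := normr_ge0 B; have := modulus_ge0 z0; lra.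
have e0 : 0 < 1 / 2 / (`|B| + modulus z0 + 1) by rewrite divr_gt0//; lra.
have [p Hp] := cantor_square_inv_poly D0 e0.
exists (1 - ('X - z0%:P) * p) => [|z zE].
  by rewrite !hornerE subrr mul0r subr0.
have := Hp z zE; rewrite ler_pdivlMr// => h.
have zz0 := D0 z zE; rewrite hornerXsubC in zz0 h.
have -> : (1 - ('X - z0%:P) * p).[z] = - ((p.[z] - (z - z0)^-1) * (z - z0)).
  by rewrite !hornerE; field.
rewrite modulusN modulusM; apply: le_trans h; rewrite ler_wpM2l ?modulus_ge0//.
have := modulusD z (- z0); rewrite modulusN; have := HB z zE; have := ler_norm B; lra.
Qed.

(** The rational function 1 / (1 + ((z - a) / (2 s))^(2 M)), with a and s the centre and
   the half side of the square of level n containing z0, is for large M close to 1 on this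
   square and close to 0 on the others: they lie on different sides of the circle of
   radius 2 s, as half the diagonal of the square is sqrt 2 s and the others are 3 s away from a. *)
Lemma cantor_square_peak n z0 (e : R) : cantor_square z0 -> 0 < e ->
  exists2 p : {poly R[i]}, 1 / 2 <= modulus p.[z0] &
    forall z, cantor_square z -> modulus p.[z] <= 3 /\
      (supnorm (z - z0) <= 2 * (1 / 3) ^+ n \/ modulus p.[z] <= e).
Proof.
move=> z0E e_gt0; have [zx zy] := z0E n; set s := (1 / 3) ^+ n.
have s0 : 0 < s by rewrite exprn_gt0//; lra.
have [cx [_ xc Hx]] := cantor_isolated zx; have [cy [_ yc Hy]] := cantor_isolated zy.
rewrite -/s in xc yc Hx Hy; pose a := cmk cx cy.
have sC : s%:C != 0 :> R[i] by rewrite -modulus_gt0 modulus_real gtr0_norm.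
have [M HM] : exists M, (1 / 2 : R) ^+ M < Num.min (1 / 2) (e / 4).
  by apply: exp_lt_eps; rewrite ?lt_min; lra.
rewrite lt_min in HM; move: HM => /andP[HM1 HM2].
pose y z := (z - a) ^+ 2 / ((4 * s ^+ 2)%:C).
have msq z : modulus (y z) = ((Re z - cx) ^+ 2 + (Im z - cy) ^+ 2) / (4 * s ^+ 2).
  rewrite modulusM modulusX modulus_sqr modulusV modulus_real !raddfB /=.
  by rewrite ger0_norm// mulr_ge0// sqr_ge0.
have s4 : 0 < 4 * s ^+ 2 by rewrite mulr_gt0// exprn_gt0.
have sq (x : R) : `|x| <= s -> x ^+ 2 <= s ^+ 2.
  by move=> xs; rewrite -real_normK ?num_real// lerXn2r ?nnegrE// ltW.
have sq3 (x : R) : 3 * s <= `|x| -> (3 * s) ^+ 2 <= x ^+ 2.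
  by move=> xs; rewrite -[leRHS]real_normK ?num_real// lerXn2r ?nnegrE//; lra.
have near z : `|Re z - cx| <= s -> `|Im z - cy| <= s -> modulus (y z) <= 1 / 2.
  by move=> /sq h1 /sq h2; rewrite msq ler_pdivrMr//; lra.
have dich z : cantor_square z ->
    supnorm (z - z0) <= 2 * s /\ modulus (y z) <= 1 / 2 \/ 2 <= modulus (y z).
  move=> /(_ n)[/Hx hx /Hy hy].
  have far : 3 * s <= `|Re z - cx| \/ 3 * s <= `|Im z - cy| -> 2 <= modulus (y z).
    have h1 := sqr_ge0 (Re z - cx); have h2 := sqr_ge0 (Im z - cy).
    have h3 := sqr_ge0 s.
    by rewrite msq ler_pdivlMr// => -[] /sq3; rewrite exprMn; lra.
  case: hx => hx; last by right; apply: far; left.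
  case: hy => hy; last by right; apply: far; right.
  left; split; last exact: near.
  rewrite /supnorm ge_max !raddfB /=; apply/andP; split.
    by have := ler_distD cx (Re z) (Re z0); rewrite (distrC cx); lra.
  by have := ler_distD cy (Im z) (Im z0); rewrite (distrC cy); lra.
pose D : {poly R[i]} := 1 + (((4 * s ^+ 2)%:C)^-1 *: ('X - a%:P) ^+ 2) ^+ M.
have DE z : D.[z] = 1 + y z ^+ M by rewrite /D hornerD hornerC horner_exp hornerZ horner_exp hornerXsubC mulrC.
have pw0 : 0 <= (1 / 2 : R) ^+ M by rewrite exprn_ge0//; lra.
have Dnear z : modulus (y z) <= 1 / 2 -> 1 / 2 <= modulus D.[z] <= 3 / 2.
  move=> yz; have : modulus (y z ^+ M) <= (1 / 2) ^+ M.
    by rewrite modulusX lerXn2r ?nnegrE ?modulus_ge0//; lra.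
  have := modulus_ge 1 (y z ^+ M); have := modulusD 1 (y z ^+ M).
  by rewrite DE modulus1; lra.
have Dfar z : 2 <= modulus (y z) ->
    1 <= modulus D.[z] /\ (modulus D.[z])^-1 <= e / 2.
  move=> yz; have h2 : 2 ^+ M <= modulus (y z ^+ M).
    by rewrite modulusX lerXn2r ?nnegrE ?modulus_ge0//; lra.
  have h1 : 2 ^+ M * (1 / 2 : R) ^+ M = 1.
    by rewrite -exprMn (_ : 2 * (1 / 2) = 1) ?expr1n//; lra.
  have := modulus_ge (y z ^+ M) 1; rewrite modulus1 [_ + 1]addrC -DE => h3.
  have p2 : 2 < (2 : R) ^+ M by nra.
  have D0 : 1 <= modulus D.[z] by lra.
  split; first by [].
  rewrite -div1r ler_pdivrMr; last by lra.
  have : 1 <= e / 4 * 2 ^+ M by nra.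
  by nra.
have D0 z : cantor_square z -> D.[z] != 0.
  by rewrite -modulus_gt0 => /dich[[_ /Dnear]|/Dfar[]//]; lra.
have d0 : 0 < Num.min (1 / 6) (e / 2) by rewrite lt_min; apply/andP; split; lra.
have [p Hp] := cantor_square_inv_poly D0 d0; exists p => [|z zE].
  have := Hp z0 z0E; rewrite le_min => /andP[h _].
  have /andP[h1 h2] := Dnear z0 (near z0 xc yc).
  have : 2 / 3 <= modulus (D.[z0]^-1).
    by rewrite modulusV -[leRHS]div1r ler_pdivlMr; lra.
  have := modulus_ge (D.[z0]^-1) (p.[z0] - D.[z0]^-1).
  have -> : D.[z0]^-1 + (p.[z0] - D.[z0]^-1) = p.[z0] by ring.
  lra.
have := Hp z zE; rewrite le_min => /andP[h h'].
have := modulusD (p.[z] - D.[z]^-1) (D.[z]^-1); rewrite subrK modulusV.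
have [[zz /Dnear/andP[h1 _]]|/Dfar[h1 h2]] := dich z zE.
  have : (modulus D.[z])^-1 <= 2 by rewrite -div1r ler_pdivrMr; lra.
  by move=> *; split; [lra|left].
have : (modulus D.[z])^-1 <= 2.
  by rewrite -div1r ler_pdivrMr; lra.
by move=> *; split; [lra|right; lra].
Qed.

End runge_cantor_square.

(** * Polynomial functions on C^n *)

Section polynomial_functions.
Variables (R : realType) (n : nat).
Implicit Types (u v : Cspace R n) (f h : Cspace R n -> R[i]).

Definition polyfun f := exists p : mpoly.mpoly n R[i], forall v, f v = peval p v.

Lemma polyfun_cst c : polyfun (fun=> c).
Proof. by exists (mpoly.mpolyC n c) => v; rewrite /peval mpoly.mevalC. Qed.

Lemma polyfun_coord i : polyfun (fun v => coords v i).
Proof.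
by exists (mpoly.mpolyX R[i] (mpoly.mnm1 i)) => v; rewrite /peval mpoly.mevalXU.
Qed.

Lemma polyfunD f h : polyfun f -> polyfun h -> polyfun (fun v => f v + h v).
Proof.
by move=> [p Hp] [q Hq]; exists (p + q) => v; rewrite /peval mpoly.mevalD Hp Hq.
Qed.

Lemma polyfunM f h : polyfun f -> polyfun h -> polyfun (fun v => f v * h v).
Proof.
by move=> [p Hp] [q Hq]; exists (p * q) => v; rewrite /peval mpoly.mevalM Hp Hq.
Qed.

Lemma polyfunN f : polyfun f -> polyfun (fun v => - f v).
Proof. by move=> [p Hp]; exists (- p) => v; rewrite /peval mpoly.mevalN Hp. Qed.

Lemma polyfunB f h : polyfun f -> polyfun h -> polyfun (fun v => f v - h v).
Proof. by move=> Hf /polyfunN; exact: polyfunD. Qed.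

Lemma polyfunX f k : polyfun f -> polyfun (fun v => f v ^+ k).
Proof.
move=> Hf; elim: k => [|k IH]; first exact: polyfun_cst.
under eq_fun do rewrite exprS.
  exact: polyfunM.
Qed.

Lemma polyfun_horner (p : {poly R[i]}) f : polyfun f -> polyfun (fun v => p.[f v]).
Proof.
move=> Hf; elim/poly_ind: p => [|p c IH].
  under eq_fun do rewrite horner0.
  exact: polyfun_cst.
under eq_fun do rewrite hornerMXaddC.
by apply: polyfunD (polyfun_cst c); exact: polyfunM.
Qed.

(** Induction over the construction of polynomial functions, without reference to
   monomials. *)
Lemma peval_ind (P : (Cspace R n -> R[i]) -> Prop) :
  (forall c, P (fun=> c)) -> (forall i, P (fun v => coords v i)) ->
  (forall f h, P f -> P h -> P (fun v => f v + h v)) ->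
  (forall f h, P f -> P h -> P (fun v => f v * h v)) ->
  forall p, P (peval p).
Proof.
move=> Pc Px PD PM; elim/mpoly.mpolyind => [|c m p _ _ IH].
  rewrite (_ : peval _ = fun=> 0); first exact: Pc.
  by apply/funext => v; rewrite /peval mpoly.meval0.
rewrite (_ : peval _ = fun v => c * (\prod_(i < n) coords v i ^+ m i) + peval p v).
  apply: (PD) => //; apply: (PM) => //.
  elim: (index_enum _) => [|i s IHs].
    under eq_fun do rewrite big_nil.
  exact: Pc.
  under eq_fun do rewrite big_cons.
  apply: (PM) => //.
  elim: (m i) => [|k IHk]; first exact: Pc.
  under eq_fun do rewrite exprS.
  exact: PM.
by apply/funext => v; rewrite /peval mpoly.mevalD mpoly.mevalZ mpoly.mevalX.
Qed.

Lemma peval_lipschitz (p : mpoly.mpoly n R[i]) (M : R) : exists2 L, 0 < L &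
  forall u v d, 0 <= d -> (forall i, modulus (coords u i) <= M) ->
    (forall i, modulus (coords v i) <= M) ->
    (forall i, modulus (coords u i - coords v i) <= d) ->
    modulus (peval p u) <= L /\ modulus (peval p u - peval p v) <= L * d.
Proof.
pose P (F : Cspace R n -> R[i]) := exists2 L, 0 < L &
  forall u v d, 0 <= d -> (forall i, modulus (coords u i) <= M) ->
    (forall i, modulus (coords v i) <= M) ->
    (forall i, modulus (coords u i - coords v i) <= d) ->
    modulus (F u) <= L /\ modulus (F u - F v) <= L * d.
rewrite -/(P (peval p)); apply: (peval_ind (P := P)) => [c|i|f h|f h].
- exists (modulus c + 1) => [|u v d d0 _ _ _]; first by have := modulus_ge0 c; lra.
  rewrite subrr modulus0 mulr_ge0//; last by have := modulus_ge0 c; lra.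
  by split => //; lra.
- exists (`|M| + 1) => [|u v d d0 hu hv huv]; first by have := normr_ge0 M; lra.
  have := normr_ge0 M; have := ler_norm M; have := hu i; have := huv i.
  by move=> *; split; [lra|nra].
- move=> [L L0 HL] [K K0 HK]; exists (L + K) => [|u v d d0 hu hv huv]; first by lra.
  have [h1 h2] := HL u v d d0 hu hv huv; have [h3 h4] := HK u v d d0 hu hv huv.
  split; first by have := modulusD (f u) (h u); lra.
  rewrite (_ : _ - _ = (f u - f v) + (h u - h v)); last by ring.
  by have := modulusD (f u - f v) (h u - h v); lra.
- move=> [L L0 HL] [K K0 HK].
  have LK0 : 0 < L * K by exact: mulr_gt0.
  exists (2 * (L * K)) => [|u v d d0 hu hv huv]; first by lra.
  have huv' i : modulus (coords v i - coords u i) <= d by rewrite modulusB.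
  have [h1 h2] := HL u v d d0 hu hv huv; have [h3 h4] := HK u v d d0 hu hv huv.
  have [h5 _] := HL v u d d0 hv hu huv'.
  split.
    by rewrite modulusM; have := ler_pM (modulus_ge0 _) (modulus_ge0 _) h1 h3; lra.
  rewrite (_ : _ - _ = (f u - f v) * h u + f v * (h u - h v)); last by ring.
  rewrite (le_trans (modulusD _ _))// !modulusM.
  have := ler_pM (modulus_ge0 _) (modulus_ge0 _) h2 h3.
  by have := ler_pM (modulus_ge0 _) (modulus_ge0 _) h5 h4; lra.
Qed.

End polynomial_functions.

(** * Injective paths are homeomorphisms onto their image *)

Section parametrised_arcs.
Variables (R : realType) (n : nat).
Implicit Types (f : R -> Cspace R n).

Definition coord_ucont f := forall i, ucont (@distR R) (@distC R) (fun t => coords (f t) i).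

Lemma Cspace_nbhs (v : Cspace R n) (A : set (Cspace R n)) :
  nbhs v A <-> exists2 e : R, 0 < e &
    forall u, (forall i, modulus (coords u i - coords v i) < e) -> A u.
Proof.
split=> [/nbhs_ballP[e /= e0 H]|[e e0 H]].
  have [er eE] : e = (Re e)%:C /\ 0 < Re e.
    by move: e0; rewrite ltcE /= => /andP[/eqP h1 h2]; split=> //; case: (e) h1 => x y /= ->.
  exists (Re e) => // u hu; apply: H; split=> // i j; rewrite ord1.
  rewrite /ball /= er -[`|_|]/((modulus (_ : R[i]))%:C) ltcR.
  by rewrite modulusB; exact: hu.
apply/nbhs_ballP; exists e%:C; first by rewrite /= ltcR.
move=> u [_ hu]; apply: H => i; have := hu ord0 i.
rewrite /ball /= -[`|_|]/((modulus (_ : R[i]))%:C) ltcR => h.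
by rewrite modulusB; exact: h.
Qed.

Lemma coord_ucont_continuous f : coord_ucont f -> continuous f.
Proof.
move=> Hf t A /Cspace_nbhs[e e0 H].
have [d d0 hd] : exists2 d, 0 < d & forall s i, distR s t < d ->
    modulus (coords (f s) i - coords (f t) i) < e.
  have H1 (l : seq 'I_n) : exists2 d, 0 < d & forall s i, i \in l -> distR s t < d ->
    modulus (coords (f s) i - coords (f t) i) < e.
    elim: l => [|j l [d d0 hd]]; first by exists 1.
    have [c c0 hc] := Hf j e e0; exists (Num.min c d) => [|s i]; first by rewrite lt_min c0.
    rewrite inE lt_min => /orP[/eqP ->|il] /andP[h1 h2]; [exact: hc|exact: hd].
  by have [d d0 hd] := H1 (enum 'I_n); exists d => // s i; apply: hd; rewrite mem_enum.
apply/nbhs_ballP; exists d => // s hs; apply: H => i; apply: hd.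
by rewrite distR_sym.
Qed.

(** The inverse is continuous by compactness of the interval: the distance |t - s| vanishes
   where the distance of f s and f t does, hence is small where the latter is. *)
Lemma homeomorphism_of_injective f : coord_ucont f ->
  (forall s t, 0 <= s <= 1 -> 0 <= t <= 1 -> f s = f t -> s = t) ->
  homeomorphism_on (`[0, 1] : set R) (f @` `[0, 1]) f.
Proof.
move=> Hf inj; split.
- exact/continuous_subspaceT/coord_ucont_continuous.
- split; first by move=> t t01; exists t.
  + by move=> s t; rewrite !inE /= !in_itv /= => h1 h2; exact: inj.
  + by move=> v [t t01 <-]; exists t.
have [g gf] : exists g : Cspace R n -> R, forall t, 0 <= t <= 1 -> g (f t) = t.
  pose g v :=
    if pselect (exists t, 0 <= t <= 1 /\ f t = v) is left H then projT1 (cid H) else 0.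
  exists g => t t01; rewrite /g; case: pselect => [H|[]]; last by exists t.
  by case: cid => s /= [s01 E]; exact: inj.
exists g; last by move=> t; rewrite inE /= in_itv /=; exact: gf.
apply/subspace_continuousP => v [t]; rewrite /= in_itv /= => t01 <-.
rewrite /from_subspace gf//; apply/cvgrPdist_lt => e e0.
pose u s := \sum_(i < n) modulus (coords (f s) i - coords (f t) i).
have Hu : ucont (@distR R) (@distR R) u.
  rewrite /u; elim: (index_enum _) => [|i l IH].
    under eq_fun do rewrite big_nil.
  apply: ucont_cst; exact: distRR.
  under eq_fun do rewrite big_cons.
  apply: ucontD => // d /(Hf i)[c c0 hc].
  exists c => // x y /hc; apply: le_lt_trans.
  have h1 := modulus_triangle (coords (f x) i) (coords (f y) i) (coords (f t) i).
  have h2 := modulus_triangle (coords (f y) i) (coords (f x) i) (coords (f t) i).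
  rewrite (modulusB (coords (f y) i) (coords (f x) i)) in h2.
  by rewrite /distR /distC ler_norml; lra.
pose w s : R := `|t - s|.
have Hw : ucont (@distR R) (@distR R) w.
  apply: (@lipschitz_ucont _ _ _ _ _ _ 1) => // x y; rewrite mul1r /distR /w.
  by apply: (le_trans (ler_dist_dist _ _)); rewrite distrC (_ : _ - _ = x - y)//; lra.
have [s s01 us0|d d0 hd] := @small_near_zeros R u w 0 1 e ler01 Hu Hw.
  rewrite /w (_ : t = s) ?subrr ?normr0//; apply: inj => //.
  apply/rowP => i; apply/eqP; rewrite eq_sym -subr_eq0 -modulus_eq0; apply/eqP.
  have /psumr_eq0P : u s = 0.
    by apply/eqP; rewrite eq_le us0 sumr_ge0// => j _; exact: modulus_ge0.
  by move=> /(_ (fun j _ => modulus_ge0 _) i isT).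
have dn : 0 < d / n.+1%:R by rewrite divr_gt0.
apply/Cspace_nbhs; exists (d / n.+1%:R) => // v' hv' [s]; rewrite /= in_itv /= => s01 E.
rewrite -E gf//; apply: hd => //; rewrite -{}E in hv'.
have : u s <= \sum_(i < n) (d / n.+1%:R) by apply: ler_sum => i _; exact: ltW.
move=> /le_lt_trans; apply.
rewrite sumr_const card_ord -(mulr_natr (d / n.+1%:R) n) mulrAC ltr_pdivrMr// ltr_pM2l// ltr_nat//.
Qed.

End parametrised_arcs.

(** * Bounded uniformly continuous functions of a parameter *)

Section bounded_ucont.
Variable R : realType.
Implicit Types (u v : R -> R[i]).

Definition bucont u :=
  (exists M : R, forall t, modulus (u t) <= M) /\ ucont (@distR R) (@distC R) u.

Lemma bucont_cst c : bucont (fun=> c).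
Proof.
split; first by exists (modulus c).
by apply: ucont_cst => z; rewrite /distC subrr modulus0.
Qed.

Lemma bucontD u v : bucont u -> bucont v -> bucont (fun t => u t + v t).
Proof.
move=> [[M HM] Hu] [[K HK] Hv]; split.
  exists (M + K) => t; have := modulusD (u t) (v t); have := HM t; have := HK t; lra.
move=> e e0; have e2 : 0 < e / 2 by lra.
have [c c0 hc] := Hu _ e2; have [d d0 hd] := Hv _ e2.
exists (Num.min c d) => [|x y]; first by rewrite lt_min c0.
rewrite lt_min => /andP[/hc h1 /hd h2]; rewrite /distC in h1 h2 *.
rewrite (_ : _ - _ = (u x - u y) + (v x - v y)); last by ring.
by have := modulusD (u x - u y) (v x - v y); lra.
Qed.

Lemma bucontM u v : bucont u -> bucont v -> bucont (fun t => u t * v t).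
Proof.
move=> [[M HM] Hu] [[K HK] Hv].
have M0 : 0 <= M by rewrite (le_trans _ (HM 0))// modulus_ge0.
have K0 : 0 <= K by rewrite (le_trans _ (HK 0))// modulus_ge0.
split.
  by exists (M * K) => t; rewrite modulusM ler_pM ?modulus_ge0.
move=> e e0; have e1 : 0 < e / 2 / (K + 1) by rewrite !divr_gt0//; lra.
have e2 : 0 < e / 2 / (M + 1) by rewrite !divr_gt0//; lra.
have [c c0 hc] := Hu _ e1; have [d d0 hd] := Hv _ e2.
exists (Num.min c d) => [|x y]; first by rewrite lt_min c0.
rewrite lt_min => /andP[/hc h1 /hd h2]; rewrite /distC in h1 h2 *.
rewrite (_ : _ - _ = (u x - u y) * v x + u y * (v x - v y)); last by ring.
apply: (le_lt_trans (modulusD _ _)); rewrite !modulusM.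
rewrite ltr_pdivlMr in h1; last by lra.
rewrite ltr_pdivlMr in h2; last by lra.
have := ler_wpM2l (modulus_ge0 (u x - u y)) (HK x).
have := ler_wpM2r (modulus_ge0 (v x - v y)) (HM y).
have := modulus_ge0 (u x - u y); have := modulus_ge0 (v x - v y).
lra.
Qed.

Lemma bucont_modulus u : bucont u -> ucont (@distR R) (@distR R) (fun t => modulus (u t)).
Proof.
move=> [_ Hu] e /Hu[d d0 hd]; exists d => // x y /hd; rewrite /distC /distR => h.
have := modulusD (u x - u y) (u y); have := modulusD (u y - u x) (u x).
by rewrite !subrK (modulusB (u y)) ltr_norml; lra.
Qed.

End bounded_ucont.

(** * Polynomial convexity of the arc *)

Section the_arc.
Variable R : realType.
Implicit Types (z w c : R[i]) (t : R) (v : Cspace R 3).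

Definition mk3 (x y z : R[i]) : Cspace R 3 := \row_(i < 3) nth 0 [:: x; y; z] i.

Lemma coords_mk3 x y z (i : 'I_3) : coords (mk3 x y z) i = nth 0 [:: x; y; z] i.
Proof. by rewrite /coords mxE. Qed.

Definition i0 : 'I_3 := @Ordinal 3 0 isT.
Definition i1 : 'I_3 := @Ordinal 3 1 isT.
Definition i2 : 'I_3 := @Ordinal 3 2 isT.

Lemma forall_I3 (P : 'I_3 -> Prop) : P i0 -> P i1 -> P i2 -> forall i, P i.
Proof.
move=> P0 P1 P2 [[|[|[|k]]] hk] //.
- by rewrite (_ : Ordinal hk = i0)//; apply: val_inj.
- by rewrite (_ : Ordinal hk = i1)//; apply: val_inj.
- by rewrite (_ : Ordinal hk = i2)//; apply: val_inj.
Qed.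

(** A polynomial automorphism of C^3, designed for w close to a Cauchy transform: where
   |z| is about 60, and w about 1 / z, it takes values in the unit ball for small c.  But for
   |z| <= 3/2 and |c| <= 1 it never does, because w and 1 - z * w cannot be both small. *)
Definition shear z w c : Cspace R 3 :=
  mk3 ((1 / 200)%:C * z) (4%:C * w) (8%:C * (1 - z * w) + c).

Definition shear_z v : R[i] := 200%:C * coords v i0.
Definition shear_w v : R[i] := (1 / 4)%:C * coords v i1.
Definition shear_c v : R[i] := coords v i2 - 8%:C * (1 - shear_z v * shear_w v).

Lemma shear_zK z w c : shear_z (shear z w c) = z.
Proof.
rewrite /shear_z coords_mk3 /= mulrA -rmorphM.
by rewrite (_ : 200 * (1 / 200) = 1) ?rmorph1 ?mul1r//; lra.
Qed.

Lemma shear_wK z w c : shear_w (shear z w c) = w.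
Proof.
rewrite /shear_w coords_mk3 /= mulrA -rmorphM.
by rewrite (_ : 1 / 4 * 4 = 1) ?rmorph1 ?mul1r//; lra.
Qed.

Lemma shear_cK z w c : shear_c (shear z w c) = c.
Proof. by rewrite /shear_c shear_zK shear_wK coords_mk3 /= addrC addKr. Qed.

Lemma shearK v : shear (shear_z v) (shear_w v) (shear_c v) = v.
Proof.
apply/rowP => i; rewrite mxE; move: i; apply: forall_I3 => /=.
- rewrite /shear_z mulrA -rmorphM (_ : 1 / 200 * 200 = 1) ?rmorph1 ?mul1r//; lra.
- rewrite /shear_w mulrA -rmorphM (_ : 4 * (1 / 4) = 1) ?rmorph1 ?mul1r//; lra.
- by rewrite /shear_c addrC subrK.
Qed.

Lemma polyfun_shear_z : polyfun shear_z.
Proof. by apply: polyfunM; [exact: polyfun_cst|exact: polyfun_coord]. Qed.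

Lemma polyfun_shear_w : polyfun shear_w.
Proof. by apply: polyfunM; [exact: polyfun_cst|exact: polyfun_coord]. Qed.

Lemma polyfun_shear_c : polyfun shear_c.
Proof.
apply: polyfunB; first exact: polyfun_coord.
apply: polyfunM; first exact: polyfun_cst.
apply: polyfunB; first exact: polyfun_cst.
by apply: polyfunM; [exact: polyfun_shear_z|exact: polyfun_shear_w].
Qed.

Definition path t : Cspace R 3 :=
  shear (ext_z t) (limit_field (ext_z t)) (ext_h t)%:C.

Lemma path_coords_bucont i : bucont (fun t => coords (path t) i).
Proof.
have Bz : bucont (@ext_z R).
  by split; [exists 64; exact: ext_z_bound|exact: (ext_ucont R).1].
have Bw : bucont (fun t => limit_field (ext_z t)).
  have [M HM] := limit_field_bounded R.
  split; first by exists M => t; exact: HM.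
  exact: ucont_comp (ext_ucont R).1 (@limit_field_ucont R).
have Bh : bucont (fun t => (ext_h t)%:C : R[i]).
  split.
    exists 2 => t; rewrite modulus_real /ext_h.
    have := clamp_itv (- t); have := curve_h_bound (clamp_itv t).
    by rewrite ler_norml; lra.
  move=> e /((ext_ucont R).2)[d d0 hd]; exists d => // s t /hd.
  by rewrite /distC -rmorphB modulus_real.
move: i; apply: forall_I3; rewrite /path /shear;
  under eq_fun do rewrite coords_mk3 /=.
- exact: bucontM (bucont_cst _) Bz.
- exact: bucontM (bucont_cst _) Bw.
- apply: bucontD Bh; apply: bucontM (bucont_cst _) _.
  rewrite (_ : (fun t => _) = (fun t => 1 + (-1) * (ext_z t * limit_field (ext_z t)))).
    exact: bucontD (bucont_cst _) (bucontM (bucont_cst _) (bucontM Bz Bw)).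
  by apply/funext => t; ring.
Qed.

Lemma path_polyfun_bucont q : polyfun q -> bucont (fun t => q (path t)).
Proof.
move=> [p Hp]; rewrite (_ : (fun t => _) = (fun t => peval p (path t))); last first.
  by apply/funext => t; rewrite Hp.
apply: (peval_ind (P := fun F => bucont (fun t => F (path t)))).
- exact: bucont_cst.
- exact: path_coords_bucont.
- by move=> f h; exact: bucontD.
- by move=> f h; exact: bucontM.
Qed.

Lemma path_inj s t : -1 <= s <= 1 -> -1 <= t <= 1 -> path s = path t -> s = t.
Proof.
move=> s1 t1 /(congr1 shear_z); rewrite /path !shear_zK; exact: ext_inj.
Qed.

Section polynomial_convexity.
Variable a : R.
Hypothesis a_bnd : -1 <= a <= 0.

Let J : set (Cspace R 3) := path @` `[a, 1].

Lemma sub_polynomial_hull : J `<=` polynomial_hull J.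
Proof.
move=> v Jv p; apply: ub_le_sup; last by exists v.
have Hp : polyfun (peval p : Cspace R 3 -> R[i]) by exists p.
have [[M HM] _] := path_polyfun_bucont Hp; exists M => _ [_ [t _ <-] <-].
exact: HM.
Qed.

Section point_of_hull.
Variable v : Cspace R 3.
Hypothesis v_hull : polynomial_hull J v.

Lemma hull_le q (B : R) : polyfun q -> (forall t, a <= t <= 1 -> modulus (q (path t)) <= B) ->
  modulus (q v) <= B.
Proof.
move=> [p Hp] H; rewrite Hp; apply: (le_trans (v_hull p)); apply: ge_sup.
  exists (modulus (peval p (path 0))), (path 0) => //; exists 0 => //=.
  by rewrite in_itv /=; have := a_bnd; lra.
move=> _ [_ [t t1 <-] <-]; rewrite -Hp; apply: H.
by move: t1; rewrite /= in_itv.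
Qed.

(** Let c be the value of shear_c at v.  The polynomial 1 - ((x - Re c)^2 + (Im c)^2) / K
   equals 1 at x = c, while at the real values taken by shear_c on J it lies between 0 and
   1, and is bounded away from 1 where x is not close to c.  Its powers localise estimates
   near the fibre over c. *)
Lemma hull_le_near_fibre q (B d : R) : 0 <= B -> 0 < d -> polyfun q ->
  (forall t, a <= t <= 1 -> modulus ((ext_h t)%:C - shear_c v) < d ->
    modulus (q (path t)) <= B) ->
  modulus (q v) <= B.
Proof.
move=> B0 d0 Hq H; set c := shear_c v in H *.
have [[M HM] _] := path_polyfun_bucont Hq.
have M0 : 0 <= M by rewrite (le_trans _ (HM 0))// modulus_ge0.
pose x0 := Re c; pose y0 := Im c; pose K := 1 + (1 + `|x0|) ^+ 2 + y0 ^+ 2 + d ^+ 2.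
have K1 : 1 <= K.
  by rewrite /K; have := sqr_ge0 (1 + `|x0|); have := sqr_ge0 y0; have := sqr_ge0 d; lra.
pose k (x : R[i]) : R[i] := 1 - (K^-1)%:C * ((x - x0%:C) ^+ 2 + (y0 ^+ 2)%:C).
pose kr (x : R) := 1 - K^-1 * ((x - x0) ^+ 2 + y0 ^+ 2).
have kE x : k x%:C = (kr x)%:C.
  by rewrite /k /kr; ring.
have kc : k c = 1.
  rewrite /k; have -> : c - x0%:C = cmk 0 y0.
    by rewrite /x0 /y0; case: (c) => x y; apply/eqP; rewrite eq_complex /=;
      apply/andP; split; apply/eqP; ring.
  rewrite (_ : cmk 0 y0 ^+ 2 + (y0 ^+ 2)%:C = 0) ?mulr0 ?subr0//.
  by apply/eqP; rewrite eq_complex /=; apply/andP; split; apply/eqP; ring.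
have dist x : modulus (x%:C - c) ^+ 2 = (x - x0) ^+ 2 + y0 ^+ 2.
  by rewrite modulus_sqr /x0 /y0; case: (c) => x' y' /=; ring.
have K0 : 0 < K^-1 by rewrite invr_gt0; lra.
have kr01 t : a <= t <= 1 -> 0 <= kr (ext_h t) <= 1.
  move=> t1; have /ext_h_bound hb : -1 <= t <= 1 by have := a_bnd; lra.
  have hx : (ext_h t - x0) ^+ 2 <= (1 + `|x0|) ^+ 2.
    rewrite -real_normK ?num_real// lerXn2r ?nnegrE ?addr_ge0//.
    by apply: (le_trans (ler_normB _ _)); rewrite lerD2r ler_norml; lra.
  have h1 : (ext_h t - x0) ^+ 2 + y0 ^+ 2 <= K by rewrite /K; have := sqr_ge0 d; lra.
  have h2 := sqr_ge0 (ext_h t - x0); have h3 := sqr_ge0 y0.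
  have : K^-1 * ((ext_h t - x0) ^+ 2 + y0 ^+ 2) <= 1.
    by rewrite mulrC ler_pdivrMr; lra.
  have : 0 <= K^-1 * ((ext_h t - x0) ^+ 2 + y0 ^+ 2).
    by rewrite mulr_ge0//; lra.
  by rewrite /kr; lra.
pose r := 1 - K^-1 * d ^+ 2.
have r01 : 0 <= r < 1.
  have dK : K^-1 * d ^+ 2 <= 1.
    rewrite mulrC ler_pdivrMr; last by lra.
    by rewrite /K; have := sqr_ge0 (1 + `|x0|); have := sqr_ge0 y0; lra.
  have : 0 < K^-1 * d ^+ 2 by rewrite mulr_gt0// exprn_gt0.
  by rewrite /r; lra.
apply/ler_addgt0Pl => e e0; have [N HN] : exists N, r ^+ N < e / (M + 1).
  by apply: exp_lt_eps => //; rewrite divr_gt0//; lra.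
rewrite ltr_pdivlMr in HN; last by lra.
have rN : 0 <= r ^+ N by rewrite exprn_ge0//; case/andP: r01.
have -> : q v = q v * k (shear_c v) ^+ N by rewrite -/c kc expr1n mulr1.
apply: (@hull_le (fun u => q u * k (shear_c u) ^+ N)).
  apply: polyfunM => //; apply: polyfunX; apply: polyfunB; first exact: polyfun_cst.
  apply: polyfunM; first exact: polyfun_cst.
  apply: polyfunD; last exact: polyfun_cst.
  apply: polyfunX; apply: polyfunB; last exact: polyfun_cst.
  exact: polyfun_shear_c.
move=> t t1; rewrite {2}/path shear_cK kE modulusM modulusX modulus_real.
have /andP[k0 k1] := kr01 t t1; rewrite ger0_norm//.
have kN0 : 0 <= kr (ext_h t) ^+ N by rewrite exprn_ge0.
have kN1 : kr (ext_h t) ^+ N <= 1 by rewrite exprn_ile1.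
have [near|far] := ltrP (modulus ((ext_h t)%:C - c)) d.
  by have := ler_pM (modulus_ge0 _) kN0 (H t t1 near) kN1; lra.
have : kr (ext_h t) ^+ N <= r ^+ N.
  rewrite lerXn2r ?nnegrE//; first by case/andP: r01.
  rewrite /kr /r -dist lerD2l lerN2 ler_wpM2l ?(ltW K0)//.
  by rewrite lerXn2r ?nnegrE ?modulus_ge0// ltW.
move=> h; have := ler_pM (modulus_ge0 _) kN0 (HM t) h; lra.
Qed.

Lemma hull_le_fibre q (B : R) : 0 <= B -> polyfun q ->
  (forall t, a <= t <= 1 -> (ext_h t)%:C = shear_c v -> modulus (q (path t)) <= B) ->
  modulus (q v) <= B.
Proof.
move=> B0 Hq H; apply/ler_addgt0Pl => e e0.
have Hu : ucont (@distR R) (@distR R) (fun t => modulus ((ext_h t)%:C - shear_c v)).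
  apply: bucont_modulus.
  have := path_polyfun_bucont (polyfunB polyfun_shear_c (polyfun_cst 3 (shear_c v))).
  by rewrite (_ : (fun t => _ - _) = (fun t => (ext_h t)%:C - shear_c v))//;
    apply/funext => t; rewrite shear_cK.
have Hv := bucont_modulus (path_polyfun_bucont Hq).
have a1 : a <= 1 by have := a_bnd; lra.
have [t t1 ut|d d0 hd] := @small_near_zeros R _ _ a 1 (e + B) a1 Hu Hv.
  have tc : (ext_h t)%:C = shear_c v.
    by apply/eqP; rewrite -subr_eq0 -modulus_eq0 eq_le ut modulus_ge0.
  by have := H t t1 tc; lra.
by apply: (hull_le_near_fibre _ d0 Hq) => [|t t1 /(hd t t1)/ltW//]; lra.
Qed.

(** It is enough to separate v from the part of J in the fibre of shear_c through v.  If the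
   height is positive that part is finite.  If it is 0, that part lies in the graph of
   limit_field over the Cantor square, on which polynomials in the first coordinate
   separate any two points. *)
Lemma hull_sub : J v.
Proof.
apply: contrapT => vJ; have a01 := a_bnd.
have notJ t : a <= t <= 1 -> path t <> v.
  by move=> t1 E; apply: vJ; exists t => //=; rewrite in_itv.
have vanish (s : seq R) : exists2 q, polyfun q & q v != 0 /\
    forall t, t \in s -> a <= t <= 1 -> q (path t) = 0.
  elim: s => [|t s [q Hq [qv qs]]].
    by exists (fun=> 1); [exact: polyfun_cst|rewrite oner_eq0].
  case: (pselect (a <= t <= 1)) => t1; last first.
    by exists q => //; split=> // u; rewrite inE => /orP[/eqP -> //|]; exact: qs.
  have [i hi] : exists i, coords v i != coords (path t) i.
    apply: contrapT => /forallNP hi; apply: (notJ t t1); apply/rowP => i.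
    by apply/esym/eqP; have /negP := hi i; rewrite negbK.
  exists (fun u => (coords u i - coords (path t) i) * q u).
    apply: polyfunM => //; apply: polyfunB; [exact: polyfun_coord|exact: polyfun_cst].
  split; first by rewrite mulf_neq0// subr_eq0.
  move=> u; rewrite inE => /orP[/eqP -> _|us u1]; first by rewrite subrr mul0r.
  by rewrite (qs u us u1) mulr0.
have finite_fibre (s : seq R) :
    ~ forall t, a <= t <= 1 -> (ext_h t)%:C = shear_c v -> t \in s.
  move=> Hs; have [q Hq [qv qs]] := vanish s.
  have : modulus (q v) <= 0.
    apply: hull_le_fibre => // t t1 tc.
    by rewrite qs ?modulus0//; exact: Hs.
  by move: qv; rewrite -modulus_gt0; lra.
have [cv|cv] := eqVneq (shear_c v) 0; last first.
  have [cp|cp] := pselect (Im (shear_c v) = 0 /\ 0 < Re (shear_c v)); last first.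
    apply: (finite_fibre [::]) => t t1 E; exfalso; apply: cp.
    rewrite -E /=; split=> //; have /ext_h_bound : -1 <= t <= 1 by lra.
    rewrite le_eqVlt eq_sym => /andP[/orP[/eqP h0|//] _].
    by move: cv; rewrite -E h0 eqxx.
  have [s Hs] := ext_h_fibre cp.2; apply: (finite_fibre s) => t t1 E.
  by apply: Hs; [lra|rewrite -E].
have fibreE t : a <= t <= 1 -> (ext_h t)%:C = shear_c v -> cantor_square (ext_z t).
  move=> t1; rewrite cv => -[]; apply: ext_h_zero; lra.
have [zE|zE] := pselect (cantor_square (shear_z v)); last first.
  have [p p1 pE] := separate_from_cantor_square zE.
  have := @hull_le_fibre (fun u => p.[shear_z u]) (1 / 2).
  rewrite p1 modulus1 => h; suff : (1 : R) <= 1 / 2 by lra.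
  apply: h => [||t t1 tc]; first by lra.
    by apply: polyfun_horner; exact: polyfun_shear_z.
  by rewrite shear_zK; apply: pE; exact: fibreE.
have [t0 [t01 zt0 ht0]] := ext_onto_cantor zE.
set g := limit_field (shear_z v).
have [wg|wg] := eqVneq (shear_w v) g.
  apply: (notJ t0); first by lra.
  by rewrite -[RHS]shearK /path zt0 ht0 wg cv.
pose eta := modulus (shear_w v - g).
have eta0 : 0 < eta by rewrite modulus_gt0 subr_eq0.
have [G HG] := limit_field_bounded R.
have G0 : 0 <= G by rewrite (le_trans _ (HG 0))// modulus_ge0.
have [d d0 hd] := @limit_field_ucont R (eta / 12) (divr_gt0 eta0 (ltr0n _ 12)).
have [n Hn] : exists n, (1 / 3 : R) ^+ n < d / 4 by apply: exp_lt_eps; lra.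
have e0 : 0 < eta / 4 / (2 * G + 1) by rewrite !divr_gt0//; lra.
have [p p0 pE] := cantor_square_peak n zE e0.
have : modulus ((shear_w v - g) * p.[shear_z v]) <= eta / 4.
  apply: (@hull_le_fibre (fun u => (shear_w u - g) * p.[shear_z u])); first by lra.
    apply: polyfunM; last by apply: polyfun_horner; exact: polyfun_shear_z.
    by apply: polyfunB; [exact: polyfun_shear_w|exact: polyfun_cst].
  move=> t t1 tc; rewrite /path shear_wK shear_zK modulusM.
  have [p3 [zn|pe]] := pE _ (fibreE t t1 tc).
    have : distC (ext_z t) (shear_z v) < d.
      by rewrite /distC; have := modulus_le_supnorm (ext_z t - shear_z v); lra.
    move=> /hd; rewrite /distC -/g => h.
    by have := ler_pM (modulus_ge0 _) (modulus_ge0 _) (ltW h) p3; lra.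
  have gg : modulus (limit_field (ext_z t) - g) <= 2 * G + 1.
    have := modulusD (limit_field (ext_z t)) (- g); rewrite modulusN.
    by have := HG (ext_z t); have := HG (shear_z v); rewrite -/g; lra.
  rewrite mulrC; apply: (le_trans (ler_pM (modulus_ge0 _) (modulus_ge0 _) pe gg)).
  by rewrite divfK//; apply/eqP; lra.
rewrite modulusM -/eta; have := ler_wpM2l (ltW eta0) p0; lra.
Qed.

End point_of_hull.

Lemma arc_polynomially_convex : polynomially_convex J.
Proof.
apply/seteqP; split=> v; [exact: hull_sub|exact: sub_polynomial_hull].
Qed.

End polynomial_convexity.

End the_arc.

(** * The unit ball *)

Section ball.
Variable R : realType.
Implicit Types (v : Cspace R 3).

Definition sumsq v : R := \sum_(i < 3) modulus (coords v i) ^+ 2.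

Lemma sumsqE v : sumsq v =
  modulus (coords v i0) ^+ 2 + modulus (coords v i1) ^+ 2 + modulus (coords v i2) ^+ 2.
Proof.
rewrite /sumsq !big_ord_recl big_ord0 addr0 addrA.
by congr (_ + _ + _); congr (modulus (coords v _) ^+ 2); apply: val_inj.
Qed.

Lemma sumsq_mk3 (x y z : R[i]) :
  sumsq (mk3 x y z) = modulus x ^+ 2 + modulus y ^+ 2 + modulus z ^+ 2.
Proof. by rewrite sumsqE !coords_mk3. Qed.

Lemma ball_coords v : closed_unit_ball v -> forall i, modulus (coords v i) <= 1.
Proof.
rewrite /closed_unit_ball /mkset -/(sumsq v) sumsqE => h i.
have := sqr_ge0 (modulus (coords v i0)); have := sqr_ge0 (modulus (coords v i1)).
have := sqr_ge0 (modulus (coords v i2)) => h2 h1 h0.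
rewrite -(ler_pXn2r (n := 2)) ?nnegrE ?modulus_ge0// expr1n.
by move: i; apply: forall_I3; lra.
Qed.

(** By compactness of the ball, which is obtained from that of a cube in R^6. *)
Lemma ball_polyfun_pos (q : Cspace R 3 -> R[i]) : polyfun q ->
  (forall v, closed_unit_ball v -> q v != 0) ->
  exists2 d : R, 0 < d & forall v, closed_unit_ball v -> d <= modulus (q v).
Proof.
move=> [p Hp] q0.
pose cx (x : 'rV[R]_6) : Cspace R 3 := mk3
  (x ord0 (inord 0) +i* x ord0 (inord 1)) (x ord0 (inord 2) +i* x ord0 (inord 3))
  (x ord0 (inord 4) +i* x ord0 (inord 5)).
pose P (F : Cspace R 3 -> R[i]) :=
  continuous (fun x => Re (F (cx x))) /\ continuous (fun x => Im (F (cx x))).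
have Pp : P (peval p).
  apply: peval_ind => [c|i|f h [f1 f2] [h1 h2]|f h [f1 f2] [h1 h2]].
  - by split => x; exact: cst_continuous.
  - by split; move: i; apply: forall_I3; rewrite /cx;
      (under eq_fun do rewrite coords_mk3 /=); exact: coord_continuous.
  - split => x; under eq_fun do rewrite raddfD /=.
      exact: cvgD (f1 x) (h1 x).
    exact: cvgD (f2 x) (h2 x).
  - have ReM (a b : R[i]) : Re (a * b) = Re a * Re b - Im a * Im b by case: a b => ? ? [].
    have ImM (a b : R[i]) : Im (a * b) = Re a * Im b + Im a * Re b by case: a b => ? ? [].
    split => x.
      under eq_fun do rewrite ReM.
      exact: cvgB (cvgM (f1 x) (h1 x)) (cvgM (f2 x) (h2 x)).
    under eq_fun do rewrite ImM.
    exact: cvgD (cvgM (f1 x) (h2 x)) (cvgM (f2 x) (h1 x)).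
pose N (x : 'rV[R]_6) : R := \sum_(i < 6) x ord0 i ^+ 2.
have NE x : sumsq (cx x) = N x.
  rewrite sumsqE /cx !coords_mk3 !modulus_sqr /= /N !big_ord_recl big_ord0 addr0 !addrA.
  by congr (_ + _ + _ + _ + _ + _); congr (x ord0 _ ^+ 2); apply: val_inj;
    rewrite /= inordK.
have Nc : continuous N.
  move=> x; rewrite /N; elim: (index_enum _) => [|i s IH].
    (under eq_fun do rewrite big_nil); exact: cst_continuous.
  under eq_fun do rewrite big_cons expr2.
  have Ci : continuous_at x (fun x : 'rV[R]_6 => x ord0 i) by exact: coord_continuous.
  exact: cvgD (cvgM Ci Ci) IH.
(* Positive everywhere, and equal to |q|^2 where N <= 1. *)
pose h x := Re (peval p (cx x)) * Re (peval p (cx x)) +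
  Im (peval p (cx x)) * Im (peval p (cx x)) + (`|N x - 1| + (N x - 1)).
have hE x : h x = modulus (peval p (cx x)) ^+ 2 + (`|N x - 1| + (N x - 1)).
  by rewrite modulus_sqr !expr2.
have hc : continuous h.
  move=> x; have N1 : continuous_at x (fun x => N x - 1).
    exact: cvgB (Nc x) (@cst_continuous _ _ (1 : R) x).
  have N2 : continuous_at x (fun x => `|N x - 1|) by exact: cvg_norm N1.
  have N3 : continuous_at x (fun x => `|N x - 1| + (N x - 1)) by exact: cvgD N2 N1.
  have r := Pp.1 x; have i := Pp.2 x.
  exact: cvgD (cvgD (cvgM r r) (cvgM i i)) N3.
pose A : set 'rV[R]_6 := [set x | forall i, `[(-1 : R), 1]%classic (x ord0 i)].
have Ac : compact A := rV_compact (fun=> @segment_compact R (-1) 1).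
have A0 : A !=set0.
  by exists 0 => i /=; rewrite mxE in_itv /=; lra.
have [c cA Hc] := compact_EVT_min A0 Ac (continuous_subspaceT hc).
have hc0 : 0 < h c.
  rewrite hE; case: (lerP (N c) 1) => N1.
    have : 0 < modulus (peval p (cx c)) ^+ 2.
      by rewrite exprn_gt0// modulus_gt0 -Hp q0// /closed_unit_ball /mkset -/(sumsq _) NE.
    by have := ler_norm (- (N c - 1)); rewrite normrN; lra.
  by have := sqr_ge0 (modulus (peval p (cx c))); have := normr_ge0 (N c - 1); lra.
exists (Num.sqrt (h c)) => [|v vB]; first by rewrite sqrtr_gt0.
pose x : 'rV[R]_6 := \row_(j < 6)
  nth 0 [:: Re (coords v i0); Im (coords v i0); Re (coords v i1); Im (coords v i1);
            Re (coords v i2); Im (coords v i2)] j.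
have xE : cx x = v.
  apply/rowP => i; rewrite mxE; move: i; apply: forall_I3 => /=; rewrite !mxE !inordK//=.
  - by rewrite -/(coords v i0); case: (coords v i0).
  - by rewrite -/(coords v i1); case: (coords v i1).
  - by rewrite -/(coords v i2); case: (coords v i2).
have xA : x \in A.
  rewrite inE => i /=; rewrite mxE in_itv /= -ler_norml.
  have c0 := ball_coords vB i0; have c1 := ball_coords vB i1; have c2 := ball_coords vB i2.
  by case: i => [[|[|[|[|[|[|k]]]]]] hk] //=;
    first [exact: le_trans (Re_le_modulus _) _ | exact: le_trans (Im_le_modulus _) _].
have := Hc x xA; rewrite (hE x) xE -Hp.
have : N x <= 1 by rewrite -NE xE.
move=> N1; rewrite ler0_norm ?subr_le0// addNr addr0 => hx.
by rewrite -(ger0_norm (modulus_ge0 _)) -sqrtr_sqr ler_wsqrtr.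
Qed.

End ball.

(** * The field far from the square *)

Section field_estimates.
Variable R : realType.
Implicit Types (z a : R[i]).

Lemma centres_modulus n a : a \in centres R n -> modulus a <= 2.
Proof.
move=> /centres_in_box h; have := modulus_le_supnorm a.
have : 0 <= (1 / 3 : R) ^+ n by rewrite exprn_ge0//; lra.
lra.
Qed.

Lemma pow3_le1 n : 0 < (1 / 3 : R) ^+ n <= 1.
Proof. by rewrite exprn_gt0 ?exprn_ile1//; lra. Qed.

Lemma avg_centres_le n (F : R[i] -> R[i]) (M : R) :
  (forall a, a \in centres R n -> modulus (F a) <= M) ->
  modulus (((1 / 4) ^+ n)%:C * \sum_(a <- centres R n) F a) <= M.
Proof.
move=> H; rewrite modulus_realM ger0_norm; last by rewrite exprn_ge0//; lra.
have : modulus (\sum_(a <- centres R n) F a) <= 4 ^+ n * M.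
  apply: (le_trans (modulus_sum _ _)); rewrite big_seq.
  apply: (le_trans (ler_sum _ H)); rewrite -big_seq big_const_seq count_predT.
  by rewrite size_centres iter_addr_0 -[leLHS]mulr_natl natrX.
have e : (1 / 4 : R) ^+ n * 4 ^+ n = 1.
  by rewrite -exprMn (_ : 1 / 4 * 4 = 1) ?expr1n//; lra.
have e0 : 0 <= (1 / 4 : R) ^+ n by rewrite exprn_ge0//; lra.
by move=> /(ler_wpM2l e0); rewrite mulrA e [1 * M]mul1r.
Qed.

Lemma avg_centres1 n : ((1 / 4) ^+ n)%:C * \sum_(a <- centres R n) 1 = 1 :> R[i].
Proof.
rewrite big_const_seq count_predT size_centres iter_addr_0 natrX.
rewrite -(rmorph_nat (real_complex R)) -rmorphXn -rmorphM /= -exprMn.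
by rewrite (_ : 1 / 4 * 4 = 1) ?expr1n//; lra.
Qed.

(** The field is an average of 1 / (z - a) with |a| <= 2, hence close to 1 / z. *)
Lemma field_far n z : 50 <= modulus z ->
  modulus (field n z) <= 1 / 48 /\ modulus (1 - z * field n z) <= 1 / 24.
Proof.
move=> z50; have za a : a \in centres R n -> 48 <= modulus (z - a).
  by move=> /centres_modulus a2; have := modulus_ge z (- a); rewrite modulusN; lra.
have fE : field n z = ((1 / 4) ^+ n)%:C * \sum_(a <- centres R n) (z - a)^-1.
  by apply: field_sum => a /za; have := pow3_le1 n; lra.
split.
  rewrite fE; apply: avg_centres_le => a /za h.
  by rewrite modulusV -div1r ler_pdivrMr; lra.
have -> : 1 - z * field n z =
    ((1 / 4) ^+ n)%:C * \sum_(a <- centres R n) (- (a / (z - a))).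
  rewrite -(avg_centres1 n) fE mulrCA -mulrBr; congr (_ * _).
  rewrite mulr_sumr -sumrB big_seq [RHS]big_seq; apply: eq_bigr => a /za h.
  have z0 : z - a != 0 by rewrite -modulus_gt0; lra.
  by field.
apply: avg_centres_le => a ha; have h := za a ha; have h2 := centres_modulus ha.
by rewrite modulusN modulusM modulusV ler_pdivrMr; lra.
Qed.

Lemma centres_off0 n a : (0 < n)%N -> a \in centres R n -> (1 / 3) ^+ n <= modulus a.
Proof.
case: n => // n _ /centresSP[b [c [hb /centres_in_box hc ->]]].
have := supnormD (b + (1 / 3)%:C * c) (- ((1 / 3)%:C * c)); rewrite addrK supnormN.
rewrite (supnorm_corner hb) supnormZ; last by lra.
have := supnorm_le_modulus (b + (1 / 3)%:C * c).
by have := pow3_le1 n; rewrite exprS; lra.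
Qed.

Lemma prod_diff_deriv (s : seq R[i]) z : (forall a, a \in s -> z - a != 0) ->
  ((\prod_(a <- s) ('X - a%:P))^`()).[z] = prod_diff s z * \sum_(a <- s) (z - a)^-1.
Proof.
elim: s => [|a s IH] H.
  by rewrite !big_nil mulr0 -[1]/(1%:P) derivC horner0.
have za : z - a != 0 by apply: H; rewrite inE eqxx.
rewrite !big_cons derivM derivXsubC hornerD !hornerM IH => [|b bs]; last first.
  by apply: H; rewrite inE bs orbT.
by rewrite hornerXsubC hornerC mul1r -prod_diffE /prod_diff big_cons; field.
Qed.

End field_estimates.

(** * Zeros of polynomials on a rational curve *)

Section counting_zeros.
Variable R : realType.
Implicit Types (z a : R[i]).

(** For s = 1 this is z |-> shear z (field n z) 0, rational in z off the discs around the
   centres; the factor s contracts it to the origin. *)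
Definition ratmap n (s : R) z : Cspace R 3 :=
  mk3 (s%:C * ((1 / 200)%:C * z)) (s%:C * (4%:C * field n z))
    (s%:C * (8%:C * (1 - z * field n z))).

Definition off_discs n z := forall a, a \in centres R n -> (1 / 3) ^+ n <= modulus (z - a).

Lemma off_discs_neq0 n z a : off_discs n z -> a \in centres R n -> z - a != 0.
Proof. by move=> H /H; rewrite -modulus_gt0; have := pow3_le1 R n; lra. Qed.

Lemma field_prod_diff n z : off_discs n z -> prod_diff (centres R n) z * field n z =
  (((1 / 4) ^+ n)%:C *: (\prod_(a <- centres R n) ('X - a%:P))^`()).[z].
Proof.
move=> H; rewrite hornerZ prod_diff_deriv; last by move=> a; exact: off_discs_neq0.
by rewrite (field_sum H); ring.
Qed.

(** Each coordinate becomes a polynomial in z after multiplication by prod_diff, the common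
   denominator. *)
Lemma ratmap_numerator (p : mpoly.mpoly 3 R[i]) n :
  exists m, forall s : R, exists N : {poly R[i]}, forall z, off_discs n z ->
    N.[z] = prod_diff (centres R n) z ^+ m * peval p (ratmap n s z).
Proof.
pose D : {poly R[i]} := \prod_(a <- centres R n) ('X - a%:P).
pose P (F : Cspace R 3 -> R[i]) := exists m0, forall m, (m0 <= m)%N -> forall s : R,
  exists N : {poly R[i]}, forall z, off_discs n z -> N.[z] = D.[z] ^+ m * F (ratmap n s z).
suff [m0 H] : P (peval p).
  by exists m0 => s; have [N HN] := H m0 (leqnn _) s; exists N => z; rewrite prod_diffE; exact: HN.
apply: peval_ind => [c|i|f h [m1 H1] [m2 H2]|f h [m1 H1] [m2 H2]].
- exists 0%N => m _ s; exists (c *: D ^+ m) => z _.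
  by rewrite hornerZ horner_exp mulrC.
- exists 1%N => -[//|m] _ s.
  have times (Q : {poly R[i]}) (j : 'I_3) :
      (forall z, off_discs n z -> Q.[z] = D.[z] * coords (ratmap n s z) j) ->
      exists N : {poly R[i]}, forall z, off_discs n z ->
        N.[z] = D.[z] ^+ m.+1 * coords (ratmap n s z) j.
    move=> HQ; exists (D ^+ m * Q) => z /HQ E.
    by rewrite hornerM horner_exp E exprS; ring.
  pose G : {poly R[i]} := ((1 / 4) ^+ n)%:C *: D^`().
  have GE z : off_discs n z -> G.[z] = D.[z] * field n z.
    by move=> hz; rewrite -field_prod_diff// prod_diffE.
  move: i; apply: forall_I3.
  + apply: (times ((s%:C * (1 / 200)%:C) *: ('X * D))) => z _.
    by rewrite /ratmap coords_mk3 hornerZ hornerM hornerX /=; ring.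
  + apply: (times ((s%:C * 4%:C) *: G)) => z hz.
    by rewrite /ratmap coords_mk3 hornerZ GE//=; ring.
  + apply: (times ((s%:C * 8%:C) *: (D - 'X * G))) => z hz.
    by rewrite /ratmap coords_mk3 hornerZ hornerD hornerN hornerM hornerX GE//=; ring.
- exists (maxn m1 m2) => m; rewrite geq_max => /andP[hm1 hm2] s.
  have [N HN] := H1 m hm1 s; have [K HK] := H2 m hm2 s.
  by exists (N + K) => z hz; rewrite hornerD HN// HK// mulrDr.
- exists (m1 + m2)%N => m hm s.
  have [N HN] := H1 m1 (leqnn _) s.
  have hm2 : (m2 <= m - m1)%N by rewrite leq_subRL// (leq_trans _ hm)// leq_addr.
  have [K HK] := H2 (m - m1)%N hm2 s.
  exists (N * K) => z hz; rewrite hornerM HN// HK//.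
  have -> : D.[z] ^+ m = D.[z] ^+ m1 * D.[z] ^+ (m - m1).
    by rewrite -exprD subnKC// (leq_trans _ hm)// leq_addr.
  by ring.
Qed.

Definition poles n m : seq R[i] := flatten (nseq m (centres R n)).

Lemma prod_diff_poles n m z : prod_diff (poles n m) z = prod_diff (centres R n) z ^+ m.
Proof.
elim: m => [|m IH]; first by rewrite /prod_diff big_nil expr0.
by rewrite exprS -IH /prod_diff /poles /= big_cat.
Qed.

Lemma count_poles n m (P : pred R[i]) : count P (poles n m) = (m * count P (centres R n))%N.
Proof. by elim: m => [|m IH] //; rewrite /poles /= count_cat -/(poles n m) IH mulSn. Qed.

Lemma prod_diff_ge (s : seq R[i]) z (r : R) : 0 <= r ->
  (forall a, a \in s -> r <= modulus (z - a)) -> r ^+ size s <= modulus (prod_diff s z).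
Proof.
move=> r0; elim: s => [|a s IH] H; first by rewrite /prod_diff big_nil modulus1 expr0.
rewrite /prod_diff big_cons modulusM exprS ler_pM ?exprn_ge0//.
  by apply: H; rewrite inE eqxx.
by apply: IH => b bs; apply: H; rewrite inE bs orbT.
Qed.

(** Rouche's theorem for the numerators of two rational functions f and h with common
   denominator prod_diff ^+ m: the denominator cancels from its hypothesis. *)
Lemma count_roots_stable n m (c : R[i]) (r b d : R) (f h : R[i] -> R[i]) k s k' s' :
  0 < r -> 0 < b -> 0 < d ->
  (forall z, modulus (z - c) = r -> off_discs n z /\ forall a, a \in centres R n ->
     b <= modulus (z - a)) ->
  (forall z, off_discs n z -> k * prod_diff s z = prod_diff (centres R n) z ^+ m * f z) ->
  (forall z, off_discs n z -> k' * prod_diff s' z = prod_diff (centres R n) z ^+ m * h z) ->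
  (forall z, modulus (z - c) = r -> d <= modulus (h z)) ->
  (forall z, modulus (z - c) = r -> modulus (f z - h z) <= d / 2) ->
  count (fun x => modulus (x - c) < r) s = count (fun x => modulus (x - c) < r) s'.
Proof.
move=> r0 b0 d0 H Hf Hh hd fh.
apply: (@rouche _ c r k s k' s' ((b ^+ size (centres R n)) ^+ m * d)) => //.
- by rewrite mulr_gt0// !exprn_gt0.
- move=> z zc; have [hz za] := H z zc; rewrite Hh// modulusM modulusX.
  have bp := prod_diff_ge (ltW b0) za.
  rewrite ler_pM ?hd ?(ltW d0) ?exprn_ge0 ?(ltW b0)//.
  by rewrite lerXn2r ?nnegrE ?exprn_ge0 ?modulus_ge0 ?(ltW b0).
- move=> z zc; have [hz za] := H z zc; rewrite Hf// Hh// -mulrBr !modulusM.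
  rewrite -mulrA ler_wpM2l ?modulus_ge0//.
  by have := hd z zc; have := fh z zc; lra.
Qed.


Lemma count_exclusive_lt (L r : seq R[i]) (P : R[i] -> pred R[i]) (W : pred R[i]) x0 :
  uniq L -> (forall a b x, a \in L -> b \in L -> P a x -> P b x -> a = b) ->
  (forall a x, a \in L -> P a x -> W x) ->
  x0 \in r -> W x0 -> (forall a, a \in L -> ~~ P a x0) ->
  (\sum_(a <- L) count (P a) r < count W r)%N.
Proof.
move=> uL excl PW xr Wx Px.
have one x : (\sum_(a <- L) P a x <= W x)%N.
  have [/hasP[a aL ax]|no] := boolP (has (P ^~ x) L).
    rewrite (PW a x aL ax) (bigD1_seq a)//= ax big_seq_cond big1 ?addn0//.
    move=> b /andP[bL ba]; apply/eqP; rewrite eqb0; apply: contra ba => bx.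
    by apply/eqP/(excl b a x).
  rewrite big_seq big1// => a aL; apply/eqP; rewrite eqb0.
  by apply: contra no => ax; apply/hasP; exists a.
have le s : (\sum_(a <- L) count (P a) s <= count W s)%N.
  elim: s => [|x s IH]; first by rewrite big1.
  by rewrite /= big_split /= leq_add.
elim: r xr => [//|x r IH]; rewrite inE => /orP[/eqP <-|/IH h].
  rewrite /= big_split /= Wx add1n ltnS big_seq big1 ?add0n ?le// => a /Px.
  by move=> /negbTE ->.
by rewrite /= big_split /= -addnS leq_add.
Qed.

End counting_zeros.

(** * A point in the rational hull *)

Section rational_hull.
Variable R : realType.

Definition hull_point : Cspace R 3 := mk3 0 0 8%:C.

Lemma ratmap0 n : ratmap n (1 : R) 0 = hull_point.
Proof.
by rewrite /ratmap field0 !mulr0 subr0 !mulr1 rmorph1 mul1r.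
Qed.

Lemma shear_in_ball (z w c : R[i]) : modulus z <= 62 -> modulus w <= 1 / 40 ->
  modulus (1 - z * w) <= 1 / 20 -> modulus c <= 1 / 10 -> sumsq (shear z w c) <= 1.
Proof.
move=> z62 w1 zw c1; rewrite /shear sumsq_mk3.
have sq (x : R[i]) (M : R) : modulus x <= M -> modulus x ^+ 2 <= M ^+ 2.
  by move=> xM; have x0 := modulus_ge0 x; rewrite lerXn2r ?nnegrE// (le_trans x0).
have h0 : modulus ((1 / 200)%:C * z) <= 31 / 100 by rewrite modulus_realM ger0_norm; lra.
have h1 : modulus (4%:C * w) <= 1 / 10 by rewrite modulus_realM ger0_norm; lra.
have h2 : modulus (8%:C * (1 - z * w) + c) <= 1 / 2.
  by apply: (le_trans (modulusD _ _)); rewrite modulus_realM ger0_norm; lra.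
by have := sq _ _ h0; have := sq _ _ h1; have := sq _ _ h2; lra.
Qed.

(** If |z w| >= 1/2 the second coordinate is large, otherwise the third one is. *)
Lemma shear_outside_ball (z w c : R[i]) : modulus z <= 3 / 2 -> modulus c <= 1 ->
  1 < sumsq (shear z w c).
Proof.
move=> z2 c1; rewrite /shear sumsq_mk3.
have sq0 := sqr_ge0 (modulus ((1 / 200)%:C * z)).
have sq1 := sqr_ge0 (modulus (4%:C * w)).
have sq2 := sqr_ge0 (modulus (8%:C * (1 - z * w) + c)).
have [zw|zw] := lerP (1 / 2) (modulus (z * w)).
  rewrite modulusM in zw; have w0 := modulus_ge0 w.
  have w1 : 1 / 3 <= modulus w by have := ler_wpM2r w0 z2; lra.
  have : 4 / 3 <= modulus (4%:C * w) by rewrite modulus_realM ger0_norm; lra.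
  by nra.
have h2 := modulus_ge (8%:C * (1 - z * w)) c.
have h3 := modulus_ge 1 (- (z * w)); rewrite modulusN modulus1 in h3.
rewrite modulus_realM ger0_norm in h2; last by lra.
have : 3 <= modulus (8%:C * (1 - z * w) + c) by lra.
by nra.
Qed.

Lemma ratmap_in_ball n (s : R) z : 0 <= s <= 1 -> 50 <= modulus z <= 62 ->
  closed_unit_ball (ratmap n s z).
Proof.
move=> /andP[s0 s1] /andP[z50 z62]; have [f1 f2] := field_far n z50.
rewrite /closed_unit_ball /mkset -/(sumsq _).
have -> : sumsq (ratmap n s z) = s ^+ 2 * sumsq (shear z (field n z) 0).
  rewrite /ratmap /shear !sumsq_mk3 !(modulus_realM s) !exprMn (ger0_norm s0).
  by rewrite addr0; ring.
have h : sumsq (shear z (field n z) 0) <= 1.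
  by apply: shear_in_ball => //; rewrite ?modulus0; lra.
have h0 : 0 <= sumsq (shear z (field n z) 0).
  by apply: sumr_ge0 => i _; exact: sqr_ge0.
have : s ^+ 2 <= 1 by rewrite exprn_ile1.
have := sqr_ge0 s; nra.
Qed.

Lemma ratmap1 n (z : R[i]) : ratmap n 1 z = shear z (field n z) 0.
Proof. by rewrite /ratmap /shear rmorph1 !mul1r addr0. Qed.

Lemma shear_coords_le (z w c : R[i]) (G : R) : 0 <= G ->
  modulus z <= 3 -> modulus w <= G + 2 -> modulus c <= 1 ->
  forall i, modulus (coords (shear z w c) i) <= 200 + 200 * G.
Proof.
move=> G0 z3 wG c1; apply: forall_I3; rewrite /shear !coords_mk3 /=.
- by rewrite modulus_realM ger0_norm; lra.
- by rewrite modulus_realM ger0_norm; lra.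
have := modulusD (8%:C * (1 - z * w)) c; rewrite modulus_realM ger0_norm//.
have := modulusD 1 (- (z * w)); rewrite modulusN modulus1 modulusM.
by have := ler_pM (modulus_ge0 _) (modulus_ge0 _) z3 wG; lra.
Qed.

Lemma shear_coords_near (z z' w w' c : R[i]) (G k : R) : 0 <= G -> 0 <= k ->
  modulus z <= 3 -> modulus w' <= G -> modulus (z - z') <= 3 * k ->
  modulus (w - w') <= 2 * k -> modulus c <= k ->
  forall i, modulus (coords (shear z w 0) i - coords (shear z' w' c) i) <=
    (100 + 100 * G) * k.
Proof.
move=> G0 k0 z3 w'G zz ww ck; have Gk : 0 <= G * k by rewrite mulr_ge0.
apply: forall_I3; rewrite /shear !coords_mk3 /=.
- by rewrite -mulrBr modulus_realM ger0_norm; lra.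
- by rewrite -mulrBr modulus_realM ger0_norm; lra.
have -> : 8%:C * (1 - z * w) + 0 - (8%:C * (1 - z' * w') + c) =
    - (8%:C * (z * (w - w') + (z - z') * w')) - c by ring.
apply: (le_trans (modulusD _ _)); rewrite !modulusN modulus_realM ger0_norm//.
have := modulusD (z * (w - w')) ((z - z') * w'); rewrite !modulusM.
have := ler_pM (modulus_ge0 _) (modulus_ge0 _) z3 ww.
have := ler_pM (modulus_ge0 _) (modulus_ge0 _) zz w'G.
lra.
Qed.

(** On such a circle field n is close to the uniformly continuous limit_field, and the curve
   comes near the centre a at a small height. *)
Lemma ratmap_near_path (p : mpoly.mpoly 3 R[i]) (d : R) : 0 < d -> exists N, forall n,
  (N <= n)%N -> forall a, a \in centres R n -> exists2 t, 0 <= t <= 1 &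
  forall z, modulus (z - a) = (1 / 3) ^+ n ->
    modulus (peval p (ratmap n 1 z) - peval p (path t)) <= d.
Proof.
move=> d0; have [G HG] := limit_field_bounded R.
have G0 : 0 <= G by rewrite (le_trans _ (HG 0))// modulus_ge0.
have [L L0 HL] := peval_lipschitz p (200 + 200 * G).
have K0 : 0 < 100 + 100 * G by lra.
pose kap := Num.min 1 (d / L / (100 + 100 * G)).
have kap0 : 0 < kap by rewrite lt_min ltr01 !divr_gt0.
have kap1 : kap <= 1 by rewrite ge_min lexx.
have kapL : L * ((100 + 100 * G) * kap) <= d.
  have : kap <= d / L / (100 + 100 * G) by rewrite ge_min lexx orbT.
  by rewrite ler_pdivlMr// ler_pdivlMr//; lra.
have [e e0 he] := @limit_field_ucont R kap kap0.
have [N1 hN1] := field_limit_unif kap0.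
have [N2 hN2] : exists n, (1 / 3 : R) ^+ n < Num.min (kap / 3) (e / 3).
  by apply: exp_lt_eps; [lra|rewrite lt_min; apply/andP; split; lra].
exists (maxn N1 N2) => n; rewrite geq_max => /andP[n1 n2] a ha.
have : (1 / 3 : R) ^+ n < Num.min (kap / 3) (e / 3).
  by apply: le_lt_trans hN2; apply: ler_wiXn2l; [lra|lra|].
have := pow3_le1 R n; set rho := (1 / 3) ^+ n => /andP[rho0 rho1].
rewrite lt_min => /andP[rhok rhoe].
have [t [t01 ta ht]] := curve_near_centre ha; rewrite -/rho in ta ht.
exists t => // z za; have [zt htE] := ext_pos t01; set w := curve_z t in zt ta.
have zw : modulus (z - w) <= 3 * rho.
  have := modulus_triangle z a w; rewrite za (modulusB a w).
  by have := modulus_le_supnorm (w - a); lra.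
have w2 : modulus w <= 2.
  have x1 : `|curve_x t| <= 1 by rewrite ler_norml; exact: curve_x_bound.
  have y1 : `|curve_y t| <= 1 by rewrite ler_norml; exact: curve_y_bound.
  by apply: (le_trans (modulus_le_ReIm w)) => /=; move: x1 y1; clear; lra.
have z3 : modulus z <= 3.
  by have := modulusD (z - w) w; rewrite subrK; move: zw w2 rhok kap1; clear; lra.
have fg : modulus (field n z - limit_field w) <= 2 * kap.
  have h1 := modulus_triangle (field n z) (limit_field z) (limit_field w).
  have h2 : distC (limit_field z) (limit_field w) < kap.
    by apply: he; rewrite /distC; move: zw rhoe; clear; lra.
  by have h3 := hN1 n n1 z; rewrite /distC in h2; move: h1 h2 h3; clear; lra.
have gw := HG w.
have fz : modulus (field n z) <= G + 2.
  have := modulusD (field n z - limit_field w) (limit_field w).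
  by rewrite subrK; move: fg gw kap1; clear; lra.
have hk : modulus ((ext_h t)%:C : R[i]) <= kap.
  rewrite modulus_real htE ger0_norm; last by case/andP: (curve_h_bound t01).
  by move: ht rhok kap0; clear; lra.
have zw' : modulus (z - w) <= 3 * kap by move: zw rhok kap0; clear; lra.
have w3 : modulus w <= 3 by move: w2; clear; lra.
have gw' : modulus (limit_field w) <= G + 2 by move: gw; clear; lra.
have c01 : modulus (0 : R[i]) <= 1 by rewrite modulus0.
rewrite ratmap1 /path zt.
have [_ h] := HL _ _ _ (mulr_ge0 (ltW K0) (ltW kap0))
  (shear_coords_le G0 z3 fz c01) (shear_coords_le G0 w3 gw' (le_trans hk kap1))
  (shear_coords_near G0 (ltW kap0) z3 gw zw' fg hk).
exact: le_trans h kapL.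
Qed.

Section zeros_of_a_polynomial.
Variables (p : mpoly.mpoly 3 R[i]) (d : R) (n m : nat).
Hypothesis d_gt0 : 0 < d.
Hypothesis numerator : forall s : R, exists N : {poly R[i]}, forall z, off_discs n z ->
  N.[z] = prod_diff (centres R n) z ^+ m * peval p (ratmap n s z).

Definition roots_of_ratmap (s : R) (kr : R[i] * seq R[i]) := forall z, off_discs n z ->
  kr.1 * prod_diff kr.2 z = prod_diff (centres R n) z ^+ m * peval p (ratmap n s z).

Lemma roots_of_ratmap_exist s : exists kr, roots_of_ratmap s kr.
Proof.
have [N HN] := numerator s; have [r Hr] := closed_field_poly_normal N.
exists (lead_coef N, r) => z /HN <-.
by rewrite [in RHS]Hr hornerZ prod_diffE.
Qed.

Let outer z : modulus (z - 0) = 60 -> off_discs n z /\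
  forall a, a \in centres R n -> 1 <= modulus (z - a).
Proof.
rewrite subr0 => z60; have za a : a \in centres R n -> 1 <= modulus (z - a).
  by move=> /centres_modulus a2; have := modulus_ge z (- a); rewrite modulusN; lra.
by split=> // a /za; have := pow3_le1 R n; lra.
Qed.

Let outer_ball (s : R) z : 0 <= s <= 1 -> modulus (z - 0) = 60 ->
  closed_unit_ball (ratmap n s z).
Proof.
by move=> s01; rewrite subr0 => z60; apply: ratmap_in_ball => //; rewrite z60; lra.
Qed.

(** On the circle of radius 60 the map takes values in the ball, in which it can be
   contracted to a constant.  Along the contraction p does not vanish; it is cut into K
   steps so short that Rouche's theorem applies to each. *)
Lemma count_roots_outer kr : (forall v, closed_unit_ball v -> d <= modulus (peval p v)) ->
  roots_of_ratmap 1 kr ->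
  count (fun x => modulus (x - 0) < 60) kr.2 = (m * size (centres R n))%N.
Proof.
move=> dB Hkr; have [L L0 HL] := peval_lipschitz p 1.
have r60 : (0 : R) < 60 by rewrite ltr0n.
pose K := (Num.bound (2 * L / d)).+1.
have K0 : 0 < K%:R :> R by rewrite ltr0n.
have KV : 0 <= (K%:R^-1 : R) by rewrite invr_ge0 ler0n.
have LK : L * K%:R^-1 <= d / 2.
  have Ld : 0 <= 2 * L / d by rewrite divr_ge0// ?mulr_ge0// ltW.
  have : 2 * L / d < K%:R by rewrite /K -natr1; have := archi_boundP Ld; lra.
  by rewrite ler_pdivrMr// ltr_pdivrMr//; lra.
have q01 (j : nat) : (j <= K)%N -> 0 <= (j%:R / K%:R : R) <= 1.
  by move=> jK; rewrite divr_ge0 ?ler0n//= ler_pdivrMr// mul1r ler_nat.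
have H k : (k <= K)%N -> forall kr, roots_of_ratmap (k%:R / K%:R) kr ->
    count (fun x => modulus (x - 0) < 60) kr.2 = (m * size (centres R n))%N.
  elim: k => [|k IH] kK {Hkr}kr Hkr.
    have <- : count (fun x => modulus (x - 0) < 60) (poles R n m) =
        (m * size (centres R n))%N.
      rewrite count_poles; congr (_ * _)%N; apply/eqP; rewrite -all_count.
      by apply/allP => a /centres_modulus; rewrite subr0; lra.
    have rz z : ratmap n (0 / K%:R : R) z = mk3 0 0 0.
      by rewrite /ratmap mul0r rmorph0 !mul0r.
    apply: (@count_roots_stable R n m 0 60 1 d (fun z => peval p (ratmap n (0 / K%:R) z))
      (fun=> peval p (mk3 0 0 0)) kr.1 _ (peval p (mk3 0 0 0))) => //.
    - by move=> z hz; rewrite prod_diff_poles mulrC.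
    - move=> z hz; rewrite -(rz z); apply/dB/outer_ball => //.
      by rewrite mul0r lexx ler01.
    - by move=> z _; rewrite rz subrr modulus0 divr_ge0 ?(ltW d_gt0).
  have [kr' Hkr'] := roots_of_ratmap_exist (k%:R / K%:R).
  rewrite -(IH (ltnW kK) kr' Hkr').
  apply: (@count_roots_stable R n m 0 60 1 d
    (fun z => peval p (ratmap n (k.+1%:R / K%:R) z))
    (fun z => peval p (ratmap n (k%:R / K%:R) z)) kr.1 _ kr'.1) => //.
    by move=> z hz; apply/dB/outer_ball => //; apply: q01; exact: ltnW.
  move=> z hz; have s1 := q01 _ kK; have s0 := q01 _ (ltnW kK).
  have hB1 := ball_coords (outer_ball s1 hz); have hB0 := ball_coords (outer_ball s0 hz).
  have diff i : modulus (coords (ratmap n (k.+1%:R / K%:R) z) i -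
      coords (ratmap n (k%:R / K%:R) z) i) <= K%:R^-1.
    have o01 : 0 <= (1 : R) <= 1 by rewrite ler01 lexx.
    have := ball_coords (outer_ball o01 hz) i.
    have E (w : R[i]) : (k.+1%:R / K%:R)%:C * w - (k%:R / K%:R)%:C * w =
        (K%:R^-1)%:C * (1%:C * w).
      by rewrite -mulrBl -rmorphB -mulrBl -natr1 addrC addKr mul1r rmorph1 mul1r.
    move: i {hB1 hB0}; apply: forall_I3; rewrite /ratmap !coords_mk3 /= => h;
      by rewrite E modulus_realM ger0_norm// ler_piMr.
  have [_ h] := HL _ _ _ KV hB1 hB0 diff.
  exact: le_trans h LK.
by apply: (H K (leqnn _) kr) => z hz; rewrite divff ?Hkr// gt_eqF.
Qed.

Lemma centres_far a b : a \in centres R n -> b \in centres R n -> a != b ->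
  4 * (1 / 3) ^+ n <= modulus (a - b).
Proof. by move=> ha hb /(centres_sep ha hb)/le_trans; apply; exact: supnorm_le_modulus. Qed.

(** Around a pole the map is close to a point of the arc, so Rouche's theorem compares the
   numerator with a constant multiple of the denominator. *)
Lemma count_roots_hole kr a (t : R) : a \in centres R n ->
  d <= modulus (peval p (path t)) ->
  (forall z, modulus (z - a) = (1 / 3) ^+ n ->
    modulus (peval p (ratmap n 1 z) - peval p (path t)) <= d / 2) ->
  roots_of_ratmap 1 kr ->
  count (fun x => modulus (x - a) < (1 / 3) ^+ n) kr.2 = m.
Proof.
move=> ha dt near Hkr; have /andP[rho0 _] := pow3_le1 R n; set rho := _ ^+ n in near rho0 *.
transitivity (count (fun x => modulus (x - a) < rho) (poles R n m)).
  apply: (@count_roots_stable R n m a rho rho d (fun z => peval p (ratmap n 1 z))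
    (fun=> peval p (path t)) kr.1 _ (peval p (path t))) => //.
  - move=> z za; have H b : b \in centres R n -> rho <= modulus (z - b).
      move=> hb; have [->|ba] := eqVneq b a; first by rewrite za.
      have := centres_far hb ha ba; have := modulus_triangle b z a.
      by rewrite za (modulusB b z) -/rho; lra.
    by split.
  - by move=> z hz; rewrite prod_diff_poles mulrC.
rewrite count_poles -[RHS]muln1; congr (_ * _)%N.
have <- : count_mem a (centres R n) = 1%N by rewrite count_uniq_mem ?centres_uniq// ha.
apply: eq_in_count => b hb /=; have [->|ba] := eqVneq b a.
  by rewrite subrr modulus0 rho0.
by apply/negbTE; rewrite -leNgt; have := centres_far hb ha ba; rewrite -/rho; lra.
Qed.

End zeros_of_a_polynomial.

(** In the disc of radius 60 the numerator of p o ratmap n has as many zeros as the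
   denominator, and so it has in each of the discs around the poles, which contain all
   zeros of the denominator.  So the numerator has no further zero in the large disc, in
   particular not at 0, where ratmap n takes the value hull_point. *)
Lemma no_avoiding_hypersurface (p : mpoly.mpoly 3 R[i]) :
  (forall v, closed_unit_ball v -> peval p v != 0) ->
  (forall t, 0 <= t <= 1 -> peval p (@path R t) != 0) ->
  peval p hull_point != 0.
Proof.
move=> p_ball p_path; apply/eqP => p_hull.
have Hp : polyfun (peval p : Cspace R 3 -> R[i]) by exists p.
have [d1 d10 hd1] := ball_polyfun_pos Hp p_ball.
have [[t0 t001 ht0] _] := ucont_extrema (bucont_modulus (path_polyfun_bucont Hp)).
have d20 : 0 < modulus (peval p (path t0)) by rewrite modulus_gt0 p_path.
set d2 := modulus _ in d20 ht0.
pose d := Num.min d1 d2.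
have d0 : 0 < d by rewrite lt_min d10.
have dB v : closed_unit_ball v -> d <= modulus (peval p v).
  by move=> /hd1; apply: le_trans; rewrite ge_min lexx.
have dJ t : 0 <= t <= 1 -> d <= modulus (peval p (path t)).
  by move=> /ht0; apply: le_trans; rewrite ge_min lexx orbT.
(* The level N.+1 is positive, so that 0 is off the discs. *)
have [N /(_ N.+1 (leqnSn N)) near] := ratmap_near_path p (divr_gt0 d0 (ltr0n _ 2)).
set n := N.+1 in near; have [m num] := ratmap_numerator p n.
have [[k r] Hkr] := roots_of_ratmap_exist num 1.
have total := count_roots_outer d0 num dB Hkr; rewrite /= in total Hkr.
have hole a : a \in centres R n -> count (fun x => modulus (x - a) < (1 / 3) ^+ n) r = m.
  move=> ha; have [t t01 ht] := near a ha.
  exact: (count_roots_hole d0 ha (dJ t t01) ht Hkr).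
have off0 : off_discs n (0 : R[i]).
  by move=> a ha; rewrite sub0r modulusN; exact: centres_off0.
have k0 : k != 0.
  have o01 : 0 <= (1 : R) <= 1 by rewrite ler01 lexx.
  have m60 : modulus ((60 : R)%:C) = 60 by rewrite modulus_real ger0_norm.
  have hz : off_discs n (60 : R)%:C.
    move=> a /centres_modulus a2; have := modulus_ge (60 : R)%:C (- a).
    by rewrite modulusN m60; have := pow3_le1 R n; lra.
  apply/eqP => kE; have := Hkr _ hz.
  rewrite /= kE mul0r => /esym/eqP; apply/negP; rewrite mulf_neq0//.
    apply: expf_neq0; rewrite /prod_diff prodf_seq_neq0; apply/allP => a ha /=.
    exact: off_discs_neq0 hz ha.
  by apply/p_ball/ratmap_in_ball; rewrite ?o01// m60; apply/andP; split; rewrite ler_nat.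
have r0 : (0 : R[i]) \in r.
  have /eqP := Hkr 0 off0; rewrite /= ratmap0 p_hull mulr0 mulf_eq0 (negbTE k0) /=.
  by rewrite prod_diffE -root_prod_XsubC.
have := @count_exclusive_lt R (centres R n) r (fun a x => modulus (x - a) < (1 / 3) ^+ n)
  (fun x => modulus (x - 0) < 60) 0 (centres_uniq R n).
rewrite total big_seq (eq_bigr (fun=> m)) => [|a ha]; last exact: hole.
rewrite -big_seq big_const_seq count_predT iter_addn_0 ltnn => H.
apply: notF; apply: H => //.
- move=> a b x ha hb xa xb; apply/eqP; apply: contraT => ab.
  have := centres_far ha hb ab; have := modulus_triangle a x b.
  have := pow3_le1 R n; rewrite (modulusB a x); move: xa xb; clear; lra.
- move=> a x /centres_modulus a2 xa; rewrite subr0.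
  have := modulusD (x - a) a; rewrite subrK; have := pow3_le1 R n.
  by move: a2 xa; clear; lra.
- by rewrite subrr modulus0.
- by move=> a /off0 h; rewrite -leNgt.
Qed.

End rational_hull.

(** * The end of the arc on the sphere *)

Section conclusion.
Variable R : realType.

Lemma path_outside_ball t : 0 <= t <= 1 -> 1 < sumsq (@path R t).
Proof.
move=> t01; have [zt ht] := ext_pos t01; apply: shear_outside_ball.
  have : modulus (ext_z t) ^+ 2 <= 2.
    rewrite zt modulus_sqr /=.
    by have := curve_x_bound t01; have := curve_y_bound t01; nra.
  by have := modulus_ge0 (ext_z t); nra.
by rewrite modulus_real ht ler_norml; have := curve_h_bound t01; lra.
Qed.

Lemma limit_field_far (z : R[i]) : 50 <= modulus z <= 62 ->
  modulus (limit_field z) <= 1 / 40 /\ modulus (1 - z * limit_field z) <= 1 / 20.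
Proof.
move=> /andP[z50 z62]; have e0 : 0 < (1 / 10000 : R) by lra.
have [N /(_ N (leqnn N) z) fw] := field_limit_unif e0.
have [f1 f2] := field_far N z50; split.
  have := modulusD (limit_field z - field N z) (field N z); rewrite subrK.
  by rewrite (modulusB (limit_field z)); lra.
have -> : 1 - z * limit_field z = (1 - z * field N z) + z * (field N z - limit_field z).
  by ring.
apply: (le_trans (modulusD _ _)); rewrite modulusM.
by have := ler_pM (modulus_ge0 _) (modulus_ge0 _) z62 fw; lra.
Qed.

Lemma path_start_in_ball : sumsq (@path R (-1)) <= 1.
Proof.
have m1 : -1 <= (-1 : R) <= 0 by lra.
have [zt ht] := ext_neg m1.
have z61 : 50 <= modulus (@ext_z R (-1)) <= 62.
  have := Re_le_modulus (@ext_z R (-1)); have := modulus_le_ReIm (@ext_z R (-1)).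
  by rewrite zt /= !ler0_norm; lra.
have [h1 h2] := limit_field_far z61.
apply: shear_in_ball => //; first by case/andP: z61.
by rewrite modulus_real ht ger0_norm; lra.
Qed.

(** The path starts in the ball and is outside of it on [0, 1]; the parameter a is that of the
   last point in the ball. *)
Lemma last_exit : exists a : R, [/\ -1 <= a < 0, sumsq (path a) <= 1 &
  forall t, a < t <= 1 -> 1 < sumsq (path t)].
Proof.
pose S : set R := [set t | -1 <= t <= 1 /\ sumsq (path t) <= 1].
have S1 : S (-1) by split; [lra|exact: path_start_in_ball].
have Su : ubound S 1 by move=> t [t1 _]; lra.
have Sb : has_ubound S by exists 1.
have a1 : -1 <= sup S by exact: (ub_le_sup Sb S1).
have a2 : sup S <= 1 by apply: ge_sup => //; exists (-1).
have N_ucont : ucont (@distR R) (@distR R) (fun t => sumsq (path t)).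
  have sq i : bucont (fun t => (modulus (coords (@path R t) i) ^+ 2)%:C : R[i]).
    have [[M HM] Hu] := @path_coords_bucont R i.
    have cu := bucont_modulus (@path_coords_bucont R i).
    have Bm : bucont (fun t => (modulus (coords (@path R t) i))%:C : R[i]).
      split; first by exists M => t; rewrite modulus_real ger0_norm ?modulus_ge0.
      move=> e /cu[d d0 hd]; exists d => // x y /hd.
      by rewrite /distC -rmorphB modulus_real.
    by have := bucontM Bm Bm; under eq_fun do rewrite -rmorphM -expr2.
  have B := bucontD (bucontD (sq i0) (sq i1)) (sq i2).
  move=> e /(B.2)[d d0 hd]; exists d => // x y /hd.
  by rewrite /distC -!rmorphD -rmorphB modulus_real /distR !sumsqE.
have aN : sumsq (path (sup S)) <= 1.
  apply/ler_addgt0Pl => e /N_ucont[d d0 hd].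
  have hs : has_sup S by split => //; exists (-1).
  have [t [t1 tN] ht] := sup_adherent d0 hs.
  have ta : t <= sup S by apply: ub_le_sup.
  have : distR (sup S) t < d by rewrite /distR ger0_norm; lra.
  by move=> /hd; rewrite /distR ltr_norml; lra.
exists (sup S); split=> //.
  rewrite a1 ltNge; apply/negP => a0.
  have a01 : 0 <= sup S <= 1 by lra.
  by have := path_outside_ball a01; lra.
move=> t /andP[ta t1]; rewrite ltNge; apply/negP => tN.
have : S t by split=> //; lra.
by move=> /(ub_le_sup Sb); lra.
Qed.

Lemma hull_point_not_in_ball : ~ closed_unit_ball (hull_point R).
Proof.
rewrite /closed_unit_ball /mkset -/(sumsq _) /hull_point sumsq_mk3.
by rewrite modulus0 modulus_real ger0_norm; lra.
Qed.

Lemma hull_point_not_on_path t : -1 <= t <= 1 -> path t <> hull_point R.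
Proof.
move=> t1 E; have zE : ext_z t = 0.
  by have := congr1 (@shear_z R) E; rewrite shear_zK /shear_z coords_mk3 /= mulr0.
have hE : ext_h t = 0.
  have := congr1 (@shear_c R) E; rewrite shear_cK /shear_c /shear_z /shear_w !coords_mk3 /=.
  by rewrite !mulr0 subr0 mulr1 subrr => /complexI.
have := ext_h_zero t1 hE; rewrite zE => /(_ 1%N)[] /=; lra.
Qed.

End conclusion.

Theorem corollary5p4 (R : realType) :
  exists (J : set (Cspace R 3)) (a : Cspace R 3),
    is_arc R J /\
    polynomially_convex J /\
    is_arc_end_point R J a /\
    J `&` @closed_unit_ball R 3 = [set a] /\
    ~ rationally_convex (@closed_unit_ball R 3 `|` J).
Proof.
have [a [a_bnd aN aout]] := last_exit R.
pose J : set (Cspace R 3) := @path R @` `[a, 1].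
pose f s : Cspace R 3 := path (a + s * (1 - a)).
have fJ : f @` `[0, 1] = J.
  apply/seteqP; split=> v [s]; rewrite /= in_itv /= => s01 <-.
    exists (a + s * (1 - a)) => //=; rewrite in_itv /=.
    by have /andP[s0 s1] := s01; apply/andP; split; nra.
  exists ((s - a) / (1 - a)).
    rewrite /= in_itv /= divr_ge0 ?ler_pdivrMr; lra.
  by rewrite /f divfK; [rewrite addrC subrK|rewrite gt_eqF//; lra].
have fh : homeomorphism_on (`[0, 1] : set R) J f.
  rewrite -fJ; apply: homeomorphism_of_injective.
    move=> i; apply: (@ucont_comp _ _ _ _ _ (@distR R)) (path_coords_bucont R i).2.
    apply: (@lipschitz_ucont _ _ _ _ _ _ (1 - a)); first by lra.
    move=> s t; rewrite /distR (_ : _ - _ = (1 - a) * (s - t)); last by lra.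
    by rewrite normrM ger0_norm//; lra.
  move=> s t s01 t01 /path_inj E.
  have : a + s * (1 - a) = a + t * (1 - a).
    by apply: E; apply/andP; split; nra.
  by move=> /addrI /mulIf; apply; rewrite gt_eqF//; lra.
exists J, (path a); split; first by exists f.
split; first by apply: arc_polynomially_convex; lra.
split; first by exists f => //; left; rewrite /f mul0r addr0.
split.
  apply/seteqP; split=> [v [[t]]|v ->].
    rewrite /= in_itv /= => /andP[at1 t1] <- tB.
    have [->//|ta] := eqVneq t a.
    have : 1 < sumsq (path t) by apply: aout; rewrite t1 lt_neqAle eq_sym ta at1.
    have tB' : sumsq (path t) <= 1 by exact: tB.
    by rewrite ltNge tB'.
  split; last exact: aN.
  by exists a => //=; rewrite in_itv /= lexx; lra.
move=> conv; have : (@closed_unit_ball R 3 `|` J) (hull_point R).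
  rewrite -conv => p; apply: contrapT => H.
  pose q := p - mpoly.mpolyC 3 (peval p (hull_point R)).
  have qE v : peval q v = peval p v - peval p (hull_point R).
    by rewrite /peval mpoly.mevalB mpoly.mevalC.
  have : peval q (hull_point R) != 0.
    apply: no_avoiding_hypersurface => [v vB|t t01]; rewrite qE subr_eq0;
      apply/eqP => E; apply: H.
      by exists v => //; left.
    by exists (path t) => //; right; exists t => //=; rewrite in_itv /=; lra.
  by rewrite qE subrr eqxx.
move=> [|[t]]; first exact: hull_point_not_in_ball.
by rewrite /= in_itv /= => t1; apply: hull_point_not_on_path; lra.
Qed.
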